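(* Let $G$ be a finite alphabet, let $\mathfrak{G}\subseteq G^{\mathbb{Z}}$ be an irreducible topological Markov chain using all letters of $G$, with topological entropy $\mathbf{h}(\mathfrak{G})=\log p$ where $p$ is a prime number, and let $(\mathfrak{G},\Phi)$ be a structurally compatible affine cellular automaton. Let $\mu$ be a $(\Phi,\sigma)$-invariant probability measure on $\mathfrak{G}$. Suppose that (i) $\mu$ is ergodic for the action $(\Phi,\sigma)$; (ii) $\mu$ has positive entropy for $\Phi$; (iii) the sigma-algebra of the $\sigma^{(p-1)p}$-invariant sets coincides mod $\mu$ with the sigma-algebra of the $\sigma$-invariant sets. Then $\mu$ is the Parry measure.
   Context: $\sigma$ is the shift map, $(\sigma(\mathbf{g}))_n=g_{n+1}$; $\mathbf{h}(\mathfrak{G})$ is the topological entropy of $\sigma$ on $\mathfrak{G}$. A subshift is a topological Markov chain if for every allowed word $(g_1,\dots,g_k)$ the set of letters that may follow it depends only on $g_k$; it is irreducible if for all letters $u,w$ there is an allowed word $(u,v_1,\dots,v_k,w)$ with $k\ge1$. The Parry measure is the unique maximum entropy measure of $(\mathfrak{G},\sigma)$. A cellular automaton $(\mathfrak{G},\Phi)$ with radio $1$ is given by a map $\phi:G\times G\to G$ (the local rule) such that $\Phi(\mathbf{x})=(\phi(x_i,x_{i+1}))_{i\in\mathbb{Z}}$ maps $\mathfrak{G}$ into $\mathfrak{G}$. It is structurally compatible if it has radio $1$ and $(x_i),(y_i)\in\mathfrak{G}$ implies $(\phi(x_i,y_i))_{i\in\mathbb{Z}}\in\mathfrak{G}$.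 It is affine if $\phi(a,b)=\eta(a)+\rho(b)+c$, where $+$ is an Abelian group operation on $G$, $\eta,\rho:G\to G$ are commuting automorphisms of $(G,+)$, and $c\in G$. A measure is $(\Phi,\sigma)$-invariant if it is invariant under both $\Phi$ and $\sigma$; it is ergodic for the action $(\Phi,\sigma)$ if every measurable set invariant under both $\Phi$ and $\sigma$ has measure $0$ or $1$. *)

(* Defs.v *)
From HB Require Import structures.
From mathcomp Require Import all_boot all_order all_algebra.
From mathcomp Require Import all_classical all_reals all_analysis.

Set Implicit Arguments.
Unset Strict Implicit.
Unset Printing Implicit Defensive.
Import Order.TTheory GRing.Theory Num.Theory.
Import numFieldNormedType.Exports.
Local Open Scope classical_set_scope.
Local Open Scope ring_scope.

(* Nonempty finite types; [measurableType] requires a [pointedType]. *)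
#[short(type="pfinType")]
HB.structure Definition PointedFinite := { T of Finite T & Pointed T }.

(* The space [G^Z] with the product of the discrete topologies and the product
   sigma-algebra (generated by the one-letter cylinders). *)
Definition config (G : Type) : Type := int -> G.

Definition cylinders (G : Type) : set (set (config G)) :=
  [set A | exists (i : int) (g : G), A = [set x | x i = g]].

HB.instance Definition _ (G : pfinType) := Pointed.copy (config G) (int -> G).
HB.instance Definition _ (G : pfinType) :=
  Topological.copy (config G) (prod_topology (fun _ : int => discrete_topology G)).
HB.instance Definition _ (G : pfinType) :=
  Measurable.copy (config G) (g_sigma_algebraType (@cylinders G)).

Definition config_shift (G : Type) (x : config G) : config G := fun i => x (i + 1).

Section subshifts.
Context (G : pfinType).
Implicit Type X : set (config G).

Definition is_subshift X : Prop := closed X /\ @config_shift G @^-1` X = X.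

Definition allowed X (w : seq G) : Prop :=
  exists2 x, X x & exists i : int, w = mkseq (fun k => x (i + k%:Z)) (size w).

Definition is_markov_chain X : Prop :=
  is_subshift X /\
  forall (w w' : seq G) (g : G),
    allowed X (rcons w g) -> allowed X (rcons w' g) ->
    [set a | allowed X (rcons (rcons w g) a)] =
    [set a | allowed X (rcons (rcons w' g) a)].

Definition irreducible_shift X : Prop :=
  forall u w : G, exists v : seq G, (0 < size v)%N /\ allowed X (u :: rcons v w).

Definition uses_all_letters X : Prop := forall g : G, allowed X [:: g].

Definition block_map (phi : G -> G -> G) (x : config G) : config G :=
  fun i => phi (x i) (x (i + 1)).

Definition is_cellular_automaton X (phi : G -> G -> G) : Prop :=
  forall x, X x -> X (block_map phi x).

Definition structurally_compatible X (phi : G -> G -> G) : Prop :=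
  forall x y, X x -> X y -> X (fun i => phi (x i) (y i)).

End subshifts.

Definition is_abelian_group (G : Type) (add : G -> G -> G) : Prop :=
  exists (zero : G) (opp : G -> G),
    [/\ associative add, commutative add, left_id zero add
      & left_inverse zero opp add].

Definition is_automorphism (G : Type) (add : G -> G -> G) (f : G -> G) : Prop :=
  bijective f /\ {morph f : x y / add x y}.

Definition is_affine (G : Type) (phi : G -> G -> G) : Prop :=
  exists (add : G -> G -> G) (eta rho : G -> G) (c : G),
    [/\ is_abelian_group add, is_automorphism add eta, is_automorphism add rho,
        eta \o rho =1 rho \o eta
      & forall a b, phi a b = add (add (eta a) (rho b)) c].

(* The cell of index [w] in the join of [U], f^-1 U, ..., f^-(n-1) U. *)
Definition join_cell (T : Type) (f : T -> T) (k : nat) (U : 'I_k -> set T)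
    (n : nat) (w : {ffun 'I_n -> 'I_k}) : set T :=
  [set x | forall i : 'I_n, U (w i) (iter i f x)].

Section topological_entropy.
Context (R : realType) (T : topologicalType).

(* Covers of [X] by traces of open sets of [T]. *)
Definition is_open_cover (X : set T) (k : nat) (U : 'I_k -> set T) : Prop :=
  (forall i, open (U i)) /\ X `<=` \bigcup_i U i.

(* The least cardinality of a subcover of the [n]-fold join; the bound [k ^ n]
   is attained by the whole join when [U] covers the [f]-stable set [X]. *)
Definition cover_number (X : set T) (f : T -> T) (k : nat)
    (U : 'I_k -> set T) (n : nat) : nat :=
  \big[minn/(k ^ n)%N]_(S : {set {ffun 'I_n -> 'I_k}}
      | `[< X `<=` \bigcup_(w in [set` S]) join_cell f U w >]) #|S|.

Definition cover_entropy (X : set T) (f : T -> T) (k : nat)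
    (U : 'I_k -> set T) : \bar R :=
  limn (fun n => (ln (cover_number X f U n)%:R / n%:R)%:E).

(* Adler-Konheim-McAndrew entropy of [f] on the compact [f]-stable set [X]; by
   compactness the supremum over finite open covers is the one over all open
   covers. *)
Definition topological_entropy (X : set T) (f : T -> T) : \bar R :=
  ereal_sup [set h | exists (k : nat) (U : 'I_k -> set T),
    is_open_cover X U /\ h = cover_entropy X f U].

End topological_entropy.

Section measure_entropy.
Context (R : realType) (d : measure_display) (T : measurableType d).
Implicit Types (mu : probability T R) (f : T -> T).

Definition is_measurable_partition (k : nat) (P : 'I_k -> set T) : Prop :=
  [/\ forall i, measurable (P i), trivIset setT P & \bigcup_i P i = setT].

Definition join_entropy mu f (k : nat) (P : 'I_k -> set T) (n : nat) : R :=
  \sum_(w : {ffun 'I_n -> 'I_k})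
    - (fine (mu (join_cell f P w)) * ln (fine (mu (join_cell f P w)))).

Definition partition_entropy mu f (k : nat) (P : 'I_k -> set T) : \bar R :=
  limn (fun n => (join_entropy mu f P n / n%:R)%:E).

(* Kolmogorov-Sinai entropy. *)
Definition measure_entropy mu f : \bar R :=
  ereal_sup [set h | exists (k : nat) (P : 'I_k -> set T),
    is_measurable_partition P /\ h = partition_entropy mu f P].

Definition invariant_measure mu f : Prop :=
  forall A, measurable A -> mu (f @^-1` A) = mu A.

(* The sigma-algebra of invariant sets of the restriction of [f] to [X]. *)
Definition invariant_sets (X : set T) f : set (set T) :=
  [set A | [/\ measurable A, A `<=` X & X `&` f @^-1` A = A]].

Definition ergodic_action (X : set T) mu f g : Prop :=
  forall A, invariant_sets X f A -> invariant_sets X g A ->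
    mu A = 0%E \/ mu A = 1%E.

Definition coincide_mod mu (F F' : set (set T)) : Prop :=
  (forall A, F A -> exists2 B, F' B & mu (A `+` B) = 0%E) /\
  (forall B, F' B -> exists2 A, F A & mu (A `+` B) = 0%E).

End measure_entropy.

Section parry.
Context (R : realType) (G : pfinType).
Implicit Types (X : set (config G)) (mu : probability (config G) R).

(* Probability measures on [X] are those on [G^Z] giving mass 1 to [X]. *)
Definition shift_invariant_on X mu : Prop :=
  mu X = 1%E /\ invariant_measure mu (@config_shift G).

Definition max_entropy_measure X mu : Prop :=
  shift_invariant_on X mu /\
  forall nu : probability (config G) R, shift_invariant_on X nu ->
    (measure_entropy nu (@config_shift G) <= measure_entropy mu (@config_shift G))%E.

Definition is_parry_measure X mu : Prop :=
  max_entropy_measure X mu /\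
  forall nu : probability (config G) R, max_entropy_measure X nu ->
    forall A, measurable A -> nu A = mu A.

End parry.

(* Main.v *)
(* Compatibility with the affine rule makes the differences of points of [X] a
   group of walks on a group of edges, in which every letter has [p] successors.
   A nonzero walk [z] of minimal finite support generates, by convolution, a copy
   of the full shift over [F_p], on which the automorphisms act as two nonzero
   scalars. So the linear part of [Phi] has a kernel [K1] of order [p] there, its
   square has a kernel [K2] of order [p ^ 2], and [K1] accounts for all the fibers
   of [Phi] in [X].

   Let [f] be the density of [mu] with respect to the sum of its translates by
   [K2]. The shift permutes [K2] with period dividing [(p - 1) p], so (iii) makes
   the translates of [f] by elements of [K2] invariant under the shift, and
   hence constant along the cosets of [K1] in [K2] other than [K1] itself.
   With ergodicity this leaves two cases. Either [Phi] is injective on a set of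
   full measure: then [x 0] is a function of [Phi x] and the entropy of [Phi]
   vanishes, against (ii). Or [f] is invariant under [K1], and so is [mu]. Pulling
   this invariance back along [Phi], [mu] is preserved by translations that fix
   [x 0], ..., [x n] and move [x (n + 1)] to any other successor of [x n]. Each
   word thus gives equal mass to its [p] extensions, and such a measure is the
   Parry measure. *)
Require Import Defs.
From HB Require Import structures.
From mathcomp Require Import all_boot all_order all_algebra all_fingroup.
From mathcomp Require Import all_classical all_reals all_analysis measurable_realfun.
From mathcomp Require Import finfield zify ring lra.
Set Implicit Arguments.
Unset Strict Implicit.
Unset Printing Implicit Defensive.
Import Order.TTheory GRing.Theory Num.Theory.
Import numFieldNormedType.Exports.
Local Open Scope classical_set_scope.
Local Open Scope ring_scope.

(** * Subshifts and their edges *)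

(** The space [X] need not be a group, nor even one coset of the convolutions: a periodic chain
    splits into several cosets, permuted by the shift. Two points of [X] are therefore comparable
    only up to a shift, and that the points of one fiber differ by a convolution needs an argument
    of its own. The number (p - 1) p comes from the coordinates of [K2]. Its elements are the
    convolutions with coefficients (A + B i) r^i, where r = - a / b, and the shift acts on (A, B) as
    r times a unipotent Jordan block: r contributes p - 1 and the block contributes p. On [K1],
    where B = 0, the shift acts by the scalar r alone, which may be 1; it is the block, moving A to
    A - B, that links all the elements of a coset. This is why the density is taken over [K2].
    Constancy on the cosets other than [K1] is relative to a base point. To learn about x + [K1] the
    base point is moved to a point of x + [K2], outside x + [K1], with positive density. Where no
    such point exists, almost surely the image of x shares its fiber with no other point of positive
    density. This makes the set of points with such a partner invariant, so that ergodicity applies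
    to it. *)

Section config_topology.
Context (G : pfinType).
Implicit Types (x y : config G).

Lemma nbhs_coord x (i : int) : nbhs x [set y | y i = x i].
Proof.
have := @proj_continuous int (fun=> discrete_topology G) i x [set x i].
by apply; exact: discrete_set1.
Qed.

Lemma cvg_config (F : set_system (config G)) x : Filter F ->
  (forall i, F [set y | y i = x i]) -> F --> x.
Proof.
move=> FF Fx; apply/cvg_sup => i A /= [_ [[B _ <-] Bx BA]].
by apply: filterS (Fx i) => y /= yx; apply: BA => /=; rewrite yx.
Qed.

Definition cyl (n : nat) x : set (config G) :=
  [set y | forall i, (`|i| <= n)%N -> y i = x i].

Lemma nbhs_cyl n x : nbhs x (cyl n x).
Proof.
elim: n => [|n IHn].
  apply: filterS (nbhs_coord x 0) => y /= yx i; rewrite leqn0 absz_eq0.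
  by move=> /eqP ->.
apply: filterS3 IHn (nbhs_coord x n.+1) (nbhs_coord x (- n.+1%:Z)).
move=> y yx /= yx1 yx2 i; rewrite leq_eqVlt ltnS => /orP[/eqP ni|]; last exact: yx.
by case: (intP i) ni => [|k|k] //; rewrite ?absz_nat ?abszN => - [->].
Qed.
(** Otherwise pick for every [n] a point of [cyl n x] outside [U]; these points converge to [x]
    coordinatewise, against [U] being a neighborhood. *)
Lemma nbhs_cylP (U : set (config G)) x : nbhs x U <-> exists n, cyl n x `<=` U.
Proof.
split=> [|[n nU]]; last exact: filterS (nbhs_cyl n x).
move=> xU; apply: contrapT => /forallNP nU.
have yP n : {y | cyl n x y & ~ U y}.
  apply: cid2; apply: contrapT => yU; apply: (nU n) => y yx.
  by apply: contrapT => Uy; apply: yU; exists y.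
have : (fun n => s2val (yP n)) @ \oo --> x.
  apply: cvg_config => i; exists `|i|%N => // n /= ni.
  exact: (s2valP (yP n)).
by move=> /(_ _ xU) [n _ /(_ n (leqnn n))] /=; exact: (s2valP' (yP n)).
Qed.

Lemma config_compact : compact [set: config G].
Proof.
have Gcompact : compact [set: discrete_topology G].
  by apply: finite_compact; exact: (@finite_finset G).
have := @tychonoff int (fun=> discrete_topology G) (fun=> setT) (fun=> Gcompact).
by congr compact; apply/seteqP; split.
Qed.

(** A Lebesgue number: points of [X] defeating every [n] would cluster at some [x] in [X], and a
    cylinder around [x] inside some [U i] contains the cylinder around a late point close to [x]. *)
Lemma config_lebesgue_number (X : set (config G)) (k : nat)
    (U : 'I_k -> set (config G)) : closed X -> is_open_cover X U ->
  exists n, forall x, X x -> exists i, cyl n x `<=` U i.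
Proof.
move=> Xcl [Uop XU]; apply: contrapT => /forallNP nU.
have xP n : {x | X x & forall i, ~ cyl n x `<=` U i}.
  apply: cid2; apply: contrapT => xU; apply: (nU n) => x Xx.
  apply: contrapT => Ux; apply: xU; exists x => // i xUi.
  by apply: Ux; exists i.
have := @subclosed_compact _ _ setT Xcl config_compact (@subsetT _ _).
move=> /(_ ((fun n => s2val (xP n)) @ \oo)).
case=> [|x [Xx xcl]]; first by exists 0%N => // n _; exact: (s2valP (xP n)).
have [i _ Ux] := XU _ Xx.
have /nbhs_cylP[n nU'] : nbhs x (U i) by apply: open_nbhs_nbhs; split.
have [_ [[m nm <-] yx]] : [set s2val (xP m) | m in [set m | (n <= m)%N]] `&`
    cyl n x !=set0.
  apply: xcl (nbhs_cyl n x); exists n => // m nm.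
  by exists m.
apply: (s2valP' (xP m) i) => y ym; apply: nU' => j jn.
by rewrite ym ?yx// (leq_trans jn).
Qed.

End config_topology.

Section markov_edges.
Context (G : pfinType) (X : set (config G)).

Definition edge : rel G := fun a b => `[< exists x, [/\ X x, x 0 = a & x 1 = b] >].

Definition shift_by (n : int) (x : config G) : config G := fun i => x (i + n).

Lemma shift_byD m n x : shift_by m (shift_by n x) = shift_by (m + n) x.
Proof. by apply/funext => i; rewrite /shift_by addrA. Qed.

Lemma shift_by0 x : shift_by 0 x = x.
Proof. by apply/funext => i; rewrite /shift_by addr0. Qed.

Lemma iter_shift n x : iter n (@config_shift G) x = shift_by n%:Z x.
Proof.
elim: n => [|n IH]; first by rewrite shift_by0.
by rewrite iterS IH /config_shift /shift_by; apply/funext => i; congr (x _); lia.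
Qed.

Lemma subshift_by (n : int) x : is_subshift X -> X (shift_by n x) = X x.
Proof.
move=> [_ sX]; have XS y : X (shift_by 1 y) = X y by rewrite -{2}sX.
have XP k y : X (shift_by k%:Z y) = X y.
  by elim: k y => [|k IH] y; rewrite ?shift_by0// intS -shift_byD XS.
case: (intP n) => [|k|k]; rewrite ?XP//.
by rewrite -(XP k.+1) shift_byD subrr shift_by0.
Qed.

Hypothesis X_markov : is_markov_chain X.

(** As [X] is closed, it is enough that all the words of [x] are allowed. They grow letter by
    letter: the Markov property compares the long word with the one-letter word that ends in the
    same letter. *)
Lemma markov_edgesP x : X x <-> forall i, edge (x i) (x (i + 1)).
Proof.
have [Xsub Xfol] := X_markov.
split=> [Xx i|Ex].
  by apply/asboolP; exists (shift_by i x); rewrite subshift_by// /shift_by add0r addrC.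
have all_words n i : allowed X (mkseq (fun k => x (i + k%:Z)) n.+1).
  elim: n => [|n IH].
    have /asboolP[y [Xy y0 _]] := Ex i.
    by exists y => //; exists 0; rewrite /mkseq /= addr0; congr [:: _]; exact: esym y0.
  have /asboolP[y [Xy y0 y1]] := Ex (i + n%:Z).
  have y01 : allowed X (rcons (rcons [::] (x (i + n%:Z))) (x (i + n.+1%:Z))).
    exists y => //; exists 0; congr [:: _; _]; first exact: esym y0.
    by rewrite -addn1 PoszD addrA; exact: esym y1.
  have y0' : allowed X (rcons [::] (x (i + n%:Z))).
    by exists y => //; exists 0; congr [:: _]; exact: esym y0.
  have -> : mkseq (fun k => x (i + k%:Z)) n.+2 =
      rcons (rcons (mkseq (fun k => x (i + k%:Z)) n) (x (i + n%:Z)))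
        (x (i + n.+1%:Z)).
    by rewrite !mkseqS.
  have IH' : allowed X (rcons (mkseq (fun k => x (i + k%:Z)) n) (x (i + n%:Z))).
    by move: IH; rewrite mkseqS.
  by have /seteqP[+ _] := Xfol [::] _ (x (i + n%:Z)) y0' IH'; exact.
have [Xcl _] := Xsub; apply: Xcl => U /nbhs_cylP[n nU].
have [y Xy [i yx]] := all_words (n.*2) (- n%:Z).
exists (shift_by (i + n%:Z) y); split; first by rewrite subshift_by.
apply: nU => j jn.
have := congr1 (fun s => nth (x 0) s (absz (j + n%:Z)%R)) yx.
rewrite size_mkseq !nth_mkseq; [|lia..].
have -> : (absz (j + n%:Z)%R : int) = j + n%:Z by lia.
rewrite /shift_by => xy; transitivity (y (i + (j + n%:Z))).
  by congr (y _); lia.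
by rewrite -xy; congr (x _); lia.
Qed.

Lemma markov_edge_shift x i : X x -> edge (x i) (x (i + 1)).
Proof. by move=> /markov_edgesP. Qed.

Lemma edge_path (a : G) (w : seq G) : allowed X (a :: w) -> path edge a w.
Proof.
move=> [x Xx [i]].
elim: w a i => //= b w IH a i [-> -> wE]; rewrite addr0 markov_edge_shift//=.
apply: (IH _ (i + 1)); rewrite /mkseq /= addr0; congr (_ :: _).
rewrite {1}wE (iotaDl 1) -map_comp.
by apply/eq_map => k /=; congr (x _); lia.
Qed.

Lemma glue_path x x' (w : seq G) : X x -> X x' ->
  path edge (x 0) w -> last (x 0) w = x' 0 ->
  exists y, [/\ X y, forall i, i <= 0 -> y i = x i,
    forall i, 0 <= i -> y (i + (size w)%:Z) = x' i &
    forall j, (j <= size w)%N -> y j%:Z = nth (x 0) (x 0 :: w) j].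
Proof.
move=> Xx Xx' Ew lastw; pose n := size w.
pose y : config G := fun i =>
  if i < 0 then x i else if i < n%:Z then nth (x 0) (x 0 :: w) `|i| else x' (i - n%:Z).
have yx' i : 0 <= i -> y (i + n%:Z) = x' i.
  by move=> i0; rewrite /y ifF ?ifF ?addrK//; lia.
have yw j : (j <= n)%N -> y j%:Z = nth (x 0) (x 0 :: w) j.
  rewrite leq_eqVlt => /orP[/eqP ->|jn]; last by rewrite /y /= ifT.
  by rewrite -[n%:Z]add0r yx'// -lastw -[RHS]/(nth (x 0) (x 0 :: w) (size (x 0 :: w)).-1) nth_last.
have yx i : i <= 0 -> y i = x i.
  by rewrite le_eqVlt => /orP[/eqP->|i0]; [rewrite yw|rewrite /y i0].
exists y; split=> //; apply/markov_edgesP => i.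
have [i0|i0] := ltP i 0; first by rewrite !yx; [exact: (markov_edgesP x).1|lia..].
have [ni|ni] := leP n%:Z i.
  have := (markov_edgesP x').1 Xx' (i - n%:Z); rewrite -!yx'; [|lia..].
  by rewrite [_ + 1]addrAC !subrK.
have -> : i + 1 = (absz i).+1%:Z by lia.
have -> : i = (absz i)%:Z by lia.
rewrite !yw; [|lia..].
by move/(pathP (x 0)): Ew; apply; rewrite -/n; lia.
Qed.

Lemma realize_path g (w : seq G) : (forall h, exists2 x, X x & x 0 = h) ->
  path edge g w -> exists2 x, X x &
    forall j, (j <= size w)%N -> x j%:Z = nth g (g :: w) j.
Proof.
move=> letters gw; have [x Xx x0] := letters g.
have [x' Xx' x'0] := letters (last g w); rewrite -x0 in gw.
have [|y [Xy _ _ yw]] := glue_path Xx Xx' gw; first by rewrite x0.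
by exists y => // j jw; rewrite yw// x0.
Qed.

Lemma letter_point : uses_all_letters X -> forall h, exists2 x, X x & x 0 = h.
Proof.
move=> letters h; have [x Xx [i [->]]] := letters h.
exists (shift_by i x); last by rewrite /shift_by add0r addr0.
by rewrite (subshift_by _ _ X_markov.1).
Qed.

Lemma path_of_point x i n : X x ->
  path edge (x i) (mkseq (fun j => x (i + j.+1%:Z)) n).
Proof.
move=> Xx; apply/(pathP (x i)) => j; rewrite size_mkseq => jn.
rewrite nth_mkseq// -addn1 PoszD addrA.
have -> : nth (x i) (x i :: mkseq (fun k => x (i + k.+1%:Z)) n) j = x (i + j%:Z).
  by case: j jn => [|j] jn /=; rewrite ?addr0// nth_mkseq// ltnW.
exact: markov_edge_shift.
Qed.

End markov_edges.

(** * Affine rules compatible with the edges *)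

HB.mixin Record hasAbelianLaw (T : Type) := {
  law_zero : T; law_opp : T -> T; law_add : T -> T -> T;
  law_addA : associative law_add; law_addC : commutative law_add;
  law_add0 : left_id law_zero law_add;
  law_addN : left_inverse law_zero law_opp law_add }.

#[short(type="abelianAlphabet")]
HB.structure Definition AbelianAlphabet :=
  { T of PointedFinite T & hasAbelianLaw T }.

HB.instance Definition _ (G : abelianAlphabet) :=
  GRing.isZmodule.Build G law_addA law_addC law_add0 law_addN.

(** [is_affine] only asserts that some group law exists; here the law becomes a [zmodType] structure
    on the alphabet. Destructing the alphabet makes the rebuilt structure convertible to the
    original one, so nothing has to be transported. *)
Lemma abelian_alphabet_ind (P : forall G : pfinType, (G -> G -> G) -> Prop) :
  (forall G : abelianAlphabet, P G (+%R : G -> G -> G)) ->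
  forall (G : pfinType) (add : G -> G -> G), is_abelian_group add -> P G add.
Proof.
move=> HP G add [zero [opp [addA addC add0 addN]]].
case: G add zero opp addA addC add0 addN => T [a1 a2 a3 a4 a5].
move=> add zero opp addA addC add0 addN.
pose G := PointedFinite.Pack (@PointedFinite.Class T a1 a2 a3 a4 a5).
pose Z := hasAbelianLaw.Build G addA addC add0 addN.
pose H : abelianAlphabet := HB.pack_for abelianAlphabet T G Z.
exact: (HP H).
Qed.

Lemma card_path_tuples (T : finType) (e : rel T) (k n : nat) (a : T) :
  (forall b, #|[set c | e b c]%SET| = k) ->
  #|[set t : n.-tuple T | path e a t]%SET| = (k ^ n)%N.
Proof.
move=> ek; elim: n a => [|n IHn] a.
  rewrite expn0 (eq_card (B := predT)) ?card_tuple ?expn0// => t.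
  by rewrite !inE tuple0.
rewrite expnS -{1}(ek a) -sum1_card big_set/=.
rewrite (reindex (fun u : T * n.-tuple T => [tuple of u.1 :: u.2])) /=; last first.
  exists (fun t : n.+1.-tuple T => (thead t, [tuple of behead t])).
    by move=> [b t] _; congr pair; apply: val_inj.
  by move=> t _; rewrite /= -tuple_eta.
rewrite -sum_nat_const (eq_bigl (fun u : T * n.-tuple T => e a u.1 && path e u.1 u.2))//.
rewrite -(pair_big_dep (e a) (fun b (t : n.-tuple T) => path e b t) (fun _ _ => 1%N))/=.
rewrite [RHS](eq_bigl (e a)); last by move=> b; rewrite inE.
apply: eq_bigr => b _.
by rewrite sum1_card -(IHn b); apply: eq_card => t; rewrite !inE.
Qed.

Lemma injective_stable_onto (T : finType) (f : T -> T) (S : {set T}) :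
  injective f -> (forall x, x \in S -> f x \in S) ->
  forall y, y \in S -> exists2 x, x \in S & f x = y.
Proof.
move=> finj fS y yS; have : (f @: S)%SET = S.
  apply/eqP; rewrite eqEcard card_imset// leqnn andbT.
  by apply/fintype.subsetP => _ /imsetP[x xS ->]; exact: fS.
by move=> fSE; move: yS; rewrite -{1}fSE => /imsetP[x xS ->]; exists x.
Qed.

(** By Lagrange the order of [z] divides [p] and is not 1, so the multiples of [z] fill [S]. *)
Lemma prime_order_generated (V : finZmodType) (S : {set V}) (p : nat) (z : V) :
  prime p -> #|S| = p -> 0 \in S ->
  (forall x y, x \in S -> y \in S -> x + y \in S) -> z \in S -> z != 0 ->
  (z *+ p = 0) /\ (forall x, x \in S -> exists k : 'I_p, x = z *+ k).
Proof.
move=> pp Sp S0 SD Sz z0.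
have gS : group_set S by apply/group_setP; split.
pose Sg := Group gS.
have zSg : (<[z]>%g \subset Sg) by rewrite cycle_subG.
have oz : #[z]%g = p.
  have := cardSg zSg; rewrite /= Sp => /(primeP pp).2 /orP[|/eqP//].
  by rewrite -/(order z) order_eq1 (negPf z0).
have SE : <[z]>%g = S.
  by apply/eqP; rewrite eqEcard zSg Sp; move: oz; rewrite /order => ->; rewrite leqnn.
split; first by rewrite -FinRing.zmodXgE -oz expg_order.
move=> x; rewrite -SE => /cyclePmin[k kz ->]; rewrite oz in kz.
by exists (Ordinal kz); rewrite FinRing.zmodXgE.
Qed.

Section edge_algebra.
Context (G : abelianAlphabet) (E : rel G) (eta rho : G -> G) (c : G).
Let phi a b := eta a + rho b + c.
Hypotheses (eta_inj : injective eta) (rho_inj : injective rho).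
Hypotheses (etaD : {morph eta : x y / x + y}) (rhoD : {morph rho : x y / x + y}).
Hypothesis E_phi : forall a b a' b', E a b -> E a' b' -> E (phi a a') (phi b b').
Hypotheses (E_succ : forall a, exists b, E a b) (E_pred : forall b, exists a, E a b).

(* In the notation [a . b := phi a b]: if [y . u = y], [t . u = x] and
   [y . v = z], then [t . v = x - y + z]. *)
Lemma edge_malcev a b a' b' a'' b'' : E a b -> E a' b' -> E a'' b'' ->
  E (a - a' + a'') (b - b' + b'').
Proof.
pose S := [set e : G * G | E e.1 e.2]%SET.
have divr (y z : G * G) : y \in S -> z \in S -> exists2 u, u \in S &
    (phi y.1 u.1, phi y.2 u.2) = z.
  move=> yS; apply: (@injective_stable_onto _ (fun u => (phi y.1 u.1, phi y.2 u.2))).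
    move=> [u1 u2] [v1 v2] /= [/addIr/addrI/rho_inj -> /addIr/addrI/rho_inj ->].
    by [].
  by move=> u; move: yS; rewrite !inE /=; exact: E_phi.
have divl (u x : G * G) : u \in S -> x \in S -> exists2 t, t \in S &
    (phi t.1 u.1, phi t.2 u.2) = x.
  move=> yS; apply: (@injective_stable_onto _ (fun t => (phi t.1 u.1, phi t.2 u.2))).
    move=> [u1 u2] [v1 v2] /= [/addIr/addIr/eta_inj -> /addIr/addIr/eta_inj ->].
    by [].
  by move=> t + ; move: yS; rewrite !inE /= => + /E_phi h => /h.
move=> xS yS zS.
have [u uS [u1 u2]] := divr (a', b') (a', b') ltac:(by rewrite inE) ltac:(by rewrite inE).
have [t tS [t1 t2]] := divl u (a, b) uS ltac:(by rewrite inE).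
have [v vS [v1 v2]] := divr (a', b') (a'', b'') ltac:(by rewrite inE) ltac:(by rewrite inE).
have malcev y0 x0 z0 t0 u0 v0 : phi y0 u0 = y0 -> phi t0 u0 = x0 -> phi y0 v0 = z0 ->
    phi t0 v0 = x0 - y0 + z0.
  move=> h1 <- <-; have -> : phi t0 u0 - y0 = eta t0 - eta y0.
    by rewrite -[X in _ - X]h1 /phi -[X in X - _]addrA -[X in _ - X]addrA opprD addrACA subrr addr0.
  by rewrite /phi -!addrA addKr.
rewrite -(malcev _ _ _ _ _ _ u1 t1 v1) -(malcev _ _ _ _ _ _ u2 t2 v2).
by apply: E_phi; move: tS vS; rewrite !inE.
Qed.

(** The translations of edges to edges. By [edge_malcev] they are exactly the differences of two
    edges; they form a group, of which [E] is a coset. *)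
Definition dedge (u v : G) := [forall a, forall b, E a b ==> E (a + u) (b + v)].

Lemma dedgeP u v : reflect (forall a b, E a b -> E (a + u) (b + v)) (dedge u v).
Proof.
apply: (iffP forallP) => [h a b ab|h a].
  by have /forallP/(_ b)/implyP := h a; apply.
by apply/forallP => b; apply/implyP; exact: h.
Qed.

Lemma dedge_sub a b a' b' : E a b -> E a' b' -> dedge (a - a') (b - b').
Proof.
move=> ab ab'; apply/dedgeP => x y xy.
by rewrite addrC [y + _]addrC; exact: edge_malcev.
Qed.

Lemma dedgeE u v : dedge u v -> exists a b, E a b /\ E (a + u) (b + v).
Proof.
move=> /dedgeP uv; have [b ab] := E_succ 0.
by exists 0, b; split=> //; exact: uv.
Qed.

Lemma dedge0 : dedge 0 0.
Proof. by apply/dedgeP => a b; rewrite !addr0. Qed.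

Lemma dedgeD u v u' v' : dedge u v -> dedge u' v' -> dedge (u + u') (v + v').
Proof.
move=> /dedgeP uv /dedgeP uv'; apply/dedgeP => a b ab.
by rewrite !addrA; apply/uv'/uv.
Qed.

Lemma dedgeN u v : dedge u v -> dedge (- u) (- v).
Proof.
move=> /dedgeE[a [b [ab abu]]].
have := dedge_sub ab abu; by rewrite !opprD !addrA !subrr !add0r.
Qed.

Lemma dedgeB u v u' v' : dedge u v -> dedge u' v' -> dedge (u - u') (v - v').
Proof. by move=> uv uv'; apply: dedgeD => //; exact: dedgeN. Qed.

Lemma dedgeMn u v k : dedge u v -> dedge (u *+ k) (v *+ k).
Proof.
move=> uv; elim: k => [|k IHk]; first exact: dedge0.
by rewrite !mulrS; exact: dedgeD.
Qed.

(** Varying only the first argument of [phi] along edges leaves the difference [eta u]; the other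
    terms cancel. *)
Lemma dedge_eta u v : dedge u v -> dedge (eta u) (eta v).
Proof.
move=> /dedgeE[a [b [ab abu]]].
have := dedge_sub (E_phi abu ab) (E_phi ab ab).
suff L (s t r : G) : s + t + r + c - (s + r + c) = t by rewrite /phi !etaD !L.
have -> : s + t + r + c = t + (s + r + c) by rewrite [s + t]addrC -!addrA.
by rewrite addrK.
Qed.

Lemma dedge_rho u v : dedge u v -> dedge (rho u) (rho v).
Proof.
move=> /dedgeE[a [b [ab abu]]].
have := dedge_sub (E_phi ab abu) (E_phi ab ab).
suff L (s t r : G) : s + (r + t) + c - (s + r + c) = t by rewrite /phi !rhoD !L.
by rewrite addrA [s + r + t + c]addrAC [X in X - _]addrC addrK.
Qed.
(** The successors of [a] form a coset of the group of followers of [0]. In particular all letters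
    have equally many successors. *)
Lemma card_succ a : #|[set b | E a b]%SET| = #|[set v | dedge 0 v]%SET|.
Proof.
have [b0 ab0] := E_succ a.
rewrite -(card_imset _ (addIr (- b0))); apply: eq_card => v.
apply/imsetP/idP; rewrite inE.
  by move=> [b]; rewrite inE => ab ->; have := dedge_sub ab ab0; rewrite subrr.
move=> /dedgeP/(_ _ _ ab0); rewrite addr0 => av.
by exists (b0 + v); rewrite ?inE// addrAC subrr add0r.
Qed.

Lemma card_pred b : #|[set a | E a b]%SET| = #|[set v | dedge v 0]%SET|.
Proof.
have [b0 ab0] := E_pred b.
rewrite -(card_imset _ (addIr (- b0))); apply: eq_card => v.
apply/imsetP/idP; rewrite inE.
  by move=> [a]; rewrite inE => ab ->; have := dedge_sub ab ab0; rewrite subrr.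
move=> /dedgeP/(_ _ _ ab0); rewrite addr0 => av.
by exists (b0 + v); rewrite ?inE// addrAC subrr add0r.
Qed.

(** Both counts are constant in the letter, and multiplied by [#|G|] both give the number of
    edges. *)
Lemma card_succ_pred a b : #|[set b | E a b]%SET| = #|[set a | E a b]%SET|.
Proof.
rewrite card_succ card_pred.
have G0 : (0 < #|G|)%N by apply/card_gt0P; exists 0.
apply/eqP; rewrite -(eqn_pmul2l G0) -!sum_nat_const; apply/eqP.
transitivity (\sum_(x : G) \sum_(y : G) E x y)%N.
  by apply: eq_bigr => x _; rewrite -(card_succ x) -sum1dep_card big_mkcond.
rewrite exchange_big; apply: eq_bigr => x _.
by rewrite -(card_pred x) -sum1dep_card [RHS]big_mkcond.
Qed.

End edge_algebra.

(** * Homoclinic walks and convolutions *)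

HB.instance Definition _ (G : abelianAlphabet) :=
  GRing.Zmodule.copy (config G) (int -> G).

Section config_group.
Context (G : abelianAlphabet).
Implicit Types x y : config G.

Lemma configD x y i : (x + y) i = x i + y i. Proof. by []. Qed.
Lemma configN x i : (- x) i = - x i. Proof. by []. Qed.
Lemma configB x y i : (x - y) i = x i - y i. Proof. by []. Qed.
Lemma config0 i : (0 : config G) i = 0. Proof. by []. Qed.

Lemma shift_byDl n x y : shift_by n (x + y) = shift_by n x + shift_by n y.
Proof. by []. Qed.

Lemma shift_byB n x y : shift_by n (x - y) = shift_by n x - shift_by n y.
Proof. by []. Qed.

End config_group.

Section prime_torsion.
Context (V : zmodType) (p : nat) (p_prime : prime p).
Implicit Types (g : V) (a b : 'F_p).

Lemma Fp_card : (Zp_trunc (pdiv p)).+2 = p.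
Proof. exact: Fp_cast. Qed.

(** An element killed by [p] sees multipliers modulo [p] only, so ['F_p] acts on the [p]-torsion
    through the natural number underlying a scalar. *)
Lemma mulrn_modp g n : g *+ p = 0 -> g *+ (n %% p) = g *+ n.
Proof.
by move=> gp; rewrite [in RHS](divn_eq n p) mulrnDr mulnC mulrnA gp mul0rn add0r.
Qed.

Lemma mulrFpD g a b : g *+ p = 0 -> g *+ (a + b)%R = g *+ a + g *+ b.
Proof. by move=> gp; rewrite -mulrnDr -[RHS]mulrn_modp//=; congr (_ *+ (_ %% _)); exact: Fp_card. Qed.

Lemma mulrFpM g a b : g *+ p = 0 -> g *+ (a * b)%R = g *+ a *+ b.
Proof. by move=> gp; rewrite -mulrnA -[RHS]mulrn_modp//=; congr (_ *+ (_ %% _)); exact: Fp_card. Qed.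

Lemma mulrFpN g a : g *+ p = 0 -> g *+ (- a)%R = - (g *+ a).
Proof.
move=> gp; apply/eqP; rewrite -subr_eq0 opprK -mulrFpD// addNr.
by rewrite mulr0n.
Qed.

Lemma mulrFp_nat g n : g *+ p = 0 -> g *+ (n%:R : 'F_p) = g *+ n.
Proof. by move=> gp; rewrite -[RHS]mulrn_modp// val_Fp_nat. Qed.

Lemma mulrFp_eq0 g a : g *+ p = 0 -> (g *+ a == 0) = (g == 0) || (a == 0).
Proof.
move=> gp; apply/idP/orP => [|[/eqP->|/eqP->]]; last 2 first.
- by rewrite mul0rn.
- by rewrite mulr0n.
have [->|a0 /eqP ga] := eqVneq a 0; first by right.
left; have : g *+ (a * a^-1)%R = 0 by rewrite mulrFpM// ga mul0rn.
by rewrite divff// mulr1n => ->.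
Qed.

End prime_torsion.

Section convolution.
Context (G : abelianAlphabet) (p : nat) (p_prime : prime p).
Context (N : nat) (z : config G).
Hypothesis z_torsion : forall i, z i *+ p = 0.
Implicit Types c : int -> 'F_p.

(** The superposition of the translates of [z], the one placed at [j] weighted by [c j]. For [z]
    supported in [0, N) no other translate reaches the coordinate [i]. *)
Definition conv c : config G :=
  fun i => \sum_(k < N) z k%:Z *+ c (i - k%:Z).

Lemma convD c c' : conv (fun i => c i + c' i) = conv c + conv c'.
Proof.
apply/funext => i; rewrite configD -big_split /=.
by apply: eq_bigr => k _; rewrite mulrFpD.
Qed.

Lemma convN c : conv (fun i => - c i) = - conv c.
Proof.
apply/funext => i; rewrite configN -sumrN /=.
by apply: eq_bigr => k _; rewrite mulrFpN.
Qed.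

Lemma convB c c' : conv (fun i => c i - c' i) = conv c - conv c'.
Proof. by rewrite convD convN. Qed.

Lemma conv0 : conv (fun=> 0) = 0.
Proof. by apply/funext => i; rewrite /conv big1. Qed.

Lemma conv_shift n c : shift_by n (conv c) = conv (fun i => c (i + n)).
Proof.
by apply/funext => i; apply: eq_bigr => k _; rewrite addrAC.
Qed.

Lemma conv_morph (f : G -> G) (a : 'F_p) c : {morph f : x y / x + y} ->
  (forall i, f (z i) = z i *+ a) ->
  forall i, f (conv c i) = conv (fun i => a * c i) i.
Proof.
move=> fD fz i.
have f0 : f 0 = 0 by apply: (addIr (f 0)); rewrite -fD !add0r.
have fMn x n : f (x *+ n) = f x *+ n.
  by elim: n => // n IH; rewrite !mulrS fD IH.
rewrite /conv (big_morph f fD f0); apply: eq_bigr => k _.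
by rewrite fMn fz mulrFpM.
Qed.
End convolution.

Section homoclinic.
Context (G : abelianAlphabet) (p : nat) (p_prime : prime p) (D : rel G).
Hypotheses (D0 : D 0 0).
Hypothesis DB : forall u v u' v', D u v -> D u' v' -> D (u - u') (v - v').

Let DN u v : D u v -> D (- u) (- v).
Proof. by move=> uv; have := DB D0 uv; rewrite !sub0r. Qed.

Let DD u v u' v' : D u v -> D u' v' -> D (u + u') (v + v').
Proof. by move=> uv /DN uv'; have := DB uv uv'; rewrite !opprK. Qed.

Let DMn u v k : D u v -> D (u *+ k) (v *+ k).
Proof.
by move=> uv; elim: k => [|k IHk]; rewrite ?mulr0n// !mulrS; exact: DD.
Qed.

Definition walk (v : config G) := forall i, D (v i) (v (i + 1)).

Lemma walkB v w : walk v -> walk w -> walk (v - w).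
Proof. by move=> wv ww i; exact: DB. Qed.

Lemma walk_shift n v : walk v -> walk (shift_by n v).
Proof. by move=> wv i; rewrite /shift_by addrAC; exact: wv. Qed.

Definition finite_support n (v : config G) :=
  (forall i, i < 0 -> v i = 0) /\ (forall i, n%:Z <= i -> v i = 0).

Lemma finite_supportB n v w : finite_support n v -> finite_support n w ->
  finite_support n (v - w).
Proof.
move=> [v0 vn] [w0 wn]; split=> i h; rewrite configB.
  by rewrite v0// w0// subr0.
by rewrite vn// wn// subr0.
Qed.

Context (N : nat) (z : config G).
Hypotheses (z_walk : walk z) (z_support : finite_support N z).
Hypothesis z_torsion : forall i, z i *+ p = 0.
Hypothesis z_generator : forall v, D 0 v -> exists k : nat, v = z 0 *+ k.

Local Notation conv := (conv (p := p) N z).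

(** Padding the sums at [i] and [i + 1] with one zero term each aligns them on the same
    coefficients, so that the pair is a combination of the edges from [z (k - 1)] to [z k]. *)
Lemma conv_walk c : walk (conv c).
Proof.
move=> i.
have -> : conv c i = \sum_(k < N.+1) z (k%:Z - 1) *+ c (i + 1 - k%:Z).
  rewrite big_ord_recl /= (z_support.1 (0 - 1))// mul0rn add0r.
  apply: eq_bigr => k _; rewrite /bump leq0n add1n.
  have -> : k.+1%:Z - 1 = k%:Z by lia.
  by have -> : i + 1 - k.+1%:Z = i - k%:Z by lia.
have -> : conv c (i + 1) = \sum_(k < N.+1) z k%:Z *+ c (i + 1 - k%:Z).
  by rewrite big_ord_recr /= (z_support.2 N%:Z)// mul0rn addr0.
apply: (big_ind2 D) => // k _; apply: DMn.
by have := z_walk (k%:Z - 1); rewrite subrK.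
Qed.

(** Peeling from the left: the first letter of a walk that vanishes on negative indices follows [0],
    hence is a multiple of [z 0]. Subtracting that multiple of [z] and shifting gives a walk of the
    same kind; the multiples removed are the coefficients. *)
Lemma walk_half_line v : walk v -> (forall i, i < 0 -> v i = 0) ->
  exists c, v = conv c.
Proof.
move=> v_walk v_neg.
(* The default 0 is harmless: every [w n 0] follows [0], as the proof of [wP] shows. *)
have kP (g : G) : {k : nat | D 0 g -> g = z 0 *+ k}.
  apply: cid; have [/z_generator[k ->]|ng] := pselect (D 0 g); first by exists k.
  by exists 0%N.
pose kk g : 'F_p := (sval (kP g))%:R.
pose step w := shift_by 1 (w - (fun i => z i *+ kk (w 0) : G)).
pose w n := iter n step v.
pose c i : 'F_p := if i is Posz n then kk (w n 0) else 0.
have wP n : walk (w n) /\ forall i, i < 0 -> w n i = 0.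
  elim: n => [|n [IHw IHn]] //; rewrite /w iterS -/(w n).
  have D0w : D 0 (w n 0) by have := IHw (-1); rewrite IHn// addNr.
  split; first by apply/walk_shift/walkB => // i; apply: DMn; exact: z_walk.
  move=> i i0; rewrite /step /shift_by configB.
  have [->|i1] := eqVneq i (-1); last by rewrite IHn ?z_support.1 ?mul0rn ?subr0//; lia.
  rewrite addNr /kk mulrFp_nat//; case: (kP (w n 0)) => k /= kE.
  by rewrite -kE// subrr.
pose cn n : int -> 'F_p := fun i => if i < n%:Z then c i else 0.
have vE n : v = conv (cn n) + shift_by (- n%:Z) (w n).
  elim: n => [|n IHn].
    have -> : cn 0 = (fun=> 0) by apply/funext => -[k|k]; rewrite /cn /c //=; case: ifP.
    by rewrite conv0 add0r oppr0 shift_by0.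
  rewrite [LHS]IHn; apply/funext => i; rewrite !configD.
  have -> : conv (cn n.+1) i = conv (cn n) i + z (i - n%:Z) *+ c n.
    have -> : cn n.+1 = (fun i => cn n i + (if i == n then c n else 0)).
      apply/funext => j; rewrite /cn; case: (ltgtP j n) => jn.
      - by rewrite (_ : j < n.+1%:Z) ?addr0//; lia.
      - by rewrite (_ : j < n.+1%:Z = false) ?addr0//; lia.
      - by rewrite (_ : j < n.+1%:Z) ?add0r ?jn//; lia.
    rewrite convD// configD; congr (_ + _); rewrite /conv.
    have [i_n|i_n] := boolP ((n%:Z <= i) && (i < n%:Z + N%:Z)).
      have kN : (`|i - n%:Z| < N)%N by lia.
      rewrite (bigD1 (Ordinal kN)) //= big1 ?addr0.
        have -> : (absz (i - n%:Z) : int) = i - n%:Z by lia.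
        by rewrite subKr eqxx.
      move=> k /eqP kn; case: eqP => // ink; exfalso; apply: kn; apply: val_inj => /=; lia.
    rewrite big1; last first.
      move=> k _; case: eqP => // ink; have := ltn_ord k; lia.
    have [ni|ni] := ltP i n%:Z; first by rewrite z_support.1 ?mul0rn//; lia.
    by rewrite z_support.2 ?mul0rn//; lia.
  rewrite -addrA; congr (_ + _); rewrite /w iterS -/(w n) /step /shift_by configB.
  have -> : i - n.+1%:Z + 1 = i - n%:Z by lia.
  by rewrite addrC subrK.
exists c; apply/funext => i.
(* After [|i| + 1] steps the remainder starts beyond [i], and the truncated coefficients agree with
   [c] wherever they matter at [i]. *)
rewrite (vE (`|i|.+1)%N) configD /shift_by (wP _).2 ?addr0; last by lia.
apply: eq_bigr => k _; rewrite /cn ifT//; lia.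
Qed.

Hypothesis N_gt0 : (0 < N)%N.
Hypothesis z_minimal : forall v, walk v -> finite_support N.-1 v -> v = 0.
Hypothesis z0 : z 0 != 0.

(* If [conv c = 0] then truncating [c] to the nonnegative indices gives a walk
   supported in [0, N - 1), which vanishes by minimality of [N]. *)
Lemma conv_inj c : conv c = 0 -> c = (fun=> 0).
Proof.
move=> cz.
have c0 d : conv d = 0 -> d 0 = 0.
  move=> dz; pose d' i : 'F_p := if i < 0 then 0 else d i.
  have d'0 : conv d' 0 = z 0 *+ d 0.
    rewrite /conv (bigD1 (Ordinal N_gt0))//= big1 ?addr0 ?subr0// => k k0.
    rewrite /d' ifT// sub0r oppr_lt0 ltz_nat lt0n.
    by apply: contra_neq k0 => k0; exact: val_inj.
  have : conv d' = 0.
    apply: z_minimal; first exact: conv_walk.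
    split=> i iN.
      rewrite /conv big1// => k _; rewrite /d' ifT ?mulr0n//; lia.
    have := congr1 (fun v => v i) dz; rewrite config0 => <-.
    apply: eq_bigr => k _; rewrite /d' ifF//; have := ltn_ord k; lia.
  move=> /(congr1 (fun v => v 0)); rewrite d'0 => /eqP.
  by rewrite mulrFp_eq0// (negPf z0) => /eqP.
apply/funext => i; have := c0 (fun j => c (j + i)).
by rewrite add0r; apply; rewrite -conv_shift cz.
Qed.

End homoclinic.

Section homoclinic_existence.
Context (G : abelianAlphabet) (E : rel G) (eta rho : G -> G) (c : G).
Context (p : nat) (p_prime : prime p).
Let phi a b := eta a + rho b + c.
Hypotheses (eta_inj : injective eta) (rho_inj : injective rho).
Hypothesis E_phi : forall a b a' b', E a b -> E a' b' -> E (phi a a') (phi b b').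
Hypothesis E_card : forall a, #|[set b | E a b]%SET| = p.

Local Notation D := (dedge E).

Let D0 : D 0 0 := dedge0 E.
Let D_sub a b a' b' : E a b -> E a' b' -> D (a - a') (b - b').
Proof. exact: (dedge_sub eta_inj rho_inj E_phi). Qed.

(* There are [p ^ n > #|G|] paths of length [n] from a letter, so two of them
   end at the same letter; their difference is a homoclinic walk. *)
Let walk_exists : exists n v, [/\ walk D v, finite_support n v & v <> 0].
Proof.
pose n := #|G|; pose g0 : G := 0.
pose S := [set t : n.-tuple G | path E g0 t]%SET.
have : (#|[set: G]%SET| < #|S|)%N.
  by rewrite (card_path_tuples _ _ E_card) cardsT ltn_expl// prime_gt1.
pose f (t : n.-tuple G) := last g0 t.
have [inj|] := boolP (dinjectiveb f (mem S)).
  move=> /(leq_ltn_trans (subset_leq_card (finset.subsetT (f @: S)%SET))).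
  by rewrite card_in_imset ?ltnn//; exact/dinjectiveP.
move=> /dinjectivePn[t tS [t' /andP[tt' t'S] ftt']] _.
rewrite !inE in tS t'S.
pose x (s : n.-tuple G) : config G :=
  fun i => if i < 0 then g0 else nth g0 (g0 :: s) `|i|.
have xP (s : n.-tuple G) i : path E g0 s -> 0 <= i < n%:Z -> E (x s i) (x s (i + 1)).
  move=> /(pathP g0) Es /andP[i0 ilen].
  have -> : x s i = nth g0 (g0 :: s) `|i| by rewrite /x ltNge i0.
  have -> : x s (i + 1) = nth g0 s `|i|.
    rewrite /x ifF; last by lia.
    by have -> : (absz (i + 1)%R = (absz i).+1) by lia.
  by apply: Es; rewrite size_tuple; lia.
pose v : config G := fun i => if n%:Z <= i then 0 else x t i - x t' i.
have xn (s : n.-tuple G) : x s n%:Z = f s.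
  rewrite /x /=.
  by rewrite -[f s]/(last g0 (g0 :: s)) -nth_last /= size_tuple.
exists n, v; split.
- move=> i; rewrite /v; have [ni|ni] := leP n%:Z i.
    by rewrite ifT//; lia.
  have [i0|i0] := leP 0 i; last first.
    have -> : x t i = x t' i by rewrite /x i0.
    have -> : x t (i + 1) = x t' (i + 1).
      rewrite /x; case: ifP => // i1.
      by have -> : i + 1 = 0 by lia.
    by rewrite !subrr; case: ifP.
  have := D_sub (xP t i tS ltac:(lia)) (xP t' i t'S ltac:(lia)).
  case: ifP => // ni'; have -> : i + 1 = n%:Z by lia.
  by rewrite !xn ftt' subrr.
- split=> i h; rewrite /v; last by rewrite h.
  by rewrite ifF; [rewrite /x h subrr|lia].
- move=> v0; case/eqP: tt'; apply: val_inj; apply: (@eq_from_nth _ g0).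
    by rewrite !size_tuple.
  move=> k; rewrite size_tuple => kn.
  have [kn'|kn'] := ltnP k.+1 n; last first.
    have -> : k = n.-1 by lia.
    have L (s : n.-tuple G) : nth g0 s n.-1 = f s by rewrite /f -nth_last size_tuple.
    by rewrite !L.
  have := congr1 (fun v => v k.+1%:Z) v0; rewrite /v ifF; last by lia.
  by rewrite /x /= => /eqP; rewrite subr_eq0 => /eqP.
Qed.

(** Take a nonzero homoclinic walk whose support bound [N] is least. If [z 0] were zero, shifting by
    one would fit [z] into a shorter interval. *)
Lemma homoclinic_exists : exists N (z : config G),
  [/\ (0 < N)%N, walk D z, finite_support N z, z 0 != 0 &
      forall v, walk D v -> finite_support N.-1 v -> v = 0].
Proof.
pose P n := `[< exists v, [/\ walk D v, finite_support n v & v <> 0] >].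
have exP : exists n, P n.
  by have [n [v vP]] := walk_exists; exists n; apply/asboolP; exists v.
case: (ex_minnP exP) => N /asboolP[z [zw zN z0]] Nmin.
have minimal v : walk D v -> finite_support N.-1 v -> v = 0.
  move=> vw vN; apply: contrapT => v0.
  have : (N <= N.-1)%N by apply: Nmin; apply/asboolP; exists v.
  case: N zN vN {Nmin} => [|N] zN vN; last by rewrite ltnn.
  move=> _; apply: v0; apply/funext => i.
  by have [i0|i0] := ltP i 0; [exact: vN.1|exact: vN.2].
have N0 : (0 < N)%N.
  case: N zN {Nmin minimal} => // zN; exfalso; apply: z0; apply/funext => i.
  by have [i0|i0] := ltP i 0; [exact: zN.1|exact: zN.2].
exists N, z; split=> //; apply/eqP => z00; apply: z0.
have : shift_by 1 z = 0.
  apply: minimal; first exact: walk_shift.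
  split=> i iN; rewrite /shift_by.
    have [->|i1] := eqVneq i (-1); first by rewrite addNr.
    by apply: zN.1; lia.
  by apply: zN.2; lia.
move=> /(congr1 (shift_by (-1))); rewrite shift_byD addNr shift_by0 => ->.
by [].
Qed.

End homoclinic_existence.

(* Up to the action of [conv N z], which embeds the full shift over ['F_p] in
   the differences of points of [X], the subshift [X] is a periodic orbit. *)
Record shift_generator (G : abelianAlphabet) (X : set (config G))
    (eta rho : G -> G) (p N : nat) (z : config G) (a b : 'F_p) : Prop := {
  gen_torsion : forall i, z i *+ p = 0;
  gen_neg : forall i, i < 0 -> z i = 0;
  gen_neq0 : z 0 != 0;
  gen_a_neq0 : a != 0;
  gen_b_neq0 : b != 0;
  gen_eta : forall i, eta (z i) = z i *+ a;
  gen_rho : forall i, rho (z i) = z i *+ b;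
  gen_stable : forall x (c : int -> 'F_p), X x -> X (x + conv N z c);
  gen_inj : forall c : int -> 'F_p, conv N z c = 0 -> c = (fun=> 0);
  gen_phase : forall x x', X x -> X x' ->
    exists L (c : int -> 'F_p), shift_by L x - x' = conv N z c;
  gen_succ : forall g h h', edge X g h -> edge X g h' ->
    exists k : nat, h' = h + z 0 *+ k }.

(** * Existence of a generator for the differences of points *)

Section generator_existence.
Context (G : abelianAlphabet) (X : set (config G)) (eta rho : G -> G) (c : G).
Context (p : nat) (p_prime : prime p).
Let phi a b := eta a + rho b + c.
Hypotheses (eta_inj : injective eta) (rho_inj : injective rho).
Hypotheses (etaD : {morph eta : x y / x + y}) (rhoD : {morph rho : x y / x + y}).
Hypothesis X_markov : is_markov_chain X.
Hypothesis X_irreducible : irreducible_shift X.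
Hypothesis X_letters : uses_all_letters X.
Hypothesis phi_compatible : structurally_compatible X phi.

Let XE x : X x <-> forall i, edge X (x i) (x (i + 1)).
Proof. exact: markov_edgesP. Qed.

Lemma compatible_edge a b a' b' :
  edge X a b -> edge X a' b' -> edge X (phi a a') (phi b b').
Proof.
move=> /asboolP[x [Xx <- <-]] /asboolP[y [Xy <- <-]].
by apply/asboolP; exists (fun i => phi (x i) (y i)); split=> //; exact: phi_compatible.
Qed.

Lemma letter_edges g : (exists h, edge X g h) /\ (exists h, edge X h g).
Proof.
have [x Xx [i [->]]] := X_letters g; rewrite addr0; split.
  by exists (x (i + 1)); exact: (XE x).1.
by exists (x (i - 1)); have := (XE x).1 Xx (i - 1); rewrite subrK.
Qed.

Let E_succ g : exists h, edge X g h. Proof. exact: (letter_edges g).1. Qed.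
Let E_pred g : exists h, edge X h g. Proof. exact: (letter_edges g).2. Qed.

Hypothesis E_card : forall a, #|[set b | edge X a b]%SET| = p.

Local Notation E := (edge X).
Local Notation D := (dedge E).

Let D0 : D 0 0 := dedge0 E.
Let DB u v u' v' : D u v -> D u' v' -> D (u - u') (v - v').
Proof. exact: (dedgeB eta_inj rho_inj compatible_edge E_succ). Qed.
Let DD u v u' v' : D u v -> D u' v' -> D (u + u') (v + v').
Proof. exact: dedgeD. Qed.
Let DMn u v k : D u v -> D (u *+ k) (v *+ k).
Proof. exact: dedgeMn. Qed.
Let D_sub a b a' b' : E a b -> E a' b' -> D (a - a') (b - b').
Proof. exact: (dedge_sub eta_inj rho_inj compatible_edge). Qed.

Lemma card_pred_edge b : #|[set a | E a b]%SET| = p.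
Proof.
by rewrite -(card_succ_pred eta_inj rho_inj compatible_edge E_succ E_pred b b).
Qed.

(** The followers of [0] form a group of prime order [p], which any nonzero element generates. *)
Let follower_generated g : D 0 g -> g != 0 ->
  (g *+ p = 0) /\ (forall v, D 0 v -> exists k : nat, v = g *+ k).
Proof.
move=> Dg g0; pose S := [set v | D 0 v]%SET.
have S_card : #|S| = p.
  by rewrite -(card_succ eta_inj rho_inj compatible_edge E_succ 0).
have [|x y||gp gS] := prime_order_generated p_prime S_card _ _ _ g0; rewrite ?inE//.
  by move=> h h'; have := DD h h'; rewrite addr0.
by split=> // v Dv; have [|k ->] := gS v; [rewrite inE|exists k].
Qed.

Let predecessor_generated g : D g 0 -> g != 0 ->
  forall v, D v 0 -> exists k : nat, v = g *+ k.
Proof.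
move=> Dg g0; pose S := [set v | D v 0]%SET.
have S_card : #|S| = p.
  by rewrite -(card_pred eta_inj rho_inj compatible_edge E_pred 0) card_pred_edge.
have [|x y||gp gS] := prime_order_generated p_prime S_card _ _ _ g0; rewrite ?inE//.
  by move=> h h'; have := DD h h'; rewrite addr0.
by move=> v Dv; have [|k ->] := gS v; [rewrite inE|exists k].
Qed.

Lemma path_in_X x x' : X x -> X x' -> exists (n : nat) (y : config G),
  [/\ X y, forall i, i <= 0 -> y i = x i & forall i, 0 <= i -> y (i + n%:Z) = x' i].
Proof.
move=> Xx Xx'; have [v [v0 /(edge_path X_markov) Ev]] := X_irreducible (x 0) (x' 0).
have [|y [Xy yx yx' _]] := glue_path X_markov Xx Xx' Ev; first by rewrite last_rcons.
by exists (size (rcons v (x' 0))), y.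
Qed.

Lemma walk_X v x : walk D v -> X x -> X (x + v).
Proof. by move=> vw /XE Ex; apply/XE => i; have /dedgeP := vw i; apply. Qed.

Lemma sub_walk x y : X x -> X y -> walk D (x - y).
Proof. by move=> /XE Ex /XE Ey i; exact: D_sub. Qed.

Let reflect_walk v : walk D v -> walk (fun u w => D w u) (fun i => v (- i)).
Proof. by move=> vw i; have := vw (- (i + 1)); rewrite opprD subrK. Qed.

(** Minimality of the support is the source of the scalars: a walk supported in [0, N) is determined
    by its first letter, hence is a multiple of [z]. This applies to the images of [z] under [eta]
    and [rho]. *)
Lemma exists_shift_generator : exists N z a b, shift_generator X eta rho (p := p) N z a b.
Proof.
have [N [z [N0 zw zN z0 zmin]]] :=
  homoclinic_exists p_prime eta_inj rho_inj compatible_edge E_card.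
have D0z v : walk D v -> finite_support N v -> D 0 (v 0).
  by move=> vw vN; have := vw (-1); rewrite vN.1// addNr.
have DNz v : walk D v -> finite_support N v -> D (v N.-1%:Z) 0.
  move=> vw vN; have := vw N.-1%:Z; rewrite (_ : N.-1%:Z + 1 = N%:Z); last by lia.
  by rewrite (vN.2 _ (lexx _)).
have zmin0 v : walk D v -> finite_support N v -> v 0 = 0 -> v = 0.
  move=> vw vN v0; have : shift_by 1 v = 0.
    apply: zmin; first exact: walk_shift.
    split=> i iN; rewrite /shift_by.
      have [->|i1] := eqVneq i (-1); first by rewrite addNr.
      by apply: vN.1; lia.
    by apply: vN.2; lia.
  by move=> /(congr1 (shift_by (-1))); rewrite shift_byD addNr shift_by0 => ->.
have zN0 : z N.-1%:Z != 0.
  apply/eqP => zN'; have z_0 : z = 0.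
    apply: zmin => //; split=> i iN; first exact: zN.1.
    have [->//|i1] := eqVneq i N.-1%:Z; by apply: zN.2; lia.
  by move: z0; rewrite z_0 eqxx.
have [z0p z0gen] := follower_generated (D0z _ zw zN) z0.
have multiple v : walk D v -> finite_support N v -> exists k : nat, forall i, v i = z i *+ k.
  move=> vw vN; have [k vk] := z0gen _ (D0z _ vw vN); exists k => i.
  have : v - (fun i => z i *+ k) = 0.
    apply: zmin0; last by rewrite configB vk subrr.
      by apply: walkB => // j; apply: DMn; exact: zw.
    by apply: finite_supportB => //; split=> j jN; [rewrite zN.1//|rewrite zN.2//]; rewrite mul0rn.
  by move=> /(congr1 (fun v => v i)) /eqP; rewrite configB config0 subr_eq0 => /eqP.
have zp i : z i *+ p = 0.
  have : (fun i => z i *+ p) = (0 : config G).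
    apply: zmin0 => //; first by move=> j; exact/DMn/zw.
    by split=> j jN; [rewrite zN.1//|rewrite zN.2//]; rewrite mul0rn.
  by move=> /(congr1 (fun v => v i)).
have morph0 (f : G -> G) : {morph f : x y / x + y} -> f 0 = 0 :> G.
  by move=> fD; apply: (addIr (f 0)); rewrite -fD !add0r.
have scalar (f : G -> G) : injective f -> {morph f : x y / x + y} ->
    (forall u v, D u v -> D (f u) (f v)) ->
    exists2 a : 'F_p, a != 0 & forall i, f (z i) = z i *+ a.
  move=> finj fD Df; have f0 := morph0 f fD.
  have [||k kz] := multiple (fun i => f (z i)).
  - by move=> i; exact/Df/zw.
  - by split=> i iN; [rewrite zN.1//|rewrite zN.2//]; rewrite f0.
  exists k%:R => [|i]; last by rewrite mulrFp_nat.
  apply/eqP => k0; case/eqP: z0; apply: finj.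
  by rewrite f0 kz -(mulrFp_nat p_prime)// k0 mulr0n.
have [a a0 eta_a] := scalar _ eta_inj etaD (dedge_eta eta_inj rho_inj etaD compatible_edge E_succ).
have [b b0 rho_b] := scalar _ rho_inj rhoD (dedge_rho eta_inj rho_inj rhoD compatible_edge E_succ).
exists N, z, a, b; split=> //.
- exact: zN.1.
- by move=> x d Xx; apply: walk_X => //; exact: (conv_walk p_prime D0 DB zw zN).
- exact: (conv_inj p_prime D0 DB zw zN zp N0 zmin z0).
(* [y] follows the past of [x] and then the future of [x']. It differs from [x] on the right only
   and, once shifted, from [x'] on the left only; each difference is a convolution. *)
- move=> x x' Xx Xx'; have [n [y [Xy yx yx']]] := path_in_X Xx Xx'.
  have [c1 c1E] : exists c1 : int -> 'F_p, y - x = conv N z c1.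
    have [||c1 c1E] := walk_half_line p_prime D0 DB zw zN zp z0gen (v := shift_by 1 (y - x)).
    - exact/walk_shift/sub_walk.
    - by move=> i i0; rewrite /shift_by configB yx ?subrr//; lia.
    exists (fun i => c1 (i - 1)).
    by rewrite -conv_shift -c1E shift_byD addNr shift_by0.
  have [c2 c2E] : exists c2 : int -> 'F_p, shift_by n%:Z y - x' = conv N z c2.
    (* Reversing time turns a walk on the left half-line into one on the right half-line, generated
       by [z] read backwards; the predecessors of [0] then play the role of its followers. *)
    pose z' : config G := fun i => z (N.-1%:Z - i).
    have z'w : walk (fun u w => D w u) z'.
      move=> i; have := zw (N.-1%:Z - (i + 1)).
      by rewrite (_ : _ - _ + 1 = N.-1%:Z - i)//; lia.
    have z's : finite_support N z'.
      by split=> i iN; [apply: zN.2|apply: zN.1]; lia.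
    have z'g v : D v 0 -> exists k : nat, v = z' 0 *+ k.
      move=> /(predecessor_generated (DNz _ zw zN) zN0)[k ->].
      by exists k; rewrite /z' subr0.
    have [|i i0|d dE] := walk_half_line p_prime (D := fun u w => D w u) D0
        (fun u v u' v' => @DB v u v' u') z'w z's (fun i => zp _) z'g
        (v := fun i => (shift_by n%:Z y - x') (- i)).
    - by apply: reflect_walk; apply: sub_walk => //; rewrite (subshift_by _ _ X_markov.1).
    - by rewrite configB /shift_by yx' ?subrr//; lia.
    exists (fun j => d (- j - N.-1%:Z)).
    apply/funext => i; have := congr1 (fun v => v (- i)) dE; rewrite opprK => ->.
    rewrite /conv /z' (reindex_inj rev_ord_inj) /=; apply: eq_bigr => k _.
    have -> : N.-1%:Z - (N - k.+1)%N%:Z = k%:Z by have := ltn_ord k; lia.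
    by have -> : - i - (N - k.+1)%N%:Z = - (i - k%:Z) - N.-1%:Z by have := ltn_ord k; lia.
  exists n%:Z, (fun i => c2 i - c1 (i + n%:Z)).
  rewrite (convB p_prime)// -conv_shift -c2E -c1E shift_byB.
  by apply/funext => i; rewrite !configB opprB [RHS]addrC addrA subrK.
- move=> g h h' gh gh'; have := D_sub gh' gh; rewrite subrr => /z0gen[k hk].
  by exists k; rewrite -hk addrC subrK.
Qed.

End generator_existence.

(** * Finite entropies *)

Section finite_entropy.
Context (R : realType).
Implicit Types q x : R.

(** This is [ln t <= t - 1] at [t = x / q], multiplied by [q]. The last hypothesis is absolute
    continuity. *)
Lemma gibbs q x : 0 <= q -> 0 <= x -> (0 < q -> 0 < x) ->
  q * (ln x - ln q) <= x - q.
Proof.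
rewrite le_eqVlt => /orP[/eqP<-|q0] x0; first by rewrite mul0r subr0.
move=> /(_ q0) {}x0; rewrite -ln_div ?posrE//.
rewrite -ler_pdivlMl// mulrBr mulVf ?gt_eqF// [_^-1 * x]mulrC.
have := @le_ln1Dx R (x / q - 1); rewrite [1 + _]addrC subrK; apply.
by rewrite ltrBrDl subrr divr_gt0.
Qed.

(** The inequality [1 + t <= expR t] is strict away from [t = 0], and [t = ln (x / q)] vanishes only
    for [q = x]. *)
Lemma gibbs_eq q x : 0 <= q -> 0 <= x -> (0 < q -> 0 < x) ->
  q * (ln x - ln q) = x - q -> q = x.
Proof.
rewrite le_eqVlt => /orP[/eqP<-|q0] x0; first by rewrite mul0r subr0.
move=> /(_ q0) {}x0; rewrite -ln_div ?posrE// => h.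
have qx0 : 0 < x / q by rewrite divr_gt0.
have lnE : ln (x / q) = x / q - 1.
  by apply: (mulfI (negbT (gt_eqF q0))); rewrite h mulrBr mulrCA divff ?gt_eqF// !mulr1.
have [ln0|/expR_gt1Dx] := eqVneq (ln (x / q)) 0.
  by apply/esym/divr1_eq/eqP; rewrite -subr_eq0 -lnE ln0.
by rewrite lnK ?posrE// lnE [1 + _]addrC subrK ltxx.
Qed.

Definition H (A : finType) (q : A -> R) : R := \sum_a - (q a * ln (q a)).

(** An atom weighs at most the block it is merged into, and [- ln] decreases. *)
Lemma H_map (A B : finType) (h : A -> B) (q : A -> R) : (forall a, 0 <= q a) ->
  H (fun b => \sum_(a | h a == b) q a) <= H q.
Proof.
move=> q0; rewrite [leRHS](partition_big h xpredT)//=.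
apply: ler_sum => b _; rewrite mulr_suml -sumrN; apply: ler_sum => a /eqP hab.
rewrite lerN2; have := q0 a; rewrite le_eqVlt => /orP[/eqP<-|qa]; first by rewrite !mul0r.
have qQ : q a <= \sum_(a | h a == b) q a.
  by rewrite (bigD1 a) ?hab//= lerDl sumr_ge0.
by rewrite ler_pM2l// ler_ln ?posrE// (lt_le_trans qa).
Qed.

(** Strong subadditivity, by the Gibbs inequality against the weights [x] under which [a] and [b]
    are independent given [c], with unchanged marginals on [(a, c)] and [(b, c)]. *)
Lemma H_submodular (A B C : finType) (q : A -> B -> C -> R) :
  (forall a b c, 0 <= q a b c) ->
  H (fun t : A * (B * C) => q t.1 t.2.1 t.2.2) + H (fun c => \sum_a \sum_b q a b c) <=
  H (fun t : A * C => \sum_b q t.1 b t.2) + H (fun t : B * C => \sum_a q a t.1 t.2).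
Proof.
move=> q0.
pose qac a c := \sum_b q a b c; pose qbc b c := \sum_a q a b c.
pose qc c := \sum_a \sum_b q a b c.
have qac0 a c : 0 <= qac a c by apply: sumr_ge0.
have qbc0 b c : 0 <= qbc b c by apply: sumr_ge0.
have qc0 c : 0 <= qc c by apply: sumr_ge0 => a _; apply: sumr_ge0.
have Habc : H (fun t : A * (B * C) => q t.1 t.2.1 t.2.2) =
    \sum_a \sum_b \sum_c - (q a b c * ln (q a b c)).
  rewrite /H -(pair_bigA _ (fun a (t : B * C) => - (q a t.1 t.2 * ln (q a t.1 t.2))))/=.
  apply: eq_bigr => a _.
  by rewrite -(pair_bigA _ (fun b c => - (q a b c * ln (q a b c)))).
have Hc : H qc = \sum_a \sum_b \sum_c - (q a b c * ln (qc c)).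
  rewrite /H [RHS](eq_bigr (fun a => \sum_c \sum_b - (q a b c * ln (qc c)))); last first.
    by move=> a _; exact: exchange_big.
  rewrite [RHS]exchange_big; apply: eq_bigr => c _.
  rewrite mulr_suml -sumrN; apply: eq_bigr => a _.
  by rewrite mulr_suml -sumrN.
have Hac : H (fun t : A * C => qac t.1 t.2) = \sum_a \sum_b \sum_c - (q a b c * ln (qac a c)).
  rewrite /H -(pair_bigA _ (fun a c => - (qac a c * ln (qac a c))))/=.
  apply: eq_bigr => a _; rewrite [RHS]exchange_big; apply: eq_bigr => c _.
  by rewrite mulr_suml -sumrN.
have Hbc : H (fun t : B * C => qbc t.1 t.2) = \sum_a \sum_b \sum_c - (q a b c * ln (qbc b c)).
  rewrite /H -(pair_bigA _ (fun b c => - (qbc b c * ln (qbc b c))))/=.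
  rewrite [RHS]exchange_big; apply: eq_bigr => b _; rewrite [RHS]exchange_big; apply: eq_bigr => c _.
  by rewrite mulr_suml -sumrN.
rewrite Habc Hc Hac Hbc -subr_le0.
pose x a b c := qac a c * qbc b c / qc c.
apply: (@le_trans _ _ (\sum_a \sum_b \sum_c (x a b c - q a b c))).
  rewrite -!big_split -sumrB; apply: ler_sum => a _ /=.
  rewrite -!big_split -sumrB; apply: ler_sum => b _ /=.
  rewrite -!big_split -sumrB; apply: ler_sum => c _ /=.
  have [->|qn0] := eqVneq (q a b c) 0.
    by rewrite !mul0r oppr0 !addr0 subr0 divr_ge0// mulr_ge0.
  have qabc : 0 < q a b c by rewrite lt_neqAle eq_sym qn0 q0.
  have ac : 0 < qac a c by rewrite (lt_le_trans qabc)// /qac (bigD1 b)//= lerDl sumr_ge0.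
  have bc : 0 < qbc b c by rewrite (lt_le_trans qabc)// /qbc (bigD1 a)//= lerDl sumr_ge0.
  have c_ : 0 < qc c.
    by rewrite (lt_le_trans ac)// /qc (bigD1 a)//= lerDl sumr_ge0// => ? _; apply: sumr_ge0.
  have acbc : 0 < qac a c * qbc b c by rewrite mulr_gt0.
  have x0 : 0 < x a b c by rewrite divr_gt0.
  apply: le_trans (gibbs (q0 a b c) (ltW x0) (fun=> x0)).
  rewrite [ln (x a b c)]ln_div ?posrE// lnM ?posrE//.
  by rewrite le_eqVlt; apply/orP; left; apply/eqP; ring.
under eq_bigr do (under eq_bigr do rewrite sumrB; rewrite sumrB); rewrite sumrB subr_le0.
under [X in X <= _]eq_bigr do rewrite exchange_big /=.
rewrite exchange_big [leRHS](eq_bigr (fun a => \sum_c \sum_b q a b c)); last first.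
  by move=> a _; exact: exchange_big.
rewrite [leRHS]exchange_big /=; apply: ler_sum => c _.
rewrite -/(qc c) /x.
under eq_bigr do rewrite -mulr_suml -mulr_sumr.
rewrite -!mulr_suml -/(qc c).
have -> : \sum_b qbc b c = qc c by rewrite /qbc exchange_big.
have [->|qcn0] := eqVneq (qc c) 0; first by rewrite mul0r mul0r.
by rewrite mulfK.
Qed.

(** Gibbs inequality against the law that keeps the marginal of [a] and spreads it uniformly over
    [S a]. In the equality case all the gaps [s a b - t a b] vanish, being nonnegative with sum
    zero. *)
Lemma H_cond_bound (A B : finType) (q : A -> B -> R) (S : A -> {set B}) (k : nat) :
  (0 < k)%N -> (forall a b, 0 <= q a b) -> (forall a, #|S a| = k) ->
  (forall a b, b \notin S a -> q a b = 0) -> \sum_a \sum_b q a b = 1 ->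
  H (fun t : A * B => q t.1 t.2) - H (fun a => \sum_b q a b) <= ln k%:R /\
  (H (fun t : A * B => q t.1 t.2) - H (fun a => \sum_b q a b) = ln k%:R ->
    forall a b, b \in S a -> q a b = (\sum_b q a b) / k%:R).
Proof.
move=> k0 q0 Sk qS q1.
have kR : 0 < k%:R :> R by rewrite ltr0n.
pose Q a := \sum_b q a b.
have Q0 a : 0 <= Q a by apply: sumr_ge0.
have Q_S a : Q a = \sum_(b in S a) q a b.
  rewrite /Q (bigID (mem (S a)))/= [X in _ + X]big1 ?addr0// => b; exact: qS.
pose t a b := q a b * (ln (Q a / k%:R) - ln (q a b)).
pose s a b := Q a / k%:R - q a b.
have pos a b : 0 < q a b -> 0 < Q a / k%:R.
  by move=> qab; rewrite divr_gt0// (lt_le_trans qab)// /Q (bigD1 b)//= lerDl sumr_ge0.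
have ts a b : t a b <= s a b by apply: gibbs => //; [rewrite divr_ge0// ltW|exact: pos].
have E : H (fun t : A * B => q t.1 t.2) - H Q - ln k%:R =
    \sum_a \sum_(b in S a) t a b.
  have HQ : H Q = \sum_a \sum_b - (q a b * ln (Q a)).
    by apply: eq_bigr => a _; rewrite mulr_suml -sumrN.
  have lnk : ln k%:R = \sum_a \sum_b q a b * ln k%:R.
    by under eq_bigr do rewrite -mulr_suml; rewrite -mulr_suml q1 mul1r.
  rewrite HQ [in LHS]lnk /H -(pair_bigA _ (fun a b => - (q a b * ln (q a b))))/=.
  rewrite -!sumrB; apply: eq_bigr => a _; rewrite -!sumrB [RHS]big_mkcond.
  apply: eq_bigr => b _ /=.
  case: ifPn => [_|/qS ->]; last by rewrite !(mul0r, oppr0, addr0).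
  rewrite /t; have [->|qn0] := eqVneq (q a b) 0; first by rewrite !(mul0r, oppr0, addr0).
  have qab : 0 < q a b by rewrite lt_neqAle eq_sym qn0 q0.
  have := pos _ _ qab; rewrite pmulr_lgt0 ?invr_gt0// => Qa.
  by rewrite ln_div ?posrE//; ring.
have s0 : \sum_a \sum_(b in S a) s a b = 0.
  apply: big1 => a _; rewrite sumrB sumr_const Sk -Q_S -mulrnAr -mulr_natr mulVf ?gt_eqF//.
  by rewrite mulr1 subrr.
split.
  by rewrite -subr_le0 E -[leRHS]s0; apply: ler_sum => a _; apply: ler_sum => b _; exact: ts.
move=> /eqP; rewrite -subr_eq0 E => /eqP t0 a b bS.
have : \sum_a \sum_(b in S a) (s a b - t a b) == 0.
  by rewrite (eq_bigr (fun a => \sum_(b in S a) s a b - \sum_(b in S a) t a b))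
    ?sumrB ?s0 ?t0 ?subrr// => a' _; rewrite sumrB.
rewrite psumr_eq0; last by move=> a' _; apply: sumr_ge0 => b' _; rewrite subr_ge0.
move=> /allP/(_ a (mem_index_enum _)) /=; rewrite psumr_eq0; last by move=> b' _; rewrite subr_ge0.
move=> /allP/(_ b (mem_index_enum _)) /=; rewrite bS /= subr_eq0 => /eqP st.
by apply: (gibbs_eq (q0 a b) _ (pos a b) (esym st)); rewrite divr_ge0// ltW.
Qed.

(** With [u] the inverse of the square root of [t], the left side is [2 t ln u], and [ln u <= u]. *)
Lemma xlnx_le (t : R) : 0 <= t -> - (t * ln t) <= 2 * Num.sqrt t.
Proof.
rewrite le_eqVlt => /orP[/eqP<-|t0]; first by rewrite mul0r oppr0 mulr_ge0.
have s0 : 0 < Num.sqrt t by rewrite sqrtr_gt0.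
rewrite -[t in - (t * _)](sqr_sqrtr (ltW t0)) -[t in ln t](sqr_sqrtr (ltW t0)).
rewrite lnXn// -mulrN -mulNrn -lnV ?posrE//.
have sV0 : 0 < (Num.sqrt t)^-1 by rewrite invr_gt0.
have h := ltW (ln_sublinear sV0).
rewrite -[ln _ *+ 2]mulr_natl mulrCA ler_pM2l// expr2 -mulrA ger_pMr//.
by rewrite (le_trans (ler_wpM2l (ltW s0) h))// divff ?gt_eqF.
Qed.

End finite_entropy.

(** * Topological entropy of the Markov chain *)

Section growth_rate.
Context (R : realType).
Local Open Scope ereal_scope.

Lemma limn_le_rate (u : nat -> R) (A C : R) : (0 <= A)%R ->
  (forall n, u n <= A * n%:R + C)%R ->
  limn (fun n => (u n / n%:R)%:E) <= A%:E.
Proof.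
move=> A0 uAC; set v := fun n => _.
(* A divergent sequence has the default limit 0, whence the hypothesis [0 <= A]. *)
have [cv|dv] := pselect (cvgn v); last by rewrite dvgP// lee_fin.
apply/lee_addgt0Pr => e e0; apply: lime_le => //.
have N0 : (0 <= `|C| / e)%R by rewrite divr_ge0// ltW.
exists (Num.Def.archi_bound (`|C| / e)).+1 => // n /= Nn.
have n0 : (0 < n%:R :> R)%R by rewrite ltr0n (leq_trans _ Nn).
rewrite lee_fin ler_pdivrMr// (le_trans (uAC n))// mulrDl lerD2l.
rewrite (le_trans (ler_norm C))// -ler_pdivrMl// mulrC (le_trans (ltW (archi_boundP N0)))//.
by rewrite ler_nat ltnW.
Qed.

(** Only positive lengths are prescribed, because the count of words does not follow its geometric
    formula at the empty word. *)
Lemma limn_rate (u : nat -> R) (A C : R) :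
  (forall n, u n.+1 = A * n.+1%:R + C)%R ->
  limn (fun n => (u n / n%:R)%:E) = A%:E.
Proof.
move=> uAC; apply/cvg_lim => //; apply: cvg_EFin; first exact: nearW.
apply/cvgrPdist_le => e e0.
have N0 : (0 <= `|C| / e)%R by rewrite divr_ge0// ltW.
exists (Num.Def.archi_bound (`|C| / e)).+1 => // -[//|n] /= Nn.
have n0 : (0 < n.+1%:R :> R)%R by rewrite ltr0n.
rewrite uAC mulrDl mulfK ?gt_eqF// opprD addrA subrr add0r normrN normrM normfV.
rewrite (gtr0_norm n0) ler_pdivrMr// -ler_pdivrMl// mulrC.
by rewrite (le_trans (ltW (archi_boundP N0)))// ler_nat ltnW.
Qed.

End growth_rate.

Lemma ler_ln_nat (R : realType) (m n : nat) : (m <= n)%N -> (0 < n)%N ->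
  ln (m%:R : R) <= ln n%:R.
Proof.
case: m => [|m] mn n0; last by rewrite ler_ln ?posrE ?ltr0n// ler_nat.
by rewrite ln0// ln_ge0// ler1n.
Qed.

Lemma bigminn_le (I : eqType) (r : seq I) (P : pred I) (F : I -> nat) m i :
  i \in r -> P i -> (\big[minn/m]_(j <- r | P j) F j <= F i)%N.
Proof.
elim: r => // j r IHr; rewrite in_cons big_cons => /orP[/eqP <- ->|ir Pi].
  exact: geq_minl.
by case: ifP => _; rewrite ?(leq_trans (geq_minr _ _))// IHr.
Qed.

Section words.
Context (G : pfinType) (X : set (config G)) (X_markov : is_markov_chain X).
Context (X_letters : uses_all_letters X) (k : nat).
Hypothesis E_card : forall a, #|[set b | edge X a b]%SET| = k.

Definition words n := [set t : n.-tuple G | sorted (edge X) t]%SET.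

Lemma card_words n : #|words n.+1| = (#|G| * k ^ n)%N.
Proof.
rewrite -sum1_card big_set/=.
rewrite (reindex (fun u : G * n.-tuple G => [tuple of u.1 :: u.2])) /=; last first.
  exists (fun t : n.+1.-tuple G => (thead t, [tuple of behead t])).
    by move=> [b t] _; congr pair; apply: val_inj.
  by move=> t _; rewrite /= -tuple_eta.
rewrite -(pair_big_dep xpredT (fun b (t : n.-tuple G) => path (edge X) b t) (fun _ _ => 1%N))/=.
rewrite -sum_nat_const; apply: eq_bigr => b _.
by rewrite sum1_card -(card_path_tuples n b E_card); apply: eq_card => t; rewrite !inE.
Qed.

Definition window (n : nat) (i : int) (x : config G) : n.-tuple G :=
  mktuple (fun j : 'I_n => x (i + j%:Z)).

Lemma window_nth n i x g j : (j < n)%N -> nth g (window n i x) j = x (i + j%:Z).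
Proof.
by move=> jn; rewrite -[j]/(val (Ordinal jn)) -tnth_nth tnth_mktuple.
Qed.

Lemma window_word n i x : X x -> window n i x \in words n.
Proof.
move=> Xx; rewrite inE; case: n => [|n]; first by rewrite tuple0.
rewrite (_ : tval _ = x i :: mkseq (fun j => x (i + j.+1%:Z)) n).
  exact: path_of_point.
apply: (@eq_from_nth _ (x i)); rewrite size_tuple /= ?size_mkseq// => j jn.
by rewrite window_nth//; case: j jn => [|j] jn; rewrite ?addr0//= nth_mkseq.
Qed.

Lemma word_window n i (t : n.-tuple G) : t \in words n ->
  exists2 x, X x & window n i x = t.
Proof.
have letters := letter_point X_markov X_letters.
case: n t => [|n] t.
  by have [x Xx _] := letters point; exists x => //; rewrite [LHS]tuple0 [RHS]tuple0.
case/tupleP: t => g t; rewrite inE /= => /(realize_path X_markov letters)[x Xx xt].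
exists (shift_by (- i) x); first by rewrite (subshift_by _ _ X_markov.1).
apply: eq_from_tnth => j; rewrite tnth_mktuple /shift_by addrAC subrr add0r.
by rewrite xt ?(tnth_nth g)// size_tuple -ltnS.
Qed.

Context (R : realType).
Hypothesis k_gt0 : (0 < k)%N.

Lemma ln_card_words n : ln (#|words n.+1|%:R : R) = ln k%:R * n%:R + ln #|G|%:R.
Proof.
have G0 : (0 < #|G|)%N by apply/card_gt0P; exists point.
rewrite card_words natrM lnM ?posrE ?ltr0n ?expn_gt0 ?k_gt0//.
by rewrite natrX lnXn ?ltr0n// addrC mulr_natr.
Qed.

(** If [m] is a Lebesgue number of the cover, the letters of [x] on [-m, n + m) single out a cell of
    the [n]-fold join containing [x], so one cell per word is enough. *)
Lemma topological_entropy_le : (topological_entropy R X (@config_shift G) <= (ln k%:R)%:E)%E.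
Proof.
have lnk0 : 0 <= ln (k%:R : R) by rewrite ln_ge0// ler1n.
apply: ge_ereal_sup => _ [k0 [U [Ucov ->]]].
have [m mU] := config_lebesgue_number X_markov.1.1 Ucov.
(* The cells need [n + 2 m] letters; one more makes the length a successor, as in
   [ln_card_words]. *)
apply: (limn_le_rate (C := ln k%:R * m.*2%:R + ln #|G|%:R)) => // n.
rewrite addrA -mulrDr -natrD -ln_card_words; apply: ler_ln_nat; last first.
  by rewrite card_words muln_gt0 expn_gt0 k_gt0 andbT; apply/card_gt0P; exists point.
have chooseP (t : (n + m.*2).+1.-tuple G) : {w : {ffun 'I_n -> 'I_k0} | t \in words _ ->
    forall x, X x -> window _ (- m%:Z) x = t -> join_cell (@config_shift G) U w x}.
  apply: cid; have [tw|] := boolP (t \in words _); last first.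
    have [x0 Xx0 _] := letter_point X_markov X_letters point.
    by have [j0 _] := mU _ Xx0; exists [ffun=> j0].
  have [y Xy yt] := word_window (- m%:Z) tw.
  have iP (i : 'I_n) : {j | cyl m (shift_by i%:Z y) `<=` U j}.
    by apply/cid/mU; rewrite (subshift_by _ _ X_markov.1).
  exists [ffun i => sval (iP i)] => _ x Xx xt i; rewrite ffunE.
  apply: (svalP (iP i)) => j jm; rewrite iter_shift /shift_by.
  have jn : (absz (j + i%:Z + m%:Z)%R < (n + m.*2).+1)%N by have := ltn_ord i; lia.
  have e : - m%:Z + (absz (j + i%:Z + m%:Z)%R)%:Z = j + i%:Z by have := ltn_ord i; lia.
  have := congr1 (fun t => nth point (tval t) (absz (j + i%:Z + m%:Z)%R)) (etrans xt (esym yt)).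
  by rewrite !window_nth// e.
apply: (leq_trans _ (leq_imset_card (fun t => sval (chooseP t)) (mem (words _)))).
apply: bigminn_le; first exact: mem_index_enum.
apply/asboolP => x Xx; exists (sval (chooseP (window _ (- m%:Z) x))); last first.
  by apply: (svalP (chooseP _)) => //; exact: window_word.
by apply/imsetP; exists (window _ (- m%:Z) x) => //; exact: window_word.
Qed.

(** The cover by the letter at [0] is a partition, so the cells of its join are disjoint cylinders
    and a subcover must keep every one that meets [X], that is, one per word. *)
Lemma topological_entropy_ge : ((ln k%:R)%:E <= topological_entropy R X (@config_shift G))%E.
Proof.
pose U (j : 'I_#|G|) : set (config G) := [set x | x 0 = enum_val j].
apply: ereal_sup_ubound; exists #|G|, U; split.
  split=> [j|x _]; last by exists (enum_rank (x 0)) => //=; rewrite /U /= enum_rankK.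
  rewrite openE => x Ux; apply/nbhs_cylP; exists 0%N => y yx.
  by rewrite /U /= yx.
apply/esym/(limn_rate (C := ln #|G|%:R - ln k%:R)) => n.
rewrite -natr1 mulrDr mulr1 addrACA subrr addr0 -ln_card_words; congr (ln _%:R).
pose w (t : n.+1.-tuple G) : {ffun 'I_n.+1 -> 'I_#|G|} := [ffun i => enum_rank (tnth t i)].
have winj : injective w.
  move=> t t' tt'; apply: eq_from_tnth => i; apply: enum_rank_inj.
  by have := congr1 (fun f : {ffun _} => f i) tt'; rewrite !ffunE.
have wP x : join_cell (@config_shift G) U (w (window n.+1 0 x)) x.
  move=> i; rewrite /U /= ffunE enum_rankK tnth_mktuple iter_shift /shift_by.
  by congr (x _).
apply/eqP; rewrite eqn_leq; apply/andP; split.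
  rewrite -(card_imset _ winj); apply: bigminn_le; first exact: mem_index_enum.
  apply/asboolP => x Xx; exists (w (window n.+1 0 x)) => //.
  by apply/imset_f; exact: window_word.
rewrite /cover_number; apply: (big_ind (fun m => #|words n.+1| <= m)%N).
- by rewrite -card_tuple max_card.
- by move=> a b; rewrite leq_min => -> ->.
move=> S /asboolP SX; rewrite -(card_imset _ winj); apply: subset_leq_card.
apply/fintype.subsetP => _ /imsetP[t tw ->].
have [x Xx xt] := word_window 0 tw; have [v vS vx] := SX _ Xx.
suff -> : w t = v by [].
apply/ffunP => i; rewrite ffunE -xt tnth_mktuple; have := vx i.
by rewrite /U /= iter_shift /shift_by => ->; rewrite enum_valK.
Qed.

End words.

(** * Entropies of partitions and of invariant measures *)

Section partition_entropies.
Context (R : realType) (d : measure_display) (T : measurableType d).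
Context (mu : probability T R).
Implicit Types A B C : finType.

(* Finite partitions are encoded by maps to a finite type. *)
Definition fmeas A (f : T -> A) : Prop := forall a, measurable (f @^-1` [set a]).

Definition law A (f : T -> A) (a : A) : R := fine (mu (f @^-1` [set a])).

Definition ent A (f : T -> A) : R := H (law f).

Definition joint A B (f : T -> A) (g : T -> B) (x : T) : A * B := (f x, g x).

(** Conditional entropy of [f] given [g]. *)
Definition cent A B (f : T -> A) (g : T -> B) : R := ent (joint f g) - ent g.

Lemma muK (S : set T) : measurable S -> (fine (mu S))%:E = mu S.
Proof. by move=> mS; rewrite fineK// fin_num_measure. Qed.

Lemma fmeas_preimage A (f : T -> A) (S : set A) : fmeas f -> measurable (f @^-1` S).
Proof.
move=> mf; rewrite (_ : _ @^-1` _ = \bigcup_(a in S) f @^-1` [set a]).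
  by apply: fin_bigcup_measurable => // a _; exact: mf.
apply/seteqP; split=> [x Sx|x [a Sa /= fx]]; first by exists (f x).
exact: (eq_ind_r S Sa fx).
Qed.

Lemma fmeas_comp A B (h : A -> B) (f : T -> A) : fmeas f -> fmeas (h \o f).
Proof. by move=> mf b; rewrite comp_preimage; exact: fmeas_preimage. Qed.

Lemma fmeas_joint A B (f : T -> A) (g : T -> B) :
  fmeas f -> fmeas g -> fmeas (joint f g).
Proof.
move=> mf mg [a b]; rewrite (_ : _ @^-1` _ = f @^-1` [set a] `&` g @^-1` [set b]).
  exact: measurableI.
by apply/seteqP; split=> x [/= <- <-].
Qed.

Lemma law_ge0 A (f : T -> A) a : 0 <= law f a.
Proof. by rewrite /law fine_ge0. Qed.

Lemma law_set A (f : T -> A) (P : pred A) : fmeas f ->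
  fine (mu (f @^-1` [set` P])) = \sum_(a | P a) law f a.
Proof.
move=> mf; apply: EFin_inj; rewrite muK; last exact: fmeas_preimage.
rewrite -sumEFin (eq_bigr (fun a => mu (f @^-1` [set a]))); last first.
  by move=> a _; rewrite /law muK.
rewrite bigfs ?index_enum_uniq//; last by move=> a _; rewrite mem_index_enum.
rewrite -measure_fin_bigcup//; last first.
  by apply/trivIsetP => a b _ _ /eqP ab; rewrite -subset0 => x [/= -> /ab].
congr (mu _); apply/seteqP; split=> [x Px|x [a Pa /= fx]]; first by exists (f x).
exact: (eq_ind_r (fun a => P a) Pa fx).
Qed.

Lemma law_comp A B (h : A -> B) (f : T -> A) b : fmeas f ->
  law (h \o f) b = \sum_(a | h a == b) law f a.
Proof.
move=> mf; rewrite -law_set//; congr (fine (mu _)).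
by apply/seteqP; split=> x /= /eqP.
Qed.

Lemma law_sum A (f : T -> A) : fmeas f -> \sum_a law f a = 1.
Proof.
move=> mf; rewrite -(law_set xpredT mf) (_ : _ @^-1` _ = setT) ?probability_setT//.
by apply/seteqP; split.
Qed.

Lemma law_marginal A B (f : T -> A) (g : T -> B) b : fmeas f -> fmeas g ->
  law g b = \sum_a law (joint f g) (a, b).
Proof.
move=> mf mg; rewrite [LHS](@law_comp _ _ snd (joint f g)); last exact: fmeas_joint.
rewrite (reindex_onto (fun a => (a, b)) fst) /=; last by move=> [a b'] /= /eqP ->.
by apply: eq_bigl => a; rewrite !eqxx.
Qed.

Lemma ent_comp A B (h : A -> B) (f : T -> A) : fmeas f -> ent (h \o f) <= ent f.
Proof.
move=> mf; rewrite /ent (_ : law (h \o f) = fun b => \sum_(a | h a == b) law f a).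
  by apply: H_map => a; exact: law_ge0.
by apply/funext => b; exact: law_comp.
Qed.

Lemma ent_factor A B (f : T -> A) (g : T -> B) (h : A -> B) :
  fmeas f -> (forall x, g x = h (f x)) -> ent g <= ent f.
Proof.
by move=> mf gf; rewrite (_ : g = h \o f); [exact: ent_comp|exact/funext].
Qed.

Lemma ent_equiv A B (f : T -> A) (g : T -> B) (h : A -> B) (k : B -> A) :
  fmeas f -> fmeas g ->
  (forall x, g x = h (f x)) -> (forall x, f x = k (g x)) -> ent g = ent f.
Proof.
by move=> mf mg gf fg; apply/eqP; rewrite eq_le (ent_factor mf gf) (ent_factor mg fg).
Qed.

Lemma ent_submodular A B C (f : T -> A) (g : T -> B) (h : T -> C) :
  fmeas f -> fmeas g -> fmeas h ->
  ent (joint f (joint g h)) + ent h <= ent (joint f h) + ent (joint g h).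
Proof.
move=> mf mg mh; pose q a b c := law (joint f (joint g h)) (a, (b, c)).
have lac a c : law (joint f h) (a, c) = \sum_b q a b c.
  rewrite (law_marginal _ mg (fmeas_joint mf mh)); apply: eq_bigr => b _.
  by congr (fine (mu _)); apply/seteqP; split=> x [/= <- <- <-].
have lbc b c : law (joint g h) (b, c) = \sum_a q a b c.
  by rewrite (law_marginal _ mf (fmeas_joint mg mh)).
have lc c : law h c = \sum_a \sum_b q a b c.
  by rewrite (law_marginal _ mf mh); apply: eq_bigr => a _; rewrite lac.
have := @H_submodular R A B C q (fun a b c => law_ge0 _ _).
congr (_ + _ <= _ + _); congr H.
- by apply/funext => -[a [b c]].
- by apply/funext => c; rewrite lc.
- by apply/funext => -[a c]; rewrite lac.
- by apply/funext => -[b c]; rewrite lbc.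
Qed.

Lemma cent_ge0 A B (f : T -> A) (g : T -> B) : fmeas f -> fmeas g -> 0 <= cent f g.
Proof.
move=> mf mg; rewrite subr_ge0.
by apply: (ent_factor (h := snd)) => //; exact: fmeas_joint.
Qed.

(** Submodularity, in which [joint g h] carries no more information than [g] because [h] is a
    function of [g]. *)
Lemma cent_factor A B C (f : T -> A) (g : T -> B) (h : T -> C) (k : B -> C) :
  fmeas f -> fmeas g -> (forall x, h x = k (g x)) -> cent f g <= cent f h.
Proof.
move=> mf mg hk; have mh : fmeas h.
  by rewrite (_ : h = k \o g); [exact: fmeas_comp|exact/funext].
rewrite /cent lerBlDr addrAC lerBrDr.
have e1 : ent (joint f (joint g h)) = ent (joint f g).
  apply: (ent_equiv (h := fun t => (t.1, (t.2, k t.2))) (k := fun t => (t.1, t.2.1))).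
  - exact: fmeas_joint.
  - by apply: fmeas_joint => //; exact: fmeas_joint.
  - by move=> x; rewrite /joint hk.
  - by [].
have e2 : ent (joint g h) = ent g.
  apply: (ent_equiv (h := fun t => (t, k t)) (k := fst)) => //.
  - exact: fmeas_joint.
  - by move=> x; rewrite /joint hk.
by rewrite -e1 -e2; exact: ent_submodular.
Qed.

Lemma cent_chain A B C (a : T -> A) (a' : T -> B) (b : T -> C) :
  fmeas a -> fmeas a' -> fmeas b ->
  cent (joint a a') b = cent a (joint a' b) + cent a' b.
Proof.
move=> ma ma' mb; rewrite /cent addrA subrK; congr (_ - _).
apply: (ent_equiv (h := fun t => ((t.1, t.2.1), t.2.2))
  (k := fun t => (t.1.1, (t.1.2, t.2)))) => //.
  by apply: fmeas_joint => //; exact: fmeas_joint.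
by apply: fmeas_joint => //; exact: fmeas_joint.
Qed.

Section dynamics.
Context (f : T -> T).
Hypotheses (mf : measurable_fun setT f) (f_inv : invariant_measure mu f).

Lemma iter_measurable n : measurable_fun setT (iter n f).
Proof. by elim: n => [|n IH]; [exact: measurable_id|exact: measurableT_comp]. Qed.

Lemma iter_invariant n : invariant_measure mu (iter n f).
Proof.
elim: n => [//|n IH] S mS; rewrite (_ : iter n.+1 f = f \o iter n f)//.
rewrite comp_preimage IH ?f_inv// -[X in measurable X]setTI; exact: mf.
Qed.

Lemma fmeas_iter A (P : T -> A) n : fmeas P -> fmeas (P \o iter n f).
Proof.
move=> mP a; rewrite comp_preimage -[X in measurable X]setTI.
by apply: iter_measurable => //; exact: mP.
Qed.

Lemma ent_iter A (P : T -> A) n : fmeas P -> ent (P \o iter n f) = ent P.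
Proof.
move=> mP; rewrite /ent; congr H; apply/funext => a.
by rewrite /law comp_preimage iter_invariant.
Qed.

Definition itin A (P : T -> A) n (x : T) : {ffun 'I_n -> A} :=
  [ffun i : 'I_n => P (iter i f x)].

Lemma fmeas_itin A (P : T -> A) n : fmeas P -> fmeas (itin P n).
Proof.
move=> mP w; rewrite (_ : _ @^-1` _ = \bigcap_(i in [set: 'I_n]) (P \o iter i f) @^-1` [set w i]).
  by apply: fin_bigcap_measurable => // i _; exact: fmeas_iter.
apply/seteqP; split=> x /=; first by move=> <- i _ /=; rewrite ffunE.
by move=> h; apply/ffunP => i; rewrite ffunE; exact: h.
Qed.

Let snoc n A (t : {ffun 'I_n -> A} * A) : {ffun 'I_n.+1 -> A} :=
  [ffun i : 'I_n.+1 => if unlift ord_max i is Some j then t.1 j else t.2].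

Let split_last n A (w : {ffun 'I_n.+1 -> A}) : {ffun 'I_n -> A} * A :=
  ([ffun j : 'I_n => w (lift ord_max j)], w ord_max).

Let itin_snoc A (P : T -> A) n x : itin P n.+1 x = snoc (itin P n x, P (iter n f x)).
Proof.
apply/ffunP => i; rewrite !ffunE; case: unliftP => [j ->|->] //.
by rewrite ffunE lift_max.
Qed.

Let itin_split A (P : T -> A) n x :
  (itin P n x, P (iter n f x)) = split_last (itin P n.+1 x).
Proof. by congr pair; [apply/ffunP => j|]; rewrite !ffunE ?lift_max. Qed.

(** By the chain rule each new time adds the entropy of [P] given a record that includes [Q] at the
    same time, which invariance bounds by [cent P Q]. *)
Lemma cent_itin A B (P : T -> A) (Q : T -> B) n : fmeas P -> fmeas Q ->
  cent (itin P n) (itin Q n) <= cent P Q *+ n.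
Proof.
move=> mP mQ; have mitin C (S : T -> C) m : fmeas S -> fmeas (itin S m) by exact: fmeas_itin.
elim: n => [|n IH].
  rewrite mulr0n /cent subr_le0.
  apply: (ent_factor (h := fun t => (itin P 0 point, t))); first exact: mitin.
  by move=> x; congr pair; apply/ffunP => -[].
have mPn := fmeas_iter n mP; have mQn := fmeas_iter n mQ.
have := mitin _ _ n mP; have := mitin _ _ n mQ; move=> mQi mPi.
set a := itin P n in IH mPi; set b := itin Q n in IH mQi.
set a' := P \o iter n f in mPn; set b' := Q \o iter n f in mQn.
have -> : cent (itin P n.+1) (itin Q n.+1) = cent (joint a a') (joint b b').
  congr (_ - _).
    apply: (ent_equiv (h := fun t => (snoc t.1, snoc t.2))
      (k := fun t => (split_last t.1, split_last t.2))).
    - by apply: fmeas_joint; exact: fmeas_joint.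
    - by apply: fmeas_joint; exact: mitin.
    - by move=> x; rewrite /joint !itin_snoc.
    - by move=> x; rewrite /joint -!itin_split.
  apply: (ent_equiv (h := @snoc n B) (k := @split_last n B)).
  - exact: fmeas_joint.
  - exact: mitin.
  - by move=> x; rewrite itin_snoc.
  - by move=> x; rewrite -itin_split.
rewrite cent_chain//; last exact: fmeas_joint.
rewrite mulrSr; apply: lerD.
  apply: le_trans IH; apply: (cent_factor (k := fun t => t.2.1)) => //.
  by apply: fmeas_joint => //; exact: fmeas_joint.
have <- : cent a' b' = cent P Q.
  by rewrite /cent -(ent_iter n mQ) -(ent_iter n (fmeas_joint mP mQ)).
by apply: (cent_factor (k := snd)) => //; exact: fmeas_joint.
Qed.

Lemma ent_itin_le A B (P : T -> A) (Q : T -> B) n : fmeas P -> fmeas Q ->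
  ent (itin P n) <= ent (itin Q n) + cent P Q *+ n.
Proof.
move=> mP mQ; have := cent_itin n mP mQ; rewrite /cent lerBlDl; apply: le_trans.
by apply: (ent_factor (h := fst)) => //; apply: fmeas_joint; exact: fmeas_itin.
Qed.

Lemma ent_itin_bound A B (P : T -> A) (Q : T -> B) (a C : R) : fmeas P -> fmeas Q ->
  0 <= a -> (forall n, ent (itin Q n) <= a * n%:R + C) ->
  (limn (fun n => (ent (itin P n) / n%:R)%:E) <= (a + cent P Q)%:E)%E.
Proof.
move=> mP mQ a0 h; apply: (limn_le_rate (C := C)); first by rewrite addr_ge0// cent_ge0.
move=> n; apply: le_trans (ent_itin_le n mP mQ) _.
by rewrite mulrDl addrAC [cent _ _ * _]mulr_natr lerD2r.
Qed.

End dynamics.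

Lemma law_le1 A (f : T -> A) a : fmeas f -> law f a <= 1.
Proof.
move=> mf; rewrite -(law_sum mf) (bigD1 a)//= lerDl sumr_ge0// => b _.
exact: law_ge0.
Qed.

(* Off-diagonal terms are bounded by [- t ln t <= 2 sqrt t], diagonal ones by
   the Gibbs inequality. *)
Lemma cent_agree A (P g : T -> A) (dl : R) : fmeas P -> fmeas g ->
  fine (mu [set x | P x <> g x]) <= dl ->
  cent P g <= dl + (2 * Num.sqrt dl) *+ #|{: A * A}|.
Proof.
move=> mP mg Pg; pose q a b := law (joint P g) (a, b).
have mPg := fmeas_joint mP mg.
have q0 a b : 0 <= q a b by exact: law_ge0.
have lg b : law g b = \sum_a q a b by exact: law_marginal.
have off : \sum_(t : A * A | t.1 != t.2) q t.1 t.2 = fine (mu [set x | P x <> g x]).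
  rewrite (eq_bigr (fun t => law (joint P g) t)); last by move=> [].
  rewrite -law_set//; congr (fine (mu _)).
  by apply/seteqP; split=> x /= /eqP.
have dl0 : 0 <= dl by apply: le_trans Pg; rewrite fine_ge0.
have centE : cent P g = \sum_(t : A * A) q t.1 t.2 * (ln (law g t.2) - ln (q t.1 t.2)).
  rewrite /cent /ent /H (eq_bigr (fun t => - (q t.1 t.2 * ln (q t.1 t.2)))); last by move=> [].
  have -> : \sum_b - (law g b * ln (law g b)) = \sum_(t : A * A) - (q t.1 t.2 * ln (law g t.2)).
    rewrite -(pair_bigA _ (fun a b => - (q a b * ln (law g b))))/= exchange_big.
    by apply: eq_bigr => b _; rewrite {1}lg mulr_suml -sumrN.
  by rewrite -sumrB; apply: eq_bigr => t _; ring.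
rewrite centE (bigID (fun t : A * A => t.1 == t.2))/=; apply: lerD.
  apply: le_trans Pg; rewrite -off.
  have -> : \sum_(t : A * A | t.1 != t.2) q t.1 t.2 =
      \sum_(t : A * A | t.1 == t.2) (law g t.2 - q t.1 t.2).
    have h (F : A -> A -> R) : \sum_(t : A * A | t.1 == t.2) F t.1 t.2 = \sum_b F b b.
      rewrite -(pair_big_dep xpredT (fun a b => a == b) F)/=.
      by apply: eq_bigr => a _; rewrite (big_pred1 a)// => b; rewrite /= eq_sym.
    rewrite (h (fun a b => law g b - q a b)) sumrB -(h q).
    apply/eqP; rewrite eq_sym subr_eq addrC; apply/eqP.
    rewrite -(bigID (fun t : A * A => t.1 == t.2) xpredT)/=.
    rewrite -(pair_bigA _ q)/= exchange_big; apply: eq_bigr => b _; exact: lg.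
  apply: ler_sum => t _; apply: gibbs => //; first exact: law_ge0.
  by move=> qt; rewrite lg (lt_le_trans qt)// (bigD1 t.1)//= lerDl sumr_ge0.
rewrite -sumr_const big_mkcond /=; apply: ler_sum => t _; case: ifPn => [t12|_]; last first.
  by rewrite mulr_ge0// sqrtr_ge0.
have qdl : q t.1 t.2 <= dl.
  by apply: le_trans Pg; rewrite -off (bigD1 t)//= lerDl sumr_ge0.
apply: (@le_trans _ _ (2 * Num.sqrt (q t.1 t.2))).
  apply: le_trans (xlnx_le _) => //; rewrite mulrBr gerDr.
  by rewrite mulr_ge0_le0// ln_le0// law_le1.
by rewrite ler_wpM2l// ler_wsqrtr.
Qed.

Lemma cent_agree_small A (e : R) : 0 < e -> exists2 dl : R, 0 < dl &
  forall P g : T -> A, fmeas P -> fmeas g ->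
    fine (mu [set x | P x <> g x]) <= dl -> cent P g <= e.
Proof.
(* As [s <= 1], the bound of [cent_agree] for [dl = s ^+ 2] is at most [s * K]. *)
move=> e0; pose K : R := (#|{: A * A}|)%:R * 2 + 1.
have K0 : 0 < K by rewrite ltr_wpDl// mulr_ge0.
pose s := Num.min 1 (e / K); have s0 : 0 < s by rewrite lt_min ltr01 divr_gt0.
exists (s ^+ 2) => [|P g mP mg h]; first by rewrite exprn_gt0.
apply: le_trans (cent_agree mP mg h) _.
rewrite sqrtr_sqr (gtr0_norm s0).
have s1 : s <= 1 by rewrite ge_min lexx.
have sK : s * K <= e by rewrite -ler_pdivlMr// ge_min lexx orbT.
apply: le_trans sK; rewrite /K mulrDr mulr1 addrC -mulr_natl [s * _]mulrC mulrA lerD2l.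
by rewrite expr2 ger_pMr.
Qed.

End partition_entropies.

Lemma measurableY d (T : measurableType d) (A B : set T) :
  measurable A -> measurable B -> measurable (A `+` B).
Proof. by move=> mA mB; apply: measurableU; exact: measurableD. Qed.

(** * Approximation of measurable sets and partitions by cylinders *)

Section config_measurable.
Context (G : pfinType).

Lemma measurable_coord (i : int) (g : G) : measurable [set x : config G | x i = g].
Proof. by apply: sub_sigma_algebra; exists i, g. Qed.

Lemma measurable_config_fun d (T : measurableType d) (f : T -> config G) :
  (forall i g, measurable [set x | f x i = g]) -> measurable_fun setT f.
Proof.
move=> mf; apply: (measurability (@cylinders G)) => //.
by move=> _ [_ [i [g ->]] <-]; rewrite setTI; exact: mf.
Qed.

Lemma fmeas_window n i : fmeas (@window G n i).
Proof.
move=> t; rewrite (_ : _ @^-1` _ = \bigcap_(j in [set: 'I_n]) [set x | x (i + j%:Z) = tnth t j]).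
  by apply: fin_bigcap_measurable => // j _; exact: measurable_coord.
apply/seteqP; split=> x /=; first by move=> <- j _ /=; rewrite tnth_mktuple.
by move=> h; apply: eq_from_tnth => j; rewrite tnth_mktuple; exact: h.
Qed.

Lemma measurable_shift_by n : measurable_fun setT (@shift_by G n).
Proof. by apply: measurable_config_fun => i g; exact: measurable_coord. Qed.

Lemma measurable_config_shift : measurable_fun setT (@config_shift G).
Proof. by apply: measurable_config_fun => i g; exact: measurable_coord. Qed.

Lemma measurable_block_map (phi : G -> G -> G) : measurable_fun setT (block_map phi).
Proof.
apply: measurable_config_fun => i g.
rewrite (_ : mkset _ = window 2 i @^-1` [set t | phi (tnth t ord0) (tnth t ord_max) = g]).
  by apply: fmeas_preimage; exact: fmeas_window.
by apply/seteqP; split=> x /=; rewrite !tnth_mktuple addr0.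
Qed.

Lemma measurable_markov (X : set (config G)) : is_markov_chain X -> measurable X.
Proof.
move=> Xm; have mE (i : int) : measurable [set x : config G | edge X (x i) (x (i + 1))].
  rewrite (_ : mkset _ = window 2 i @^-1` [set t | edge X (tnth t ord0) (tnth t ord_max)]).
    by apply: fmeas_preimage; exact: fmeas_window.
  by apply/seteqP; split=> x /=; rewrite !tnth_mktuple addr0.
rewrite (_ : X = (\bigcap_n [set x | edge X (x n%:Z) (x (n%:Z + 1))]) `&`
    (\bigcap_n [set x | edge X (x (- n%:Z)) (x (- n%:Z + 1))])).
  by apply: measurableI; apply: bigcapT_measurable => n; exact: mE.
apply/seteqP; split=> [x /(markov_edgesP Xm) Ex|x [Ep En]]; first by split=> n _; exact: Ex.
by apply/(markov_edgesP Xm) => i; case: (intP i) => [|n|n]; [exact: Ep|exact: Ep|exact: En].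
Qed.

Definition agree n (x y : config G) := forall i : int, (`|i| <= n)%N -> x i = y i.

Definition local (n : nat) (C : set (config G)) := forall x y, agree n x y -> C x -> C y.

Definition centered n (x : config G) : n.*2.+1.-tuple G := window n.*2.+1 (- n%:Z) x.

Lemma centered_agree n x y : centered n x = centered n y -> agree n x y.
Proof.
move=> xy i ni; have := congr1 (fun t => nth point (tval t) (absz (i + n%:Z)%R)) xy.
rewrite !window_nth; [|lia..].
by have -> : - n%:Z + (absz (i + n%:Z)%R)%:Z = i by lia.
Qed.

Lemma agree_centered n x y : agree n x y -> centered n x = centered n y.
Proof.
move=> xy; apply: eq_from_tnth => j; rewrite !tnth_mktuple; apply: xy.
by have := ltn_ord j; lia.
Qed.

Lemma agree_le m n x y : (m <= n)%N -> agree n x y -> agree m x y.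
Proof. by move=> mn xy i im; apply: xy; exact: leq_trans mn. Qed.

Lemma local_measurable n C : local n C -> measurable C.
Proof.
move=> lC; rewrite (_ : C = centered n @^-1` (centered n @` C)).
  by apply: fmeas_preimage; exact: fmeas_window.
apply/seteqP; split=> [x Cx|x [y Cy /centered_agree/lC]]; first by exists x.
exact.
Qed.

Lemma local_le m n C : (m <= n)%N -> local m C -> local n C.
Proof. by move=> mn lC x y /(agree_le mn)/lC. Qed.

Lemma centered_factor n (A : Type) (g : config G -> A) :
  (forall x y, agree n x y -> g x = g y) ->
  exists k, forall x, g x = k (centered n x).
Proof.
move=> gn; exists (fun t => g (fun i => nth point (tval t) (absz (i + n%:Z)%R))) => x.
apply: gn => i ni; rewrite window_nth; last by lia.
by have -> : - n%:Z + (absz (i + n%:Z)%R)%:Z = i by lia.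
Qed.

Context (R : realType) (mu : probability (config G) R).

Definition approximable (A : set (config G)) := measurable A /\
  forall e : R, 0 < e -> exists n C, local n C /\ (mu (A `+` C) <= e%:E)%E.

Lemma approximable_coord (i : int) g : approximable [set x | x i = g].
Proof.
split=> [|e e0]; first exact: measurable_coord.
exists `|i|%N, [set x | x i = g]; split; last by rewrite setYK measure0 lee_fin ltW.
by move=> x y xy /=; rewrite xy.
Qed.

Lemma approximableC A : approximable A -> approximable (~` A).
Proof.
move=> [mA aA]; split=> [|e e0]; first exact: measurableC.
have [n [C [lC AC]]] := aA e e0; exists n, (~` C); split.
  by move=> x y xy nCx Cy; apply: nCx; apply: lC Cy => i /xy.
by rewrite -(setYTC A) -(setYTC C) [C `+` _]setYC setYA -(setYA A) setYK setY0.
Qed.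

Lemma approximableU A B : approximable A -> approximable B -> approximable (A `|` B).
Proof.
move=> [mA aA] [mB aB]; split=> [|e e0]; first exact: measurableU.
have e2 : 0 < e / 2 by rewrite divr_gt0.
have [n [C [lC AC]]] := aA _ e2; have [m [D [lD BD]]] := aB _ e2.
exists (maxn n m), (C `|` D); split.
  move=> x y xy [Cx|Dx]; [left|right].
    by apply: (local_le (leq_maxl n m) lC) Cx.
  by apply: (local_le (leq_maxr n m) lD) Dx.
have mC := local_measurable lC; have mD := local_measurable lD.
apply: (@le_trans _ _ (mu ((A `+` C) `|` (B `+` D)))).
  apply: le_measure; rewrite ?inE; [by apply: measurableY; exact: measurableU| |].
    by apply: measurableU; exact: measurableY.
  move=> x [[[Ax|Bx] nCD]|[[Cx|Dx] nAB]].
  - by left; left; split=> // Cx; apply: nCD; left.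
  - by right; left; split=> // Dx; apply: nCD; right.
  - by left; right; split=> // Ax; apply: nAB; left.
  - by right; right; split=> // Bx; apply: nAB; right.
apply: le_trans (measureU2 _ _ _) _; [exact: measurableY|exact: measurableY|].
by rewrite (splitr e) EFinD leeD.
Qed.

(** Half of [e] pays for replacing the union by a finite partial union, by continuity from below,
    and half for approximating the latter. *)
Lemma approximable_bigcup (F : nat -> set (config G)) :
  (forall n, approximable (F n)) -> approximable (\bigcup_n F n).
Proof.
move=> aF; have mF n : measurable (F n) by case: (aF n).
split=> [|e e0]; first exact: bigcupT_measurable.
pose B n := \big[setU/set0]_(i < n) F i.
have aB n : approximable (B n).
  rewrite /B; elim: n => [|n IH]; last by rewrite big_ord_recr; exact: approximableU.
  rewrite big_ord0; split=> // e' e'0; exists 0%N, set0; split=> //.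
  by rewrite setYK measure0 lee_fin ltW.
have mB n : measurable (B n) by case: (aB n).
have e2 : 0 < e / 2 by rewrite divr_gt0.
have BF n : B n `<=` \bigcup_n F n by exact: bigsetU_bigcup.
have cB : mu (B n) @[n --> \oo] --> mu (\bigcup_n F n).
  have -> : \bigcup_n F n = \bigcup_n B n.
    apply/seteqP; split=> [x [i _ Fx]|x [i _ /BF//]].
    by exists i.+1 => //; rewrite /B big_ord_recr; right.
  apply: (@nondecreasing_cvg_mu _ _ _ mu B mB); first exact: bigcupT_measurable.
  by move=> n m nm; apply/subsetPset; exact: subset_bigsetU.
have [N muN] : exists N, (mu ((\bigcup_n F n) `\` B N) <= (e / 2)%:E)%E.
  have /fine_cvgP[_ /cvgrPdist_le/(_ _ e2)[N _ /(_ N (leqnn N))]] : mu (B n) @[n --> \oo] -->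
    (fine (mu (\bigcup_n F n)))%:E by rewrite fineK// fin_num_measure//; exact: bigcupT_measurable.
  move=> /= h; exists N; rewrite measureD//; [|exact: bigcupT_measurable|by rewrite ltey_eq fin_num_measure//; exact: bigcupT_measurable].
  rewrite setIidr; last exact: BF.
  rewrite -[X in (X - _)%E]fineK ?fin_num_measure//; last exact: bigcupT_measurable.
  rewrite -[X in (_ - X)%E]fineK ?fin_num_measure// -EFinB lee_fin.
  exact: le_trans (ler_norm _) h.
have [_ /(_ _ e2)[n [C [lC BC]]]] := aB N; exists n, C; split=> //.
have mC := local_measurable lC.
apply: (@le_trans _ _ (mu (((\bigcup_n F n) `\` B N) `|` (B N `+` C)))).
  apply: le_measure; rewrite ?inE; [apply: measurableY => //; exact: bigcupT_measurable| |].
    by apply: measurableU; [apply: measurableD => //; exact: bigcupT_measurable|exact: measurableY].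
  move=> x [[Fx nCx]|[Cx nFx]].
    by have [Bx|nBx] := pselect (B N x); [right; left|left].
  by right; right; split=> // /BF.
apply: le_trans (measureU2 _ _ _) _; [apply: measurableD => //; exact: bigcupT_measurable|exact: measurableY|].
by rewrite (splitr e) EFinD leeD.
Qed.

Lemma measurable_approximable A : measurable A -> approximable A.
Proof.
suff : measurable `<=` approximable by exact.
apply: smallest_sub => [|_ [i [g ->]]]; last exact: approximable_coord.
split=> [|B /approximableC|F aF].
- split=> // e e0; exists 0%N, set0; split=> //.
  by rewrite setYK measure0 lee_fin ltW.
- by rewrite setTD.
- exact: approximable_bigcup.
Qed.

(** Approximate every fiber of [P] by a local set and let [g] pick a value whose set contains the
    point. The two maps differ only on the union of [#|A|] symmetric differences, hence the share
    [e']. *)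
Lemma fmeas_approximable (A : finType) (P : config G -> A) (e : R) :
  fmeas P -> 0 < e -> exists n (g : config G -> A),
  (forall x y, agree n x y -> g x = g y) /\ fine (mu [set x | P x <> g x]) <= e.
Proof.
move=> mP e0.
pose e' := e / #|A|%:R.
have A0 : (0 < #|A|)%N by apply/card_gt0P; exists (P point).
have e'0 : 0 < e' by rewrite divr_gt0// ltr0n.
have aP a : {nC : nat * set (config G) | local nC.1 nC.2 /\
    (mu ((P @^-1` [set a]) `+` nC.2) <= e'%:E)%E}.
  apply: cid; have [_ /(_ _ e'0)[n [C h]]] := measurable_approximable (mP a).
  by exists (n, C).
pose C a := (sval (aP a)).2; pose n := \max_a (sval (aP a)).1.
have lC a : local n (C a).
  by apply: local_le (svalP (aP a)).1; exact: (leq_bigmax_cond (P := xpredT) (F := fun a => (sval (aP a)).1)).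
pose g x := odflt (P point) [pick a | `[< C a x >]].
exists n, g; split.
  move=> x y xy; rewrite /g; congr odflt; apply: eq_pick => a.
  by apply: asbool_equiv_eq; split; apply: lC => // i /xy.
have mY a : measurable ((P @^-1` [set a]) `+` C a).
  by apply: measurableY; [exact: mP|exact: local_measurable (lC a)].
have sub : [set x | P x <> g x] `<=` \bigcup_(a in [set: A]) ((P @^-1` [set a]) `+` C a).
  move=> x Pgx; apply: contrapT => nY; apply: Pgx.
  have CP a : C a x <-> P x = a.
    split=> [Cax|Pxa]; apply: contrapT => h; apply: nY; exists a => //; first by right.
    by left.
  rewrite /g; case: pickP => [a /asboolP/CP//|/(_ (P x))/asboolP].
  by case; apply/CP.
have mg : fmeas g.
  move=> a; apply: (@local_measurable n) => x y xy /= <-.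
  by rewrite /g; congr odflt; apply: eq_pick => b; apply: asbool_equiv_eq; split;
    apply: lC => // i /xy.
have mPg : measurable [set x | P x <> g x].
  rewrite (_ : mkset _ = joint P g @^-1` [set t | t.1 <> t.2])//.
  by apply: fmeas_preimage; exact: fmeas_joint.
rewrite -lee_fin muK//.
have sub' : [set x | P x <> g x] `<=`
    \bigcup_(a in [set` (xpredT : pred A)]) ((P @^-1` [set a]) `+` C a).
  by move=> x /sub [a _ Ya]; exists a.
apply: le_trans (content_sub_fsum mu _ _ _ sub') _ => //.
rewrite -(@bigfs _ _ _ A (index_enum A) xpredT) ?index_enum_uniq//; last first.
  by move=> a _; rewrite mem_index_enum.
apply: (@le_trans _ _ (\sum_(a : A) e'%:E)%E).
  by apply: lee_sum => a _; exact: (svalP (aP a)).2.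
by rewrite sumEFin sumr_const -[e' *+ _]mulr_natr divfK// pnatr_eq0 -lt0n.
Qed.

(** [P] is close to a local map, which every large centered window determines; conditioning on the
    window is at least as good as conditioning on that map. *)
Lemma cent_centered (A : finType) (P : config G -> A) (e : R) : fmeas P -> 0 < e ->
  exists n, forall m, (n <= m)%N -> cent mu P (centered m) <= e.
Proof.
move=> mP e0; have [dl dl0 small] := cent_agree_small mu A e0.
have [n [g [gn Pg]]] := fmeas_approximable mP dl0.
have mg : fmeas g by move=> a; apply: (@local_measurable n) => x y /gn /= ->.
exists n => m nm; apply: le_trans (small P g mP mg Pg).
have [k gk] := @centered_factor m A g (fun x y xy => gn x y (agree_le nm xy)).
have mc : fmeas (@centered m) by exact: fmeas_window.
exact: (cent_factor _ mP mc gk).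
Qed.

End config_measurable.

Section partition_index.
Context (R : realType) (d : measure_display) (T : measurableType d).
Context (mu : probability T R) (f : T -> T).

Lemma partition_indexP k (P : 'I_k -> set T) : is_measurable_partition P ->
  exists2 idx : T -> 'I_k, fmeas idx & forall i, P i = idx @^-1` [set i].
Proof.
move=> [mP tP cP].
have idxP x : {i | P i x}.
  by apply: cid; have : setT x by []; rewrite -cP => -[i _ Pix]; exists i.
have PE i : P i = (fun x => sval (idxP x)) @^-1` [set i].
  apply/seteqP; split=> [x Pix|x /= <-]; last exact: (svalP (idxP x)).
  by apply: (tP _ _ I I); exists x; split=> //; exact: (svalP (idxP x)).
by exists (fun x => sval (idxP x)) => // i; rewrite -PE.
Qed.

Lemma join_entropyE k (P : 'I_k -> set T) (idx : T -> 'I_k) n :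
  (forall i, P i = idx @^-1` [set i]) ->
  join_entropy mu f P n = ent mu (itin f idx n).
Proof.
move=> PE; apply: eq_bigr => w _.
suff -> : join_cell f P w = itin f idx n @^-1` [set w] by [].
apply/seteqP; split=> x /=.
  by move=> h; apply/ffunP => i; rewrite ffunE; have := h i; rewrite PE.
by move=> <- i; rewrite PE /= ffunE.
Qed.

Lemma measure_entropy_le (a : \bar R) :
  (forall k (P : T -> 'I_k), fmeas P ->
    (limn (fun n => (ent mu (itin f P n) / n%:R)%:E) <= a)%E) ->
  (measure_entropy mu f <= a)%E.
Proof.
move=> h; apply: ge_ereal_sup => _ [k [P [/partition_indexP[idx midx PE] ->]]].
rewrite /partition_entropy (_ : (fun n => _) = fun n => (ent mu (itin f idx n) / n%:R)%:E).
  exact: h.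
by apply/funext => n; rewrite (join_entropyE _ PE).
Qed.

Lemma measure_entropy_ge k (P : T -> 'I_k) : fmeas P ->
  (limn (fun n => (ent mu (itin f P n) / n%:R)%:E) <= measure_entropy mu f)%E.
Proof.
move=> mP; apply: ereal_sup_ubound; exists k, (fun i => P @^-1` [set i]); split.
  split=> //; last by apply/seteqP; split=> // x _; exists (P x).
  by move=> i j _ _ [x [/= <- <-]].
rewrite /partition_entropy; congr (limn _); apply/funext => n.
by rewrite (@join_entropyE _ _ P).
Qed.

End partition_index.

(** * Block entropies of shift-invariant measures *)

Section shift_invariant_measures.
Context (R : realType) (G : pfinType) (nu : probability (config G) R).
Hypothesis nu_shift : invariant_measure nu (@config_shift G).

Lemma shift_by_invariant n : invariant_measure nu (@shift_by G n).
Proof.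
have pos (k : nat) : invariant_measure nu (@shift_by G k%:Z).
  move=> S mS; rewrite (_ : shift_by k%:Z = iter k (@config_shift G)).
    have h := iter_invariant (@measurable_config_shift G) nu_shift k.
    exact: h.
  by apply/funext => x; rewrite iter_shift.
case: (intP n) => [|k|k]; [exact: pos|exact: pos|] => S mS.
have mS' : measurable (shift_by (- k.+1%:Z) @^-1` S).
  by rewrite -[X in measurable X]setTI; exact: measurable_shift_by.
rewrite -(pos k.+1 _ mS'); congr (nu _); apply/seteqP; split=> x /=;
  by rewrite /preimage /= shift_byD addNr shift_by0.
Qed.

Lemma ent_shift (A : finType) (P : config G -> A) n : fmeas P ->
  ent nu (P \o shift_by n) = ent nu P.
Proof.
move=> mP; rewrite /ent; congr H; apply/funext => a.
by rewrite /law comp_preimage shift_by_invariant.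
Qed.
Definition block_ent n : R := ent nu (@window G n 0).

Lemma ent_window n i : ent nu (@window G n i) = block_ent n.
Proof.
rewrite /block_ent -(ent_shift i (@fmeas_window G n 0)); congr ent; apply/funext => x.
by apply: eq_from_tnth => j; rewrite !tnth_mktuple /shift_by add0r addrC.
Qed.

Definition coord (i : int) (x : config G) : G := x i.

Lemma fmeas_coord i : fmeas (coord i).
Proof. by move=> g; exact: measurable_coord. Qed.

Lemma block_ent_increment n i :
  block_ent n.+1 - block_ent n = cent nu (coord (i + n%:Z)) (window n i).
Proof.
rewrite /cent ent_window -(ent_window n.+1 i); congr (_ - _).
apply: (ent_equiv nu (h := fun t : G * n.-tuple G => [tuple of rcons t.2 t.1])
  (k := fun t : n.+1.-tuple G => (tnth t ord_max, [tuple tnth t (widen_ord (leqnSn n) j) | j < n]))).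
- by apply: fmeas_joint; [exact: fmeas_coord|exact: fmeas_window].
- exact: fmeas_window.
- move=> x; apply: val_inj; apply: (@eq_from_nth _ (x i)); first by rewrite !size_tuple.
  move=> j j_lt; have jn : (j < n.+1)%N by rewrite (leq_trans j_lt)// size_tuple.
  transitivity (nth (x i) (rcons (window n i x) (x (i + n%:Z))) j); last by [].
  rewrite nth_rcons size_tuple [LHS]window_nth//; case: ltnP => [jn'|nj].
    by rewrite window_nth.
  have -> : j = n by apply/eqP; rewrite eqn_leq nj -ltnS jn.
  by rewrite eqxx.
- move=> x; rewrite /joint /coord tnth_mktuple; congr pair.
  by apply: eq_from_tnth => j; rewrite !tnth_mktuple.
Qed.

Lemma block_ent_mono n : block_ent n <= block_ent n.+1.
Proof.
rewrite -subr_ge0 (block_ent_increment n 0); apply: cent_ge0; first exact: fmeas_coord.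
exact: fmeas_window.
Qed.

(** Both increments are entropies of a letter given the letters before it; by invariance they can be
    read at the same letter, and the longer past leaves less. *)
Lemma block_ent_concave n :
  block_ent n.+2 - block_ent n.+1 <= block_ent n.+1 - block_ent n.
Proof.
rewrite (block_ent_increment n.+1 0) (block_ent_increment n 1).
have -> : 0 + n.+1%:Z = 1 + n%:Z by lia.
apply: (cent_factor nu (k := fun t : n.+1.-tuple G => [tuple tnth t (lift ord0 j) | j < n])).
- exact: fmeas_coord.
- exact: fmeas_window.
- by move=> x; apply: eq_from_tnth => j; rewrite !tnth_mktuple; congr (x _); rewrite lift0; lia.
Qed.

(** Beyond [m] concavity bounds every increment by the one at [m]; up to [m] monotonicity
    suffices. *)
Lemma block_ent_le m n : block_ent n <= (block_ent m.+1 - block_ent m) * n%:R + block_ent m.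
Proof.
have a0 : 0 <= block_ent m.+1 - block_ent m by rewrite subr_ge0 block_ent_mono.
have [nm|mn] := leqP n m.
  apply: le_trans (_ : _ <= block_ent m) _; last by rewrite lerDr mulr_ge0.
  rewrite -(subnK nm); elim: (m - n)%N => // k IH; rewrite addSn.
  exact: le_trans IH (block_ent_mono _).
have incr k : block_ent (m + k).+1 - block_ent (m + k) <= block_ent m.+1 - block_ent m.
  elim: k => [|k IH]; first by rewrite addn0.
  by rewrite addnS (le_trans (block_ent_concave _)).
apply: le_trans (_ : _ <= (block_ent m.+1 - block_ent m) * (n - m)%:R + block_ent m) _; last first.
  by rewrite lerD2r ler_wpM2l// ler_nat leq_subr.
rewrite -{1}(subnKC (ltnW mn)); elim: (n - m)%N => [|k IH].
  by rewrite addn0 mulr0 add0r.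
rewrite addnS -natr1 mulrDr mulr1 addrAC -lerBlDr.
have := incr k; rewrite lerBlDr => /le_trans; rewrite -lerBlDl.
by move=> h; rewrite lerBlDr; have := incr k; lra.
Qed.

(* The first [n] windows of width [2 l + 1] along an orbit are read on a single
   window of length [2 l + 1 + n], hence cost at most [n] increments of the
   block entropy. *)
Lemma measure_entropy_increment (f : config G -> config G) m :
  measurable_fun setT f -> invariant_measure nu f ->
  (forall l n, exists h, forall x, itin f (@centered G l) n x = h (window (l.*2.+1 + n) (- l%:Z) x)) ->
  (measure_entropy nu f <= (block_ent m.+1 - block_ent m)%:E)%E.
Proof.
move=> mf f_inv f_loc; apply: measure_entropy_le => k P mP.
have a0 : 0 <= block_ent m.+1 - block_ent m by rewrite subr_ge0 block_ent_mono.
apply/lee_addgt0Pr => e e0.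
have [l /(_ l (leqnn l)) Pl] := cent_centered nu mP e0.
have ml : fmeas (@centered G l) by exact: fmeas_window.
have := @ent_itin_bound _ _ _ nu f mf f_inv _ _ P (@centered G l) (block_ent m.+1 - block_ent m)
  ((block_ent m.+1 - block_ent m) * l.*2.+1%:R + block_ent m) mP ml a0.
move=> /(_ _)/le_trans; apply; last by rewrite EFinD leeD2l// lee_fin.
move=> n; have [h hE] := f_loc l n.
apply: le_trans (ent_factor nu (@fmeas_window G _ _) hE) _.
by rewrite ent_window addrA -mulrDr -natrD addnC block_ent_le.
Qed.

Lemma shift_itin_local l n : exists h, forall x,
  itin (@config_shift G) (@centered G l) n x = h (window (l.*2.+1 + n) (- l%:Z) x).
Proof.
exists (fun t => [ffun i : 'I_n => [tuple nth point (tval t) (i + j) | j < l.*2.+1]]) => x.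
apply/ffunP => i; rewrite !ffunE; apply: eq_from_tnth => j; rewrite !tnth_mktuple.
have := ltn_ord i; have := ltn_ord j => hj hi.
by rewrite window_nth ?iter_shift /shift_by; [congr (x _)|]; lia.
Qed.

Lemma shift_entropy_increment m :
  (measure_entropy nu (@config_shift G) <= (block_ent m.+1 - block_ent m)%:E)%E.
Proof.
by apply: measure_entropy_increment => //; [exact: measurable_config_shift|exact: shift_itin_local].
Qed.

End shift_invariant_measures.

(** * The Parry measure *)

Section even_splitting.
Context (R : realType) (G : pfinType) (X : set (config G)).
Hypotheses (X_markov : is_markov_chain X) (X_irreducible : irreducible_shift X).
Hypothesis X_letters : uses_all_letters X.
Context (p : nat) (p_gt0 : (0 < p)%N).
Hypothesis succ_card : forall a, #|[set b | edge X a b]%SET| = p.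
Hypothesis pred_card : forall b, #|[set a | edge X a b]%SET| = p.

Let mX : measurable X := measurable_markov X_markov.

Definition splits_evenly (nu : probability (config G) R) : Prop :=
  forall n (t : n.+1.-tuple G) b, edge X (tnth t ord_max) b ->
    law nu (joint (window n.+1 0) (coord n.+1%:Z)) (t, b) =
    law nu (window n.+1 0) t / p%:R.

Section one_measure.
Context (nu : probability (config G) R).
Hypotheses (nu_X : nu X = 1%E) (nu_shift : invariant_measure nu (@config_shift G)).

Lemma null_outside (S : set (config G)) : measurable S -> (forall x, X x -> ~ S x) ->
  nu S = 0%E.
Proof.
move=> mS SX; apply/eqP; rewrite eq_le measure_ge0 andbT.
have -> : 0%E = nu (~` X) by rewrite probability_setC// nu_X subee.
by apply: le_measure; rewrite ?inE//; [exact: measurableC|move=> x Sx Xx; exact: SX Sx].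
Qed.

Lemma law_not_edge n (t : n.+1.-tuple G) b : ~~ edge X (tnth t ord_max) b ->
  law nu (joint (window n.+1 0) (coord n.+1%:Z)) (t, b) = 0.
Proof.
move=> ntb; rewrite /law null_outside//.
  by apply: fmeas_joint; [exact: fmeas_window|exact: fmeas_coord].
move=> x Xx [xt xb]; move/negP: ntb; apply; rewrite -xt -xb tnth_mktuple add0r.
have := markov_edge_shift X_markov n%:Z Xx.
by rewrite [n%:Z + 1]addrC -intS.
Qed.

Lemma law_window_sum n (t : n.+1.-tuple G) :
  \sum_b law nu (joint (window n.+1 0) (coord n.+1%:Z)) (t, b) = law nu (window n.+1 0) t.
Proof.
rewrite (law_marginal nu _ (fmeas_coord n.+1%:Z) (@fmeas_window G n.+1 0)).
apply: eq_bigr => b _; congr (fine (nu _)).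
by apply/seteqP; split=> x [/= <- <-].
Qed.

Let q n (t : n.+1.-tuple G) b := law nu (joint (window n.+1 0) (coord n.+1%:Z)) (t, b).

Let block_ent_q n : block_ent nu n.+2 - block_ent nu n.+1 =
  H (fun t : n.+1.-tuple G * G => q t.1 t.2) - H (fun t : n.+1.-tuple G => \sum_b q t b).
Proof.
rewrite (block_ent_increment nu_shift n.+1 0) add0r /cent; congr (_ - _); last first.
  by rewrite /ent; congr H; apply/funext => t; rewrite law_window_sum.
transitivity (ent nu (joint (@window G n.+1 0) (coord n.+1%:Z))).
  apply: (ent_equiv nu (h := fun t => (t.2, t.1)) (k := fun t => (t.2, t.1))) => //.
    by apply: fmeas_joint; [exact: fmeas_window|exact: fmeas_coord].
  by apply: fmeas_joint; [exact: fmeas_coord|exact: fmeas_window].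
by rewrite /ent; congr H; apply/funext => -[].
Qed.

Let q_bound n : block_ent nu n.+2 - block_ent nu n.+1 <= ln p%:R /\
  (block_ent nu n.+2 - block_ent nu n.+1 = ln p%:R ->
   forall (t : n.+1.-tuple G) b, edge X (tnth t ord_max) b ->
     q t b = law nu (window n.+1 0) t / p%:R).
Proof.
have [||||h1 h2] := @H_cond_bound R _ _ (@q n)
  (fun t => [set b | edge X (tnth t ord_max) b]%SET) p p_gt0.
- by move=> t b; exact: law_ge0.
- by move=> t; exact: succ_card.
- by move=> t b; rewrite inE; exact: law_not_edge.
- rewrite -[RHS](law_sum nu (@fmeas_window G n.+1 0)).
  by apply: eq_bigr => t _; exact: law_window_sum.
rewrite block_ent_q; split=> // e t b tb.
by rewrite -law_window_sum; apply: h2 => //; rewrite inE.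
Qed.

Lemma block_ent_increment_le n : block_ent nu n.+2 - block_ent nu n.+1 <= ln p%:R.
Proof. exact: (q_bound n).1. Qed.

Lemma splits_evenly_of_increments :
  (forall n, ln p%:R <= block_ent nu n.+2 - block_ent nu n.+1) -> splits_evenly nu.
Proof.
move=> h n t b; apply: (q_bound n).2; apply/eqP.
by rewrite eq_le h block_ent_increment_le.
Qed.

Lemma shift_entropy_le : (measure_entropy nu (@config_shift G) <= (ln p%:R)%:E)%E.
Proof.
apply: le_trans (shift_entropy_increment nu_shift 1) _.
by rewrite lee_fin block_ent_increment_le.
Qed.

(** The entropy is at most each increment of the block entropy, and from length one on an increment
    is at most [ln p]; equality throughout is the equality case of [H_cond_bound]. *)
Lemma splits_evenly_of_entropy :
  ((ln p%:R)%:E <= measure_entropy nu (@config_shift G))%E -> splits_evenly nu.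
Proof.
move=> h; apply: splits_evenly_of_increments => n.
by have := le_trans h (shift_entropy_increment nu_shift n.+1); rewrite lee_fin.
Qed.

Hypothesis nu_splits : splits_evenly nu.

Let m (g : G) : R := law nu (coord 0) g.

Let m_pred b : m b = \sum_(a | edge X a b) m a / p%:R.
Proof.
have -> : m b = law nu (coord 1) b.
  rewrite /m /law -(shift_by_invariant nu_shift 1); last exact: measurable_coord.
  by [].
rewrite (law_marginal nu _ (fmeas_coord 0) (fmeas_coord 1)) [RHS]big_mkcond.
apply: eq_bigr => a _; rewrite (_ : law _ _ _ = q [tuple a] b); last first.
  congr (fine (nu _)); apply/seteqP; split=> x e.
    have [xa xb] : x 0 = a /\ x 1 = b by case: e.
    rewrite /preimage /joint /=; congr pair => //; apply: eq_from_tnth => j.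
    by rewrite tnth_mktuple !(ord1 j) addr0.
  have xa := congr1 (fun u => tnth u.1 ord0) e; rewrite /= tnth_mktuple addr0 in xa.
  by have xb := congr1 snd e; rewrite /preimage /joint /=; congr pair.
case: ifPn => [ab|nab]; last exact: law_not_edge.
rewrite /q nu_splits//; congr (fine (nu _) / _); apply/seteqP; split=> x /=.
  by move=> /(congr1 (fun t => tnth t ord0)); rewrite tnth_mktuple addr0.
move=> xa; apply: eq_from_tnth => j.
by rewrite tnth_mktuple !(ord1 j) addr0.
Qed.

(** Maximum principle: [m b] is the average of [m] over the [p] predecessors of [b], so a maximum of
    [m] propagates to all predecessors and, by irreducibility, to all letters. *)
Lemma letter_law g : m g = (#|G|%:R)^-1.
Proof.
pose b0 := [arg max_(b > (point : G)) m b]%O.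
have mb0 a : m a <= m b0 by rewrite /b0; case: arg_maxP => // i _; exact.
have pR : 0 < p%:R :> R by rewrite ltr0n.
have pred_max a b : edge X a b -> m b = m b0 -> m a = m b0.
  move=> ab mb.
  have : \sum_(a | edge X a b) (m b0 / p%:R - m a / p%:R) == 0.
    rewrite sumrB -m_pred mb sumr_const.
    have -> : #|edge X^~ b| = p by rewrite -(pred_card b); apply: eq_card => i; rewrite inE.
    by rewrite -[_ *+ p]mulr_natr divfK ?subrr// gt_eqF.
  rewrite psumr_eq0; last by move=> i _; rewrite subr_ge0 ler_pM2r ?invr_gt0.
  move=> /allP/(_ a (mem_index_enum _)); rewrite ab /= subr_eq0.
  have pV : (p%:R : R)^-1 != 0 by rewrite invr_eq0 gt_eqF.
  by move=> /eqP/(mulIf pV).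
have all_max a : m a = m b0.
  have [v [_ /(edge_path X_markov)]] := X_irreducible a b0.
  elim: v a => [|b v IH] a /= /andP[ab]; first by move=> _; exact: pred_max ab _.
  by move=> /IH; exact: pred_max.
have := law_sum nu (fmeas_coord 0); under eq_bigr do rewrite -/(m _) all_max.
rewrite sumr_const => h.
have G0 : (#|G|%:R : R) != 0 by rewrite pnatr_eq0 -lt0n; apply/card_gt0P; exists point.
by rewrite all_max; apply: (mulIf G0); rewrite mulVf// mulr_natr -[RHS]h; congr (_ *+ _); exact: eq_card.
Qed.

(** Letters are uniform, and appending a letter divides the mass of a word by [p] while it
    multiplies the number of words by [p]. *)
Lemma words_law n (t : n.+1.-tuple G) :
  law nu (window n.+1 0) t = if t \in words X n.+1 then (#|words X n.+1|%:R)^-1 else 0.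
Proof.
case: ifPn => [tw|tw]; last first.
  rewrite /law null_outside//; first exact: fmeas_window.
  by move=> x Xx /= xt; move/negP: tw; apply; rewrite -xt window_word.
elim: n t tw => [|n IH] t tw.
  rewrite (card_words succ_card) expn0 muln1 -(letter_law (tnth t ord0)).
  congr (fine (nu _)); apply/seteqP; split=> x /=.
    by move=> <-; rewrite tnth_mktuple addr0.
  by move=> xt; apply: eq_from_tnth => j; rewrite tnth_mktuple !(ord1 j) addr0.
pose t' : n.+1.-tuple G := [tuple tnth t (widen_ord (leqnSn _) j) | j < n.+1].
pose b := tnth t ord_max.
have [x Xx xt] := word_window X_markov X_letters 0 tw.
have xt' : window n.+1 0 x = t'.
  by apply: eq_from_tnth => j; rewrite !tnth_mktuple -xt tnth_mktuple.
have xb : x n.+1%:Z = b by rewrite /b -xt tnth_mktuple add0r.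
have t'w : t' \in words X n.+1 by rewrite -xt' window_word.
have t'b : edge X (tnth t' ord_max) b.
  rewrite -xt' -xb tnth_mktuple add0r.
  have := markov_edge_shift X_markov n%:Z Xx.
  by rewrite (_ : n%:Z + 1 = n.+1%:Z)//; lia.
transitivity (q t' b).
  congr (fine (nu _)); apply/seteqP; split=> y /=.
    move=> yt; rewrite /joint /b -yt tnth_mktuple; congr pair.
    by apply: eq_from_tnth => j; rewrite !tnth_mktuple -yt tnth_mktuple.
  move=> e; have yt : window n.+1 0 y = t' := congr1 fst e; have yb : y n.+1%:Z = b := congr1 snd e.
  apply: eq_from_tnth => j; rewrite tnth_mktuple.
  have := ltn_ord j; rewrite ltnS leq_eqVlt => /orP[/eqP jn|jn].
    have -> : j = ord_max by apply: val_inj.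
    by rewrite -/b -yb add0r.
  have := congr1 (fun t => tnth t (Ordinal jn)) yt; rewrite !tnth_mktuple => ->.
  by congr (tnth t _); apply: val_inj.
rewrite /q nu_splits// IH// !(card_words succ_card) expnSr mulnA.
by rewrite [in RHS]natrM invfM.
Qed.

End one_measure.

(** Local sets are stable under intersection and generate the sigma-algebra; on them a measure is
    given by the masses of words, which [words_law] determines. *)
Lemma splits_evenly_unique (nu nu' : probability (config G) R) :
  nu X = 1%E -> invariant_measure nu (@config_shift G) -> splits_evenly nu ->
  nu' X = 1%E -> invariant_measure nu' (@config_shift G) -> splits_evenly nu' ->
  forall S, measurable S -> nu S = nu' S.
Proof.
move=> nuX nuS nuE nuX' nuS' nuE' S mS.
apply: (measure_unique [set C : set (config G) | exists n, local n C] (fun=> setT)) => //.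
- apply/seteqP; split.
    apply: smallest_sub; first exact: smallest_sigma_algebra.
    by move=> _ [i [g ->]]; apply: sub_sigma_algebra; exists `|i|%N => x y xy /= <-; rewrite xy.
  by apply: smallest_sub => [|C [n /local_measurable]]//; exact: sigma_algebra_measurable.
- move=> A B [n lA] [k lB]; exists (maxn n k) => x y xy [Ax Bx]; split.
    by apply: (local_le (leq_maxl n k) lA) Ax.
  by apply: (local_le (leq_maxr n k) lB) Bx.
- by move=> _; exists 0%N.
- by apply/seteqP; split=> // x _; exists 0%N.
- move=> C [n lC].
  have CE : C = centered n @^-1` [set` [pred t | `[< (centered n @` C) t >]]].
    apply/seteqP; split=> x; first by move=> Cx; apply/asboolP; exists x.
    by move=> /asboolP[y Cy /centered_agree/lC]; exact.
  have mc : fmeas (@centered G n) by exact: fmeas_window.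
  have mC := local_measurable lC.
  rewrite -[LHS]muK// -[RHS]muK// CE !law_set//; congr (_%:E); apply: eq_bigr => t _.
  have lawE (la : probability (config G) R) : invariant_measure la (@config_shift G) ->
      law la (centered n) t = law la (window n.*2.+1 0) t.
    move=> laS; rewrite /law -[in RHS](shift_by_invariant laS (- n%:Z)); last exact: fmeas_window.
    have e x : centered n x = window n.*2.+1 0 (shift_by (- n%:Z) x).
      by apply: eq_from_tnth => j; rewrite !tnth_mktuple /shift_by add0r addrC.
    by congr (fine (la _)); apply/seteqP; split=> x; rewrite /preimage /= e.
  by rewrite !lawE// !words_law.
- by move=> _ /=; rewrite probability_setT ltry.
Qed.

Lemma shift_entropy_ge (nu : probability (config G) R) :
  nu X = 1%E -> invariant_measure nu (@config_shift G) -> splits_evenly nu ->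
  ((ln p%:R)%:E <= measure_entropy nu (@config_shift G))%E.
Proof.
move=> nuX nuS nuE; pose P := enum_rank \o (@coord G 0).
have mP : fmeas P by apply: fmeas_comp; exact: fmeas_coord.
apply: le_trans (measure_entropy_ge nu (@config_shift G) mP).
rewrite (limn_rate (C := ln #|G|%:R - ln p%:R) (A := ln p%:R))// => n.
rewrite -natr1 mulrDr mulr1 addrACA subrr addr0 -(ln_card_words succ_card R p_gt0).
have -> : ent nu (itin (@config_shift G) P n.+1) = block_ent nu n.+1.
  apply: (ent_equiv nu (h := fun t => [ffun i => enum_rank (tnth t i)])
    (k := fun w => [tuple enum_val (w i) | i < n.+1])).
  - exact: fmeas_window.
  - by apply: fmeas_itin => //; exact: measurable_config_shift.
  - by move=> x; apply/ffunP => i; rewrite !ffunE tnth_mktuple /P /coord /= iter_shift.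
  - move=> x; apply: eq_from_tnth => i; rewrite !tnth_mktuple ffunE enum_rankK.
    by rewrite /coord iter_shift.
rewrite /block_ent /ent /H (eq_bigr (fun t => if t \in words X n.+1 then
  (#|words X n.+1|%:R)^-1 * ln #|words X n.+1|%:R : R else 0)); last first.
  move=> t _; rewrite words_law//; case: ifP => _; last by rewrite mul0r oppr0.
  rewrite lnV ?mulrN ?opprK// posrE ltr0n (card_words succ_card) muln_gt0 expn_gt0 p_gt0 andbT.
  by apply/card_gt0P; exists point.
rewrite -big_mkcond sumr_const -mulrnAl -[_^-1 *+ _]mulr_natl mulfV ?mul1r//.
rewrite pnatr_eq0 -lt0n (card_words succ_card) muln_gt0 expn_gt0 p_gt0 andbT.
by apply/card_gt0P; exists point.
Qed.

(** Even splitting amounts to entropy [ln p], the largest possible, and it determines the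
    measure. *)
Theorem splits_evenly_parry (nu : probability (config G) R) :
  nu X = 1%E -> invariant_measure nu (@config_shift G) -> splits_evenly nu ->
  is_parry_measure X nu.
Proof.
move=> nuX nuS nuE; split; first split=> // la [laX laS].
  exact: le_trans (shift_entropy_le laX laS) (shift_entropy_ge nuX nuS nuE).
move=> la [[laX laS] la_max] S mS; apply: splits_evenly_unique => //.
apply: splits_evenly_of_entropy => //.
exact: le_trans (shift_entropy_ge nuX nuS nuE) (la_max _ (conj nuX nuS)).
Qed.

End even_splitting.

(** * Densities and invariant functions *)

Section averaged_measure.
Context d (T : measurableType d) (R : realType) (mu : probability T R).
Context (I : finType) (g : I -> T -> T).

(* The proof argument lets the measure structure be inferred. *)
Definition orbit_sum (mg : forall i, measurable_fun setT (g i)) (S : set T) : \bar R :=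
  (\sum_(i : I) mu (g i @^-1` S))%E.

Context (mg : forall i, measurable_fun setT (g i)).

Let mgS i S : measurable S -> measurable (g i @^-1` S).
Proof. by move=> mS; rewrite -[X in measurable X]setTI; exact: mg. Qed.

Let orbit_sum0 : orbit_sum mg set0 = 0%E.
Proof. by rewrite /orbit_sum big1// => i _; rewrite preimage_set0 measure0. Qed.

Let orbit_sum_ge0 S : (0 <= orbit_sum mg S)%E.
Proof. by apply: sume_ge0 => i _. Qed.

Let orbit_sum_sigma_additive : semi_sigma_additive (orbit_sum mg).
Proof.
move=> F mF tF mUF; rewrite [X in X @ _ --> _](_ : _ = fun n =>
  (\sum_(i : I) \sum_(0 <= k < n) mu (g i @^-1` F k))%E); last first.
  by apply/funext => n; rewrite exchange_big.
apply: cvg_nnesum => i _.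
  by apply: nearW => n; apply: sume_ge0.
rewrite preimage_bigcup; apply: measure_semi_sigma_additive.
- by move=> n; exact: mgS.
- apply/trivIsetP => /= j k _ _ jk; rewrite -preimage_setI.
  by move/trivIsetP : tF => /(_ _ _ _ _ jk) ->//; rewrite preimage_set0.
- by rewrite -preimage_bigcup; exact: mgS.
Qed.

HB.instance Definition _ := isMeasure.Build _ _ _ (orbit_sum mg)
  orbit_sum0 orbit_sum_ge0 orbit_sum_sigma_additive.

Let orbit_sum_fin : fin_num_fun (orbit_sum mg).
Proof.
by move=> S mS; apply/sum_fin_numP => i _ _; rewrite fin_num_measure//; exact: mgS.
Qed.

HB.instance Definition _ := Measure_isFinite.Build _ _ _ (orbit_sum mg) orbit_sum_fin.

End averaged_measure.

Section density.
Context d (T : measurableType d) (R : realType).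
Context (mu : probability T R) (nu : {finite_measure set T -> \bar R}).

Lemma exists_density :
  (forall S, measurable S -> nu S = 0%E -> mu S = 0%E) ->
  exists f : T -> R, [/\ measurable_fun setT f, forall x, 0 <= f x &
    forall S, measurable S -> mu S = (\int[nu]_(x in S) (f x)%:E)%E].
Proof.
move=> nu_mu; have dom : mu `<< nu.
  by move=> A nuA B mB BA; apply: nu_mu => //; exact: nuA.
have [f [f0 ffin fi fE]] := radon_nikodym_sigma_finite dom.
exists (fine \o f); split.
- apply/measurable_EFinP; rewrite (_ : _ \o _ = f); first by case/integrableP: fi.
  by apply/funext => x /=; rewrite fineK.
- by move=> x; rewrite fine_ge0.
- move=> S mS; rewrite fE//; apply: eq_integral => x _.
  by rewrite /= fineK.
Qed.

Context (f : T -> R) (mf : measurable_fun setT f) (f0 : forall x, 0 <= f x).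
Hypothesis fE : forall S, measurable S -> mu S = (\int[nu]_(x in S) (f x)%:E)%E.

Let mfE : measurable_fun setT (EFin \o f).
Proof. exact/measurable_EFinP. Qed.

Lemma measurable_pos : measurable [set x | 0 < f x].
Proof.
rewrite -[X in measurable X]setTI; have := mf measurableT (measurable_itv `]0%R, +oo[).
by congr measurable; apply/seteqP; split=> x /= [_]; rewrite in_itv /= andbT.
Qed.

Lemma measurable_fun_neq (g h : T -> R) : measurable_fun setT g -> measurable_fun setT h ->
  measurable [set x | g x <> h x].
Proof.
move=> mg mh; rewrite (_ : mkset _ = (fun x => g x == h x) @^-1` [set false]).
  rewrite -[X in measurable X]setTI.
  exact: (measurable_fun_eqr mg mh).
by apply/seteqP; split=> x /= => [/eqP/negPf//|/negbT/eqP].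
Qed.

(** A nonnegative function with zero integral over [S] vanishes almost everywhere on [S]. Thus,
    where [f] is positive, null sets of [mu] are null for [nu]. *)
Lemma density_null S : measurable S -> mu S = 0%E -> nu (S `&` [set x | 0 < f x]) = 0%E.
Proof.
move=> mS; rewrite fE// => fS.
have : ae_eq nu S (EFin \o f) (cst 0%E).
  apply/(ae_eq_integral_abs nu mS); first exact: measurable_funTS.
  by rewrite -[RHS]fS; apply: eq_integral => x _; rewrite gee0_abs// lee_fin.
move=> [N [mN N0 SN]]; apply/eqP; rewrite eq_le measure_ge0 andbT -N0.
apply: le_measure; rewrite ?inE//; first exact: measurableI mS measurable_pos.
move=> x [Sx /= fx]; apply: SN => /= /(_ Sx) [fx0].
by rewrite fx0 ltxx in fx.
Qed.

Lemma density_pos : mu (~` [set x | 0 < f x]) = 0%E.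
Proof.
rewrite fE; last exact/measurableC/measurable_pos.
apply: integral0_eq => x /= /negP; rewrite -leNgt => fx.
by congr _%:E; apply/eqP; rewrite eq_le fx f0.
Qed.

Context (g g' : T -> T) (mg : measurable_fun setT g) (mg' : measurable_fun setT g').
Hypothesis gK : cancel g g'.
Hypothesis nu_g : forall S, measurable S -> nu (g @^-1` S) = nu S.

(** Change of variables: as [nu] is [g]-invariant, the image of [mu] under [g'] has density
    [f \o g]. *)
Lemma density_change S : measurable S ->
  mu (g' @^-1` S) = (\int[nu]_(x in S) (f (g x))%:E)%E.
Proof.
move=> mS; have mgS : measurable (g' @^-1` S).
  by rewrite -[X in measurable X]setTI; exact: mg'.
rewrite fE//.
transitivity (\int[pushforward nu g]_(x in g' @^-1` S) (f x)%:E)%E.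
  by apply: eq_measure_integral => A mA _; exact: esym (nu_g mA).
rewrite ge0_integral_pushforward//; last 2 first.
- exact: measurable_funTS.
- by move=> x _; rewrite lee_fin.
rewrite (_ : g @^-1` _ = S)//.
by apply/seteqP; split=> x; rewrite /preimage /= gK.
Qed.

(** By [density_change], [f] and [f \o g] are two densities of the same measure. *)
Lemma density_invariant : (forall S, measurable S -> mu (g @^-1` S) = mu S) ->
  nu [set x | f (g x) <> f x] = 0%E.
Proof.
move=> mu_g; have mfg : measurable_fun setT (EFin \o (f \o g)).
  by apply/measurable_EFinP; exact: measurableT_comp.
have : ae_eq nu setT (EFin \o f) (EFin \o (f \o g)).
  apply: integral_ae_eq => //.
    apply/integrableP; split=> //; rewrite (eq_integral (fun x => (f x)%:E)).
      by rewrite -fE// probability_setT ltry.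
    by move=> x _; rewrite gee0_abs// lee_fin.
  move=> E _ mE; rewrite -fE// -density_change//.
  rewrite -[RHS](mu_g); last by rewrite -[X in measurable X]setTI; exact: mg'.
  by congr (mu _); apply/seteqP; split=> x; rewrite /preimage /= gK.
move=> [N [mN N0 SN]]; apply/eqP; rewrite eq_le measure_ge0 andbT -N0.
apply: le_measure; rewrite ?inE//.
  by apply: measurable_fun_neq => //; exact: measurableT_comp.
by move=> x fx; apply: SN => /= /(_ I) [e]; apply: fx.
Qed.

Lemma density_transport S : nu [set x | f (g x) <> f x] = 0%E -> measurable S ->
  mu (g' @^-1` S) = mu S.
Proof.
move=> fg0 mS; rewrite density_change// fE//; apply: ge0_ae_eq_integral => //.
- by apply: measurable_funTS; apply/measurable_EFinP; exact: measurableT_comp.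
- exact: measurable_funTS.
- by move=> x _; rewrite lee_fin.
- by move=> x _; rewrite lee_fin.
exists [set x | f (g x) <> f x]; split=> //.
  by apply: measurable_fun_neq => //; exact: measurableT_comp.
by move=> x /= h fx; apply: h => _; rewrite fx.
Qed.

End density.

Section null_sets.
Context d (T : measurableType d) (R : realType) (mu : {measure set T -> \bar R}).

Lemma null_sub (A B : set T) : measurable A -> measurable B -> A `<=` B ->
  mu B = 0%E -> mu A = 0%E.
Proof.
move=> mA mB AB B0; apply/eqP; rewrite eq_le measure_ge0 andbT -B0.
by apply: le_measure; rewrite ?inE.
Qed.

Lemma null_bigcup (F : nat -> set T) : (forall n, measurable (F n)) ->
  (forall n, mu (F n) = 0%E) -> mu (\bigcup_n F n) = 0%E.
Proof.
move=> mF F0; apply: measure_negligible; first exact: bigcupT_measurable.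
by apply: negligible_bigcup => n; apply/negligibleP; [exact: mF|exact: F0].
Qed.

Lemma null_setU (A B : set T) : measurable A -> measurable B ->
  mu A = 0%E -> mu B = 0%E -> mu (A `|` B) = 0%E.
Proof.
move=> mA mB A0 B0; apply/eqP; rewrite eq_le measure_ge0 andbT.
have h : (mu (A `|` B) <= mu A + mu B)%E := measureU2 mu mA mB.
by rewrite A0 B0 adde0 in h.
Qed.

Lemma null_bigcup_finType (I : finType) (F : I -> set T) : (forall i, measurable (F i)) ->
  (forall i, mu (F i) = 0%E) -> mu (\bigcup_i F i) = 0%E.
Proof.
move=> mF F0.
pose F' n := if pickle_inv n is Some i then F i else set0.
apply: (@null_sub _ (\bigcup_n F' n)).
- by apply: fin_bigcup_measurable.
- by apply: bigcupT_measurable => n; rewrite /F'; case: pickle_inv.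
- by move=> x [i _ Fx]; exists (pickle i) => //; rewrite /F' pickleK_inv.
- apply: null_bigcup => n; rewrite /F'; case: pickle_inv => //; exact: measure0.
Qed.

End null_sets.

(** * Strictly invariant versions of sets invariant modulo null sets *)

Section invariant_cores.
Context d (T : measurableType d) (R : realType) (mu : probability T R).
Context (X : set T) (mX : measurable X) (mu_X : mu X = 1%E).
Implicit Types f g : T -> T.

Let mu_XC : mu (~` X) = 0%E.
Proof. by rewrite probability_setC// mu_X subee. Qed.

(** The points of [X] whose orbit visits [A] infinitely often. This makes invariance modulo null
    sets strict, as [invariant_sets] demands. *)
Definition inv_core f (A : set T) : set T :=
  [set x | X x /\ forall m, exists2 n, (m <= n)%N & A (iter n f x)].

Lemma inv_core_invariant f A : measurable_fun setT f -> (forall x, X x -> X (f x)) ->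
  measurable A -> invariant_sets X f (inv_core f A).
Proof.
move=> mf Xf mA; split=> [|x []//|].
  rewrite (_ : inv_core f A = X `&` \bigcap_m \bigcup_(n in [set n | (m <= n)%N]) iter n f @^-1` A).
    apply: measurableI => //; apply: bigcapT_measurable => m.
    apply: bigcup_measurable => n _; rewrite -[X in measurable X]setTI.
    exact: iter_measurable.
  apply/seteqP; split=> x [Xx Ax]; split=> // m.
    by move=> _; have [n mn An] := Ax m; exists n.
  by have [n mn An] := Ax m I; exists n.
apply/seteqP; split=> x.
  move=> [Xx [_ Ax]]; split=> // m; have [n mn An] := Ax m.
  by exists n.+1; [exact: leqW|rewrite iterSr].
move=> [Xx Ax]; split=> //; split; first exact: Xf.
by move=> m; have [[//|n] mn An] := Ax m.+1; exists n => //; rewrite -iterSr.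
Qed.

(** Taking the core for a second map keeps strict invariance under the first: [g x] visits [A] at
    the same times as [x]. *)
Lemma inv_core_commute f g A : (forall x, X x -> X (f x)) -> (forall x, X x -> X (g x)) ->
  (forall x, f (g x) = g (f x)) -> X `&` g @^-1` A = A ->
  X `&` g @^-1` (inv_core f A) = inv_core f A.
Proof.
move=> Xf Xg fg gA.
have Xfn n x : X x -> X (iter n f x) by elim: n => // n IH /IH; exact: Xf.
have fgn n x : iter n f (g x) = g (iter n f x) by elim: n => // n IH; rewrite !iterS IH fg.
have gAP x : X x -> A (g x) <-> A x by move=> Xx; rewrite -{2}gA; split=> // -[].
apply/seteqP; split=> x.
  move=> [Xx [_ Ax]]; split=> // m; have [n mn] := Ax m; rewrite fgn => /gAP An.
  by exists n => //; exact/An/Xfn.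
move=> [Xx Ax]; split=> //; split; first exact: Xg.
by move=> m; have [n mn An] := Ax m; exists n => //; rewrite fgn; apply/gAP => //; exact: Xfn.
Qed.

Lemma inv_core_mod f A : measurable_fun setT f -> invariant_measure mu f ->
  (forall x, X x -> X (f x)) -> measurable A ->
  mu (A `+` f @^-1` A) = 0%E -> mu (A `+` inv_core f A) = 0%E.
Proof.
move=> mf f_inv Xf mA A0.
have mpre S : measurable S -> measurable (f @^-1` S).
  by move=> mS; rewrite -[X in measurable X]setTI; exact: mf.
have mY : measurable (A `+` f @^-1` A) by apply: measurableY => //; exact: mpre.
have mpren n S : measurable S -> measurable (iter n f @^-1` S).
  by move=> mS; rewrite -[X in measurable X]setTI; exact: iter_measurable.
have [mcore _ _] := inv_core_invariant mf Xf mA.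
have mN : measurable (\bigcup_n iter n f @^-1` (A `+` f @^-1` A)).
  by apply: bigcupT_measurable => n; exact: mpren.
apply: (@null_sub _ _ _ _ _ ((~` X) `|` \bigcup_n iter n f @^-1` (A `+` f @^-1` A))).
- exact: measurableY.
- by apply: measurableU => //; exact: measurableC.
- have AP x : ~ (\bigcup_n iter n f @^-1` (A `+` f @^-1` A)) x ->
      forall n, A x <-> A (iter n f x).
    move=> nx; elim=> [|n IH] //; rewrite IH iterS.
    by split=> [An|Afn]; apply: contrapT => h; apply: nx; exists n => //; [left|right].
  move=> x; rewrite /setU /=.
  have [Xx|] := pselect (X x); last by left.
  move=> AYx; right; apply: contrapT => /AP {}AP; case: AYx => [[Ax nx]|[[_ Ax] nAx]].
    by apply: nx; split=> // m; exists m => //; exact/AP.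
  by have [n _ /AP] := Ax 0%N.
- apply: null_setU; [exact: measurableC|exact: mN|exact: mu_XC|].
  apply: null_bigcup => n; first exact: mpren.
  exact: etrans (iter_invariant mf f_inv n mY) A0.
Qed.

(** The hypothesis concerns sets, so it is applied to the sublevel sets of [g], through their cores.
    Rational levels suffice to detect where [g] changes along [f]. *)
Lemma invariant_function f M (g : T -> R) : measurable_fun setT f -> invariant_measure mu f ->
  (forall x, X x -> X (f x)) ->
  coincide_mod mu (invariant_sets X (iter M f)) (invariant_sets X f) ->
  measurable_fun setT g -> mu [set x | g (iter M f x) <> g x] = 0%E ->
  mu [set x | g (f x) <> g x] = 0%E.
Proof.
move=> mf f_inv Xf [coin _] mg gM.
have mpre S : measurable S -> measurable (f @^-1` S).
  by move=> mS; rewrite -[X in measurable X]setTI; exact: mf.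
have mfM : measurable_fun setT (iter M f) by exact: iter_measurable.
have XfM x : X x -> X (iter M f x) by elim: M {coin gM mfM} => // M IH /IH; exact: Xf.
have mneq h : measurable_fun setT h -> measurable [set x | g (h x) <> g x].
  by move=> mh; apply: measurable_fun_neq => //; exact: measurableT_comp.
pose A t := [set x | g x < t].
have mA t : measurable (A t).
  rewrite -[X in measurable X]setTI; have := mg measurableT _ (measurable_itv `]-oo, t[).
  by congr measurable; apply/seteqP; split=> x /= [_]; rewrite in_itv.
have mAY t : measurable (A t `+` f @^-1` A t) by apply: measurableY => //; exact: mpre.
have A0 t : mu (A t `+` f @^-1` A t) = 0%E.
  have AM : mu (A t `+` iter M f @^-1` A t) = 0%E.
    apply: (null_sub _ (mneq _ mfM) _ gM).
      by apply: measurableY => //; rewrite -[X in measurable X]setTI; exact: mfM.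
    by move=> x /= [[+ h]|[+ h]] e; apply/negP/negPn; [move/negP: h|move/negP: h];
      rewrite /A /preimage /= e => /negP.
  pose C := inv_core (iter M f) (A t).
  have iC : invariant_sets X (iter M f) C by exact: inv_core_invariant.
  have AC : mu (A t `+` C) = 0%E.
    by apply: inv_core_mod => //; exact: iter_invariant.
  have [B [mB BX fB] CB] := coin _ iC; have [mC _ _] := iC.
  have mACB : measurable ((A t `+` C) `|` (C `+` B)) by apply: measurableU; exact: measurableY.
  apply: (@null_sub _ _ _ _ _ (((A t `+` C) `|` (C `+` B)) `|`
      (f @^-1` ((A t `+` C) `|` (C `+` B)) `|` ~` X))) => //.
  - by apply: measurableU => //; apply: measurableU; [exact: mpre|exact: measurableC].
  - move=> x AYx; apply: contrapT => /not_orP[h1 /not_orP[h2 h3]].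
    have eqv y : ~ ((A t `+` C) `|` (C `+` B)) y -> A t y <-> B y.
      move=> /not_orP[n1 n2]; rewrite (_ : A t y <-> C y).
        by split=> h; apply: contrapT => h'; apply: n2; [left|right].
      by split=> h; apply: contrapT => h'; apply: n1; [left|right].
    have Xx : X x by exact: contrapT.
    have Bf : B (f x) <-> B x by rewrite -{2}fB; split=> // -[].
    have : A t x <-> A t (f x) by rewrite (eqv _ h1) (eqv _ h2) Bf.
    by case: AYx => -[+ nA] e => /e.
  - apply: null_setU => //; first by apply: measurableU; [exact: mpre|exact: measurableC].
      by apply: null_setU => //; exact: measurableY.
    apply: null_setU; [exact: mpre|exact: measurableC| |exact: mu_XC].
    by apply: etrans (f_inv _ mACB) _; apply: null_setU => //; exact: measurableY.
pose t n : R := ratr (odflt 0 (unpickle n : option rat)).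
apply: (@null_sub _ _ _ _ _ (\bigcup_n (A (t n) `+` f @^-1` A (t n)))).
- exact: mneq.
- by apply: bigcupT_measurable => n.
- move=> x /= /eqP; rewrite neq_lt => /orP[] /rat_in_itvoo[q]; rewrite in_itv /= => /andP[q1 q2].
    exists (pickle q) => //; right; rewrite /A /t pickleK /preimage /=; split=> //.
    by apply/negP; rewrite -leNgt ltW.
  exists (pickle q) => //; left; rewrite /A /t pickleK /preimage /=; split=> //.
  by apply/negP; rewrite -leNgt ltW.
- by apply: null_bigcup => n; [exact: mAY|exact: A0].
Qed.

End invariant_cores.

(** * The linear part of the automaton *)

Section solve_recurrence.
Context (T : Type) (fwd bwd : int -> T -> T).

Fixpoint solve_up (t : T) (n : nat) : T :=
  if n is k.+1 then fwd k%:Z (solve_up t k) else t.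

Fixpoint solve_down (t : T) (n : nat) : T :=
  if n is k.+1 then bwd (- k.+1%:Z) (solve_down t k) else t.

Definition solve (t : T) (i : int) : T :=
  match i with Posz n => solve_up t n | Negz n => solve_down t n.+1 end.

Lemma solveP t (rel : int -> T -> T -> Prop) :
  (forall i h, rel i h (fwd i h)) -> (forall i h, rel i (bwd i h) h) ->
  forall i, rel i (solve t i) (solve t (i + 1)).
Proof.
move=> hf hb [n|n]; first by rewrite -PoszD addn1; exact: hf.
rewrite NegzE; case: n => [|n]; first exact: hb.
have -> : - n.+2%:Z + 1 = - n.+1%:Z by lia.
by rewrite -!NegzE; exact: hb.
Qed.

Lemma solve_unique (x : int -> T) :
  (forall i, x (i + 1) = fwd i (x i)) -> (forall i, x i = bwd i (x (i + 1))) ->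
  x = solve (x 0).
Proof.
move=> hf hb; have up n : x n%:Z = solve_up (x 0) n.
  by elim: n => //= n <-; rewrite -hf; congr (x _); lia.
have down n : x (- n%:Z) = solve_down (x 0) n.
  by elim: n => //= n <-; rewrite [LHS]hb; congr (bwd _ (x _)); lia.
by apply/funext => -[n|n]; [exact: up|rewrite NegzE down].
Qed.

End solve_recurrence.

Section affine_section.
Context (G : abelianAlphabet) (eta rho : G -> G) (c : G).
Let phi g h := eta g + rho h + c.
Local Notation Phi := (block_map phi).
Hypotheses (eta_bij : bijective eta) (rho_bij : bijective rho).

(** The rule is bijective in each argument, so a prescribed image [y] and a letter at [0] determine
    a point step by step in both directions. Its letters on [-n, n] use [y] on [-n, n) only. *)
Lemma Phi_section_exists : exists sec : G -> config G -> config G,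
  [/\ forall g y, Phi (sec g y) = y, forall x, sec (x 0) (Phi x) = x,
      forall g y, sec g y 0 = g &
      forall g y y' (n : nat), (forall j, - n%:Z <= j < n%:Z -> y j = y' j) ->
        agree n (sec g y) (sec g y')].
Proof.
have [eta' etaK eta'K] := eta_bij; have [rho' rhoK rho'K] := rho_bij.
pose fwd (y : config G) i h := rho' (y i - c - eta h).
pose bwd (y : config G) i h := eta' (y i - c - rho h).
exists (fun g y => solve (fwd y) (bwd y) g); split=> //.
- move=> g y; apply/funext => i; rewrite /block_map.
  apply: (solveP (fwd := fwd y) (bwd := bwd y) g (rel := fun i h h' => phi h h' = y i)).
    by move=> j h; rewrite /phi /fwd rho'K [eta h + _]addrC !subrK.
  by move=> j h; rewrite /phi /bwd eta'K subrK subrK.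
- move=> x; apply/esym/solve_unique => i.
    by rewrite /fwd /block_map /phi addrK [X in X - _]addrC addrK rhoK.
  by rewrite /bwd /block_map /phi addrK addrK etaK.
move=> g y y' n yy' [m|m] mn; rewrite /solve.
  elim: m mn => //= m IH mn; rewrite /fwd yy'; last by lia.
  by rewrite IH//; lia.
have E k : (k <= n)%N -> solve_down (bwd y) g k = solve_down (bwd y') g k.
  elim: k => //= k IH kn; rewrite /bwd yy'; last by lia.
  by rewrite IH// ltnW.
by apply: E; lia.
Qed.

Lemma measurable_section (sec : G -> config G -> config G) g :
  (forall y y' (n : nat), (forall j, - n%:Z <= j < n%:Z -> y j = y' j) ->
    agree n (sec g y) (sec g y')) -> measurable_fun setT (sec g).
Proof.
move=> sec_local; apply: measurable_config_fun => i h.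
apply: (@local_measurable _ `|i|%N) => y y' yy' /= <-.
apply/esym; apply: (sec_local _ _ `|i|%N) => // j jn; apply: yy'; lia.
Qed.

End affine_section.

Section affine_automaton.
Context (G : abelianAlphabet) (X : set (config G)) (eta rho : G -> G) (c : G).
Context (p : nat) (p_prime : prime p) (N : nat) (z : config G) (a b : 'F_p).
Let phi g h := eta g + rho h + c.
Local Notation Phi := (block_map phi).
Local Notation conv := (conv (p := p) N z).
Hypotheses (etaD : {morph eta : x y / x + y}) (rhoD : {morph rho : x y / x + y}).
Hypothesis Phi_X : is_cellular_automaton X phi.
Hypothesis gen : shift_generator X eta rho N z a b.

Let zp := gen_torsion gen.

Definition linear_part (v : config G) : config G := fun i => eta (v i) + rho (v (i + 1)).

Lemma Phi_add x v : Phi (x + v) = Phi x + linear_part v.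
Proof.
apply/funext => i; rewrite configD /block_map /phi !configD etaD rhoD /linear_part.
by rewrite addrACA [LHS]addrAC.
Qed.

Lemma Phi_shift n x : Phi (shift_by n x) = shift_by n (Phi x).
Proof. by apply/funext => i; rewrite /block_map /shift_by addrAC. Qed.

Lemma linear_part_conv d : linear_part (conv d) = conv (fun i => a * d i + b * d (i + 1)).
Proof.
rewrite (convD p_prime)//; apply/funext => i; rewrite configD /linear_part.
rewrite (@conv_morph _ p p_prime N z zp eta a d etaD (gen_eta gen)).
rewrite (@conv_morph _ p p_prime N z zp rho b d rhoD (gen_rho gen)).
by congr (_ + _); exact: (congr1 (fun v => v i) (conv_shift N z 1 (fun i => b * d i))).
Qed.

(** A sequence [d] with [a * d i + b * d (i + 1) = 0] for all [i] is geometric of this ratio. *)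
Definition ratio : 'F_p := - (a / b).
Local Notation r := ratio.

Lemma ratio_neq0 : r != 0.
Proof. by rewrite oppr_eq0 mulf_neq0 ?invr_eq0 ?(gen_a_neq0 gen) ?(gen_b_neq0 gen). Qed.

Lemma br : b * r = - a.
Proof. by rewrite /r mulrN mulrCA divff ?mulr1// (gen_b_neq0 gen). Qed.

(* The [V (A, 0)] form the kernel of the linear part of [Phi] among the [conv c],
   and the [V (A, B)] the kernel of its square. *)
Definition V (s : 'F_p * 'F_p) : config G := conv (fun i => (s.1 + s.2 * i%:~R) * r ^ i).

Lemma V_add s t : V (s + t) = V s + V t.
Proof.
rewrite -(convD p_prime)//; congr conv; apply/funext => i /=.
by rewrite -mulrDl; congr (_ * _); rewrite mulrDl addrACA.
Qed.

Lemma V0 : V 0 = 0.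
Proof. by apply: (addIr (V 0)); rewrite -V_add !add0r. Qed.

Lemma V_opp s : V (- s) = - V s.
Proof. by apply: (addIr (V s)); rewrite -V_add !addNr V0. Qed.

(** The action of the shift on the coordinates of [V]: [r] times a unipotent Jordan block. *)
Definition shift_act (s : 'F_p * 'F_p) : 'F_p * 'F_p := (r * (s.1 + s.2), r * s.2).

Lemma shift_V s : config_shift (V s) = V (shift_act s).
Proof.
rewrite (_ : config_shift _ = shift_by 1 (V s))// conv_shift; congr conv.
apply/funext => i /=; rewrite expfzDr ?ratio_neq0// expr1z intrD; ring.
Qed.

Lemma iter_shift_act n s :
  iter n shift_act s = (r ^+ n * (s.1 + n%:R * s.2), r ^+ n * s.2).
Proof.
elim: n => [|n IH]; first by rewrite !mul1r mul0r addr0; case: s.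
by rewrite iterS IH /shift_act /= exprS -natr1; congr pair; ring.
Qed.

Lemma ratio_exp : r ^+ (p - 1) = 1.
Proof.
apply: (mulfI ratio_neq0); rewrite -exprS subn1 prednK ?prime_gt0// mulr1.
by have := expf_card r; rewrite card_Fp.
Qed.

Lemma iter_shift_act_pred s : iter (p - 1) shift_act s = (s.1 - s.2, s.2).
Proof.
rewrite iter_shift_act ratio_exp !mul1r natrB ?prime_gt0// pchar_Fp_0// sub0r.
by rewrite mulN1r.
Qed.

Lemma iter_shift_act_period s : iter ((p - 1) * p) shift_act s = s.
Proof.
rewrite iter_shift_act exprM ratio_exp expr1n !mul1r natrM pchar_Fp_0// mulr0 mul0r addr0.
by case: s.
Qed.

Lemma iter_shift_V n s : iter n (@config_shift G) (V s) = V (iter n shift_act s).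
Proof. by elim: n => //= n ->; exact: shift_V. Qed.

Lemma linear_part_V s : linear_part (V s) = V (- a * s.2, 0).
Proof.
rewrite linear_part_conv; congr conv; apply/funext => i /=.
rewrite expfzDr ?ratio_neq0// expr1z intrD mul0r addr0.
rewrite [r ^ i * r]mulrC [b * _]mulrCA [b * (r * _)]mulrA br; ring.
Qed.

Lemma V_stable x s : X x -> X (x + V s).
Proof. exact: gen_stable gen _ _. Qed.

Lemma V_inj0 A : V (A, 0) = 0 -> A = 0.
Proof.
move=> /(gen_inj gen)/(congr1 (fun d => d 0)) /=.
by rewrite mul0r addr0 expr0z mulr1.
Qed.
(** A priori [x'] is comparable with a shift of [x] only. Applying [Phi] shows that the common image
    [y] differs from its shift by [L] by a convolution; as [x] is a shift of [y] up to a
    convolution, the same holds for [x], and the shift can be removed. *)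
Lemma fiber_conv x x' : X x -> X x' -> Phi x = Phi x' -> exists d, x' = x + conv d.
Proof.
move=> Xx Xx' xx'; pose y := Phi x; have Xy : X y by exact: Phi_X.
have [L [d0 h0]] := gen_phase gen Xx Xx'.
have h1 : shift_by L y = y + linear_part (conv d0).
  rewrite /y -Phi_shift [in RHS]xx' -Phi_add; congr Phi.
  by rewrite -h0 addrC subrK.
have [L' [d2 h2]] := gen_phase gen Xy Xx.
have xL : shift_by L x = shift_by (L + L') y - shift_by L (conv d2).
  by rewrite -shift_byD -shift_byB -h2 opprB addrC subrK.
have yL : shift_by (L + L') y = shift_by L' y + shift_by L' (linear_part (conv d0)).
  by rewrite addrC -shift_byD h1 shift_byDl.
have yx : shift_by L' y = x + conv d2 by rewrite -h2 addrC subrK.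
pose d1 i := a * d0 i + b * d0 (i + 1).
exists (fun i => d2 i + d1 (i + L') - d2 (i + L) - d0 i).
rewrite !(convB p_prime)// (convD p_prime)// -!conv_shift.
have -> : x' = shift_by L x - conv d0 by rewrite -h0 opprB addrC subrK.
by rewrite xL yL yx linear_part_conv !addrA.
Qed.

(** The difference is a convolution killed by the linear part; as [conv] is injective, its
    coefficients satisfy the recurrence behind [ratio], hence are geometric. *)
Lemma fiber_V x x' : X x -> X x' -> Phi x = Phi x' -> exists A, x' = x + V (A, 0).
Proof.
move=> Xx Xx' xx'; have [d xd] := fiber_conv Xx Xx' xx'; exists (d 0).
rewrite xd; congr (_ + _); congr conv.
have : conv (fun i => a * d i + b * d (i + 1)) = 0.
  by rewrite -linear_part_conv; apply: (addrI (Phi x)); rewrite addr0 -Phi_add -xd.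
move=> /(gen_inj gen) d_rec.
have dS i : d (i + 1) = d i * r.
  have := congr1 (fun e => e i) d_rec => /= /eqP; rewrite addrC addr_eq0 => /eqP e.
  apply: (mulfI (gen_b_neq0 gen)); rewrite e mulrCA br mulrN mulrC//.
apply/funext => i /=; rewrite mul0r addr0.
case: (intP i) => [|n|n]; first by rewrite expr0z mulr1.
- elim: n => [|n IH]; first by rewrite -{1}[1%:Z]add0r dS expr1z.
  by rewrite -[n.+2]addn1 PoszD dS IH expfzDr ?ratio_neq0// expr1z mulrA.
- have rV : r \is a GRing.unit by rewrite unitfE ratio_neq0.
  elim: n => [|n IH]; apply: (mulIr rV); rewrite -dS.
    by rewrite addNr exprN1 mulrVK.
  have -> : - n.+2%:Z + 1 = - n.+1%:Z by lia.
  rewrite IH -mulrA; congr (_ * _).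
  by rewrite -[X in _ * X]expr1z -expfzDr ?ratio_neq0//; congr (_ ^ _); lia.
Qed.

End affine_automaton.

(** * The injectivity dichotomy *)

Section density_argument.
Context (R : realType) (G : abelianAlphabet) (X : set (config G)).
Context (eta rho : G -> G) (c : G) (p : nat) (p_prime : prime p).
Context (N : nat) (z : config G) (a b : 'F_p).
Let phi g h := eta g + rho h + c.
Local Notation Phi := (block_map phi).
Local Notation V := (V N z a b).
Local Notation act := (shift_act a b).
Local Notation shift := (@config_shift G).
Local Notation K2 := ('F_p * 'F_p)%type.
Hypotheses (eta_bij : bijective eta) (rho_bij : bijective rho).
Hypotheses (etaD : {morph eta : x y / x + y}) (rhoD : {morph rho : x y / x + y}).
Hypotheses (X_markov : is_markov_chain X) (Phi_X : is_cellular_automaton X phi).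
Hypothesis gen : shift_generator X eta rho N z a b.
Context (mu : probability (config G) R) (mu_X : mu X = 1%E).
Hypotheses (mu_Phi : invariant_measure mu Phi) (mu_shift : invariant_measure mu shift).
Hypothesis mu_ergodic : ergodic_action X mu Phi shift.
Hypothesis mu_invariants :
  coincide_mod mu (invariant_sets X (iter ((p - 1) * p)%N shift)) (invariant_sets X shift).

Let mX : measurable X := measurable_markov X_markov.
Let mu_XC : mu (~` X) = 0%E.
Proof. by rewrite probability_setC// mu_X subee. Qed.

Definition translate (s : K2) (x : config G) : config G := x + V s.
Local Notation tr := translate.

Let tr_add s t x : tr s (tr t x) = tr (s + t) x.
Proof. by rewrite /tr (V_add p_prime gen) [V s + _]addrC addrA. Qed.

Let tr0 x : tr 0 x = x.
Proof. by rewrite /tr (V0 p_prime gen) addr0. Qed.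

Let trK s : cancel (tr s) (tr (- s)).
Proof. by move=> x; rewrite tr_add addNr tr0. Qed.

Let trNK s : cancel (tr (- s)) (tr s).
Proof. by move=> x; rewrite tr_add addrN tr0. Qed.

Let tr_shift s x : shift (tr s x) = tr (act s) (shift x).
Proof. by rewrite /tr -(shift_V gen). Qed.

Let tr_X s x : X x -> X (tr s x).
Proof. exact: (@V_stable _ _ _ _ _ _ _ _ _ gen). Qed.

Let shift_X x : X x -> X (shift x).
Proof. by rewrite -[X in _ -> X]/((shift @^-1` X) x) X_markov.1.2. Qed.

Let tr_Phi s x : Phi (tr s x) = tr (- a * s.2, 0) (Phi x).
Proof. by rewrite /tr (Phi_add _ etaD rhoD) (linear_part_V p_prime etaD rhoD gen). Qed.

Lemma measurable_translate s : measurable_fun setT (tr s).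
Proof.
apply: measurable_config_fun => i g.
rewrite (_ : mkset _ = [set x : config G | x i = g - V s i]); first exact: measurable_coord.
by apply/seteqP; split=> x /=; rewrite /tr configD; [move=> <-; rewrite addrK|move=> ->; rewrite subrK].
Qed.

Let mtr s S : measurable S -> measurable (tr s @^-1` S).
Proof. by move=> mS; rewrite -[X in measurable X]setTI; exact: measurable_translate. Qed.

Let mshift S : measurable S -> measurable (shift @^-1` S).
Proof. by move=> mS; rewrite -[X in measurable X]setTI; exact: measurable_config_shift. Qed.

Let mPhi S : measurable S -> measurable (Phi @^-1` S).
Proof. by move=> mS; rewrite -[X in measurable X]setTI; exact: measurable_block_map. Qed.

Let nu : {finite_measure set (config G) -> \bar R} := orbit_sum mu measurable_translate.

Let nuE S : nu S = (\sum_(s : K2) mu (tr s @^-1` S))%E.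
Proof. by []. Qed.

Let nu_tr t S : measurable S -> nu (tr t @^-1` S) = nu S.
Proof.
move=> mS; rewrite !nuE [RHS](reindex_inj (addrI t)); apply: eq_bigr => s _.
by congr (mu _); apply/seteqP; split=> x; rewrite /preimage /= tr_add.
Qed.

Let act_inj : injective act.
Proof.
have r0 := ratio_neq0 gen.
move=> [s1 s2] [t1 t2] st.
have /(mulfI r0) /= e2 := congr1 snd st.
have /(mulfI r0) /= := congr1 fst st; rewrite e2 => /addIr ->.
by [].
Qed.

Let nu_shift S : measurable S -> nu (shift @^-1` S) = nu S.
Proof.
move=> mS; rewrite !nuE [RHS](reindex_inj act_inj); apply: eq_bigr => s _.
rewrite -[RHS]mu_shift; last exact: mtr.
by congr (mu _); apply/seteqP; split=> x; rewrite /preimage /= tr_shift.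
Qed.

Let nu_null S s : measurable S -> nu S = 0%E -> mu (tr s @^-1` S) = 0%E.
Proof.
move=> mS nuS; apply/eqP; rewrite eq_le measure_ge0 andbT -nuS nuE.
by rewrite (bigD1 s)//= leeDl// sume_ge0.
Qed.

Let nu_null0 S : measurable S -> nu S = 0%E -> mu S = 0%E.
Proof. by move=> mS /(nu_null 0 mS); congr (mu _ = _); apply/seteqP; split=> x; rewrite /preimage /= tr0. Qed.

Let density : {f : config G -> R | [/\ measurable_fun setT f, forall x, 0 <= f x &
    forall S, measurable S -> mu S = (\int[nu]_(x in S) (f x)%:E)%E]}.
Proof. by apply: cid; apply: exists_density; exact: nu_null0. Qed.

Let f := sval density.
Let mf : measurable_fun setT f. Proof. by case: (svalP density). Qed.
Let f0 x : 0 <= f x. Proof. by case: (svalP density). Qed.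
Let fE S : measurable S -> mu S = (\int[nu]_(x in S) (f x)%:E)%E.
Proof. by case: (svalP density) => _ _; exact. Qed.

Let P := [set x | 0 < f x].
Let mP : measurable P. Proof. exact: measurable_pos mf. Qed.
Let mu_PC : mu (~` P) = 0%E. Proof. exact: density_pos mf f0 fE. Qed.

Let nu_P S : measurable S -> mu S = 0%E -> nu (S `&` P) = 0%E.
Proof. by move=> mS S0; exact: (density_null mf f0 fE mS S0). Qed.

Let mneq (g h : config G -> config G) : measurable_fun setT g -> measurable_fun setT h ->
  measurable [set x | f (g x) <> f (h x)].
Proof. by move=> mg mh; apply: measurable_fun_neq; exact: measurableT_comp. Qed.

Let f_shift : nu [set x | f (shift x) <> f x] = 0%E.
Proof.
apply: (density_invariant mf f0 fE (g' := shift_by (-1))) => //.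
- exact: measurable_config_shift.
- exact: measurable_shift_by.
- by move=> x; rewrite [shift x](iter_shift 1 x) shift_byD addNr shift_by0.
Qed.

Let f_shift_iter n : nu [set x | f (iter n shift x) <> f x] = 0%E.
Proof.
elim: n => [|n IH].
  by rewrite (_ : mkset _ = set0) ?measure0//; apply/seteqP; split.
have mn : measurable [set x | f (iter n shift x) <> f x].
  by apply: mneq => //; apply: iter_measurable; exact: measurable_config_shift.
have m1 : measurable [set x | f (shift x) <> f x].
  by apply: mneq => //; exact: measurable_config_shift.
apply: (@null_sub _ _ _ nu _ ([set x | f (shift x) <> f x] `|`
  shift @^-1` [set x | f (iter n shift x) <> f x])).
- by apply: mneq => //; apply: iter_measurable; exact: measurable_config_shift.
- by apply: measurableU => //; exact: mshift.
- move=> x /=; rewrite -iterS iterSr /setU /preimage /= => h.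
  have [e|] := pselect (f (shift x) = f x); last by left.
  by right; rewrite e.
- apply: null_setU => //; first exact: mshift.
  exact: etrans (nu_shift mn) IH.
Qed.

Let eqf s t : Prop := mu [set x | f (tr s x) <> f (tr t x)] = 0%E.

Let mneq_tr s t : measurable [set x | f (tr s x) <> f (tr t x)].
Proof. by apply: mneq; exact: measurable_translate. Qed.

Let eqf_trans s t u : eqf s t -> eqf t u -> eqf s u.
Proof.
move=> st tu; apply: (@null_sub _ _ _ mu _ ([set x | f (tr s x) <> f (tr t x)] `|`
  [set x | f (tr t x) <> f (tr u x)])) => //.
- by apply: measurableU.
- move=> x /= h; have [e|] := pselect (f (tr s x) = f (tr t x)); last by left.
  by right; rewrite -e.
- exact: null_setU.
Qed.

Let eqf_refl s : eqf s s.
Proof.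
rewrite /eqf (_ : mkset _ = set0) ?measure0//.
by apply/seteqP; split=> x.
Qed.

(** The function [f \o tr (act s)] is invariant under the power of the shift in (iii), which is a
    period of [act]; hence it is invariant under the shift itself. Its value at [shift x] is
    [f (shift (tr s x))], which is [f (tr s x)] as [f] is shift-invariant. *)
Let eqf_act s : eqf (act s) s.
Proof.
have mfs : measurable_fun setT (f \o tr (act s)).
  by apply: measurableT_comp => //; exact: measurable_translate.
have shift_inv : mu [set x | (f \o tr (act s)) (shift x) <> (f \o tr (act s)) x] = 0%E.
  have h := invariant_function mX mu_X (@measurable_config_shift G) mu_shift shift_X mu_invariants mfs.
  apply: h.
  rewrite (_ : mkset _ = tr (act s) @^-1` [set x | f (iter ((p - 1) * p) shift x) <> f x]).
    apply: nu_null => //; apply: mneq => //.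
    by apply: iter_measurable; exact: measurable_config_shift.
  have com x : iter ((p - 1) * p) shift (tr (act s) x) = tr (act s) (iter ((p - 1) * p) shift x).
    rewrite {1}/tr !iter_shift shift_byDl -!iter_shift.
    by rewrite (iter_shift_V gen) (iter_shift_act_period p_prime gen).
  by apply/seteqP; split=> x; rewrite /preimage /= com.
have f_shift_s : mu (tr s @^-1` [set x | f (shift x) <> f x]) = 0%E.
  by apply: nu_null => //; apply: mneq => //; exact: measurable_config_shift.
apply: (@null_sub _ _ _ mu _
  ([set x | (f \o tr (act s)) (shift x) <> (f \o tr (act s)) x] `|`
   tr s @^-1` [set x | f (shift x) <> f x])) => //.
- apply: measurableU; last by apply: mtr; apply: mneq => //; exact: measurable_config_shift.
  apply: measurable_fun_neq => //; apply: measurableT_comp => //.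
  exact: measurable_config_shift.
- move=> x /= h; have [e|] := pselect (f (tr (act s) (shift x)) = f (tr (act s) x)); last by left.
  by right; rewrite /preimage /= tr_shift e.
- apply: null_setU => //.
    apply: measurable_fun_neq => //; apply: measurableT_comp => //.
    exact: measurable_config_shift.
  by apply: mtr; apply: mneq => //; exact: measurable_config_shift.
Qed.

(* [p - 1] steps of [act] send [(A, B)] to [(A - B, B)], and if [B != 0] these
   moves run through all the [(A', B)]. *)
Let eqf_coset A A' B : B != 0 -> eqf (A, B) (A', B).
Proof.
move=> B0.
have iter_act n s : eqf (iter n act s) s.
  elim: n => [|n IH]; first exact: eqf_refl.
  exact: eqf_trans (eqf_act _) IH.
have step n : eqf (A' - n%:R * B, B) (A', B).
  elim: n => [|n IH]; first by rewrite mul0r subr0; exact: eqf_refl.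
  apply: eqf_trans IH; have := iter_act (p - 1)%N (A' - n%:R * B, B).
  rewrite (iter_shift_act_pred p_prime gen) /= -natr1 mulrDl mul1r.
  by rewrite opprD addrA.
have := step ((A' - A) / B : 'F_p); rewrite natr_Zp divfK//.
by rewrite opprB addrC subrK.
Qed.

Let Z := \bigcup_(t : K2 * 'F_p) [set x | t.1.2 != 0 /\ f (tr t.1 x) <> f (tr (t.2, t.1.2) x)].

Let mZt (t : K2 * 'F_p) : measurable [set x | t.1.2 != 0 /\ f (tr t.1 x) <> f (tr (t.2, t.1.2) x)].
Proof.
have [B0|B0] := boolP (t.1.2 != 0).
  by rewrite (_ : mkset _ = [set x | f (tr t.1 x) <> f (tr (t.2, t.1.2) x)])//; apply/seteqP; split=> x //= [].
by rewrite (_ : mkset _ = set0)//; apply/seteqP; split=> x //= [].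
Qed.

Let mZ : measurable Z.
Proof. by apply: fin_bigcup_measurable. Qed.

Let mu_Z : mu Z = 0%E.
Proof.
apply: null_bigcup_finType => //= -[[A B] A'] /=.
have [B0|B0] := boolP (B != 0).
  rewrite (_ : mkset _ = [set x | f (tr (A, B) x) <> f (tr (A', B) x)]); first exact: eqf_coset.
  by apply/seteqP; split=> x //= [].
by rewrite (_ : mkset _ = set0) ?measure0//; apply/seteqP; split=> x //= [].
Qed.

(** The points having a translate of positive density in [Z]. As [Z] is null for [mu], its part in
    [P] is null for [nu], and the translates of that part are null for [mu]. *)
Let Bad := \bigcup_(s : K2) (tr s @^-1` (Z `&` P)).

Let mBad : measurable Bad.
Proof. by apply: fin_bigcup_measurable => // s _; apply: mtr; exact: measurableI. Qed.

Let mu_Bad : mu Bad = 0%E.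
Proof.
apply: null_bigcup_finType => s; first by apply: mtr; exact: measurableI.
by apply: nu_null; [exact: measurableI|exact: nu_P].
Qed.

(** Seen from the translate by [(A0, B0)], which has positive density and is not in [Z], the coset
    of [x] under [K1] is one of those other than [K1], where [f] is constant. *)
Let good_constant x A0 B0 : ~ Bad x -> B0 != 0 -> 0 < f (tr (A0, B0) x) ->
  forall A, f (tr (A, 0) x) = f x.
Proof.
move=> nBad B00 fpos A; apply: contrapT => fA; apply: nBad.
exists (A0, B0) => //; split=> //; exists ((A - A0, - B0), - A0) => //=.
split; first by rewrite oppr_eq0.
rewrite !tr_add; congr (f (tr _ x) <> _): fA; last first.
  by rewrite -[x in LHS]tr0; congr (f (tr _ _)); congr pair; rewrite /= addNr.
by congr pair; rewrite /= ?subrK ?addNr.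
Qed.

(** The points of positive density that share their fiber with another such point. Modulo null sets
    the preimage of [E1] lies in [Ac] and [Ac] lies in [E1], which makes [E1] invariant. *)
Let E1 := [set x | [/\ X x, 0 < f x & exists2 A : 'F_p, A != 0 & 0 < f (tr (A, 0) x)]].
Let Ac := [set x | X x /\ forall A : 'F_p, f (tr (A, 0) x) = f x].

Let mE1 : measurable E1.
Proof.
rewrite (_ : E1 = X `&` P `&` \bigcup_(A in [set A : 'F_p | A != 0]) (tr (A, 0) @^-1` P)).
  by apply: measurableI; [exact: measurableI|apply: fin_bigcup_measurable => // A _; exact: mtr].
by apply/seteqP; split=> x [] => [Xx fx [A A0 fA]|[Xx fx] [A A0 fA]]; split=> //; exists A.
Qed.

Let mAc : measurable Ac.
Proof.
rewrite (_ : Ac = X `&` \bigcap_(A in [set: 'F_p]) ~` [set x | f (tr (A, 0) x) <> f x]).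
  apply: measurableI => //; apply: fin_bigcap_measurable => // A _; apply: measurableC.
  by apply: mneq => //; exact: measurable_translate.
apply/seteqP; split=> x [Xx fA]; split=> // A; first by move=> _; rewrite /setC /= fA.
by have /= /contrapT := fA A I.
Qed.

(** The points to which [good_constant] cannot be applied. *)
Let Nset := [set x | X x /\ forall s : K2, s.2 != 0 -> f (tr s x) = 0].

Let mNset : measurable Nset.
Proof.
rewrite (_ : Nset = X `&` \bigcap_(s in [set s : K2 | s.2 != 0]) (tr s @^-1` (~` P))).
  by apply: measurableI => //; apply: fin_bigcap_measurable => // s _; apply: mtr; exact: measurableC.
apply/seteqP; split=> x [Xx fs]; split=> // s s0.
  by rewrite /P /setC /preimage /= fs// ltxx.
have /negP := fs s s0; rewrite -leNgt => fle.
by apply/eqP; rewrite eq_le fle f0.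
Qed.

Let Nset_tr A x : Nset x -> Nset (tr (A, 0) x).
Proof.
move=> [Xx fs]; split=> [|s s0]; first exact: tr_X.
by rewrite tr_add fs//= addr0.
Qed.

(** [Nset] is a union of fibers, being stable under [K1]; its image is the union of its preimages
    under the finitely many sections of [Phi], hence measurable. *)
Let image_N : exists2 B, measurable B & forall x, X x -> B (Phi x) <-> Nset x.
Proof.
have [sec [Phi_sec sec_Phi _ sec_local]] := Phi_section_exists c eta_bij rho_bij.
exists (\bigcup_(g : G) (sec g @^-1` Nset)).
  apply: fin_bigcup_measurable => // g _; rewrite -[X in measurable X]setTI.
  by apply: measurable_section => //; exact: sec_local.
move=> x Xx; split=> [[g _ Nx]|Nx].
  have [A xA] := fiber_V p_prime etaD rhoD Phi_X gen Nx.1 Xx (Phi_sec g (Phi x)).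
  by rewrite xA; exact: Nset_tr.
by exists (x 0) => //; rewrite /preimage /= sec_Phi.
Qed.

(* If [B] is the image of [Nset], then [f] vanishes on the preimage of [B + w]
   for every nonzero [w] in [K1], hence [B + w] is null. *)
Let mu_image_E1 B : measurable B -> (forall x, X x -> B (Phi x) <-> Nset x) ->
  mu (B `&` E1) = 0%E.
Proof.
move=> mB BN; have a0 := gen_a_neq0 gen.
have BA (A : 'F_p) : A != 0 -> mu (B `&` tr (A, 0) @^-1` P) = 0%E.
  move=> A0; pose Y := tr (- (A, 0)) @^-1` B.
  have mY : measurable Y by exact: mtr.
  have muY : mu Y = 0%E.
    rewrite -(mu_Phi mY); apply: (@null_sub _ _ _ mu _ (~` X `|` ~` P)).
    - exact: mPhi.
    - by apply: measurableU; exact: measurableC.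
    - move=> x Yx; have [Xx|] := pselect (X x); [right|by left].
      pose s : K2 := (0, - A / a).
      have : B (Phi (tr (- s) x)).
        rewrite tr_Phi; move: Yx; rewrite /Y /preimage /=.
        congr (B (tr _ _)); congr pair; rewrite /= ?oppr0//.
        by field.
      move=> /(BN _ (tr_X _ Xx))[_ /(_ s)]; rewrite trNK /P /setC /= => ->.
        by rewrite ltxx.
      by rewrite mulf_neq0 ?invr_eq0// oppr_eq0.
    - by apply: null_setU => //; exact: measurableC.
  have := nu_null (A, 0) (measurableI _ _ mY mP) (nu_P mY muY).
  congr (mu _ = _); apply/seteqP; split=> x; rewrite /Y /preimage /setI /=.
    by move=> []; rewrite trK.
  by rewrite trK.
apply: (@null_sub _ _ _ mu _ (\bigcup_(A : 'F_p)
    (B `&` [set x | A != 0 /\ (tr (A, 0) @^-1` P) x]))).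
- exact: measurableI.
- apply: fin_bigcup_measurable => // A _; apply: measurableI => //.
  have [A0|A0] := boolP (A != 0).
    rewrite (_ : mkset _ = tr (A, 0) @^-1` P); first exact: mtr.
    by apply/seteqP; split=> x //= [].
  by rewrite (_ : mkset _ = set0)//; apply/seteqP; split=> x //= [].
- by move=> x [Bx [Xx fx [A A0 fA]]]; exists A.
- apply: null_bigcup_finType => A /=.
    apply: measurableI => //; have [A0|A0] := boolP (A != 0).
      rewrite (_ : mkset _ = tr (A, 0) @^-1` P); first exact: mtr.
      by apply/seteqP; split=> x //= [].
    by rewrite (_ : mkset _ = set0)//; apply/seteqP; split=> x //= [].
  have [A0|A0] := boolP (A != 0).
    rewrite (_ : _ `&` _ = B `&` tr (A, 0) @^-1` P); first exact: BA.
    by apply/seteqP; split=> x //= [Bx]; [case|].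
  by rewrite (_ : _ `&` _ = set0) ?measure0//; apply/seteqP; split=> x //= [_ []].
Qed.

(** Outside [Bad] and [Ac], [good_constant] forces [x] into [Nset]; then [Phi x] lies in the image
    of [Nset], which meets [E1] in a null set. *)
Let mu_PhiE1_Ac : mu ((Phi @^-1` E1) `\` Ac) = 0%E.
Proof.
have [B mB BN] := image_N.
have mBE : measurable (B `&` E1) by exact: measurableI.
apply: (@null_sub _ _ _ mu _ ((Phi @^-1` (B `&` E1) `|` Bad) `|` ~` X)).
- by apply: measurableD => //; exact: mPhi.
- by apply: measurableU; [apply: measurableU => //; exact: mPhi|exact: measurableC].
- move=> x [Ex nAc]; have [Xx|] := pselect (X x); last by right.
  left; have [|nBad] := pselect (Bad x); [by right|left].
  split=> //; apply/BN => //; split=> // -[A0 B0] /= B00; apply: contrapT => fs.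
  apply: nAc; split=> //; apply: (@good_constant x A0 B0 nBad B00).
  by rewrite lt0r f0 andbT; apply/eqP.
- apply: null_setU; [by apply: measurableU => //; exact: mPhi|exact: measurableC| |exact: mu_XC].
  apply: null_setU; [exact: mPhi|exact: mBad| |exact: mu_Bad].
  by apply: etrans (mu_Phi mBE) _; exact: mu_image_E1.
Qed.

Let mu_Ac_E1 : mu (Ac `\` E1) = 0%E.
Proof.
apply: (@null_sub _ _ _ mu _ (~` P)) => //; [exact: measurableD|exact: measurableC|].
move=> x [[Xx fA] nE] fx; apply: nE; split=> //; exists 1; first exact: oner_neq0.
by rewrite fA.
Qed.

(** The preimage of [E1] is contained in [E1] modulo null sets and has the same mass. *)
Let mu_E1_Phi : mu (E1 `+` Phi @^-1` E1) = 0%E.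
Proof.
have mPE := mPhi mE1.
have PE : mu ((Phi @^-1` E1) `\` E1) = 0%E.
  apply: (@null_sub _ _ _ mu _ (((Phi @^-1` E1) `\` Ac) `|` (Ac `\` E1))).
  - exact: measurableD.
  - by apply: measurableU; exact: measurableD.
  - by move=> x [Px nEx]; have [Ax|nAx] := pselect (Ac x); [right|left].
  - by apply: null_setU => //; exact: measurableD.
have PEI : mu (Phi @^-1` E1 `&` E1) = mu E1.
  have := mu_Phi mE1; rewrite -[in LHS](setUIDK (Phi @^-1` E1) E1) measureU//.
  - by move=> <-; rewrite -[LHS]adde0; congr (_ + _)%E; exact: esym PE.
  - exact: measurableI.
  - exact: measurableD.
  - by apply/seteqP; split=> x // [[_ Ex] [_ /(_ Ex)]].
have E1oo : (mu E1 < +oo)%E by rewrite ltey_eq fin_num_measure.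
have EP : mu (E1 `\` Phi @^-1` E1) = 0%E.
  have h : mu (E1 `\` Phi @^-1` E1) = (mu E1 - mu (E1 `&` Phi @^-1` E1))%E := measureD mE1 mPE E1oo.
  by rewrite h setIC PEI subee// fin_num_measure.
by apply: null_setU => //; exact: measurableD.
Qed.

(** The shift turns the translation by [(A, 0)] into the one by [(ratio a b * A, 0)] and preserves
    [f]. *)
Let mu_E1_shift : mu (E1 `+` shift @^-1` E1) = 0%E.
Proof.
have m1 : measurable [set x | f (shift x) <> f x].
  by apply: mneq => //; exact: measurable_config_shift.
apply: (@null_sub _ _ _ mu _ (\bigcup_(s : K2) (tr s @^-1` [set x | f (shift x) <> f x]))).
- by apply: measurableY => //; exact: mshift.
- by apply: fin_bigcup_measurable => // s _; exact: mtr.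
- move=> x Ex; apply: contrapT => h.
  have fs s : f (tr (act s) (shift x)) = f (tr s x).
    rewrite -tr_shift; apply: contrapT => e; apply: h; exists s => //.
  have r0 := ratio_neq0 gen.
  have fx : f (shift x) = f x.
    by have := fs 0; rewrite (_ : act 0 = 0) ?tr0// /shift_act /= !mulr0 ?addr0 ?mulr0.
  have sX : X (shift x) <-> X x by rewrite -[X in _ <-> X x]X_markov.1.2.
  suff E1s : E1 (shift x) <-> E1 x.
    by case: Ex => [[E nE]|[E nE]]; apply: nE; [exact/E1s|exact/E1s].
  have fA A : f (tr (ratio a b * A, 0) (shift x)) = f (tr (A, 0) x).
    by rewrite -fs /shift_act /= addr0 mulr0.
  split=> [[/sX Xx fpos [A A0 fApos]]|[/sX Xx fpos [A A0 fApos]]].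
    split=> //; first by rewrite -fx.
    exists ((ratio a b)^-1 * A); first by rewrite mulf_neq0 ?invr_eq0.
    by rewrite -fA mulVKf.
  split=> //; first by rewrite fx.
  by exists (ratio a b * A); [rewrite mulf_neq0|rewrite fA].
- apply: null_bigcup_finType => s; first exact: mtr.
  exact: nu_null.
Qed.

(** Ergodicity wants a set strictly invariant under both maps: take the core for the shift, then the
    core for [Phi], which commutes with the shift. *)
Let mu_E1_01 : mu E1 = 0%E \/ mu E1 = 1%E.
Proof.
have mPE := mPhi mE1; have mSE := mshift mE1.
have PX x : X x -> X (Phi x) by exact: Phi_X.
have Phi_shift1 x : Phi (shift x) = shift (Phi x) by exact: (Phi_shift eta rho c 1 x).
have [mA1 A1X A1s] := inv_core_invariant mX (@measurable_config_shift G) shift_X mE1.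
set A1 := inv_core X shift E1 in mA1 A1X A1s.
have EA1 : mu (E1 `+` A1) = 0%E.
  have h := inv_core_mod mX mu_X (@measurable_config_shift G) mu_shift shift_X mE1.
  by apply: h.
have mY1 : measurable (E1 `+` A1) by exact: measurableY.
have A1Phi : mu (A1 `+` Phi @^-1` A1) = 0%E.
  apply: (@null_sub _ _ _ mu _ ((E1 `+` A1) `|` ((E1 `+` Phi @^-1` E1) `|`
      Phi @^-1` (E1 `+` A1)))).
  - by apply: measurableY => //; exact: mPhi.
  - by apply: measurableU => //; apply: measurableU; [exact: measurableY|exact: mPhi].
  - move=> x h; apply: contrapT => /not_orP[h1 /not_orP[h2 h3]].
    have iffE (S S' : set (config G)) y : ~ (S `+` S') y -> S y <-> S' y.
      by move=> n; split=> Sy; apply: contrapT => n'; apply: n; [left|right].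
    have e1 := iffE _ _ _ h1; have e2 := iffE _ _ _ h2; have e3 := iffE _ _ (Phi x) h3.
    have e : A1 x <-> A1 (Phi x) by rewrite -e1 -e3; exact: e2.
    by case: h => [[A1x n]|[A1x n]]; apply: n; exact/e.
  - apply: null_setU => //.
      by apply: measurableU; [exact: measurableY|exact: mPhi].
    apply: null_setU => //; [exact: measurableY|exact: mPhi|].
    exact: etrans (mu_Phi mY1) EA1.
have mPhi' : measurable_fun setT Phi by exact: measurable_block_map.
have [mA2 A2X A2P] := inv_core_invariant mX mPhi' PX mA1.
have A2s := inv_core_commute PX shift_X Phi_shift1 A1s.
set A2 := inv_core X Phi A1 in mA2 A2X A2P A2s.
have A12 : mu (A1 `+` A2) = 0%E.
  by have h := inv_core_mod mX mu_X mPhi' mu_Phi PX mA1; apply: h.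
have mu_eq (S S' : set (config G)) : measurable S -> measurable S' ->
    mu (S `+` S') = 0%E -> mu S = mu S'.
  have le (S1 S2 : set (config G)) : measurable S1 -> measurable S2 ->
      mu (S1 `+` S2) = 0%E -> (mu S1 <= mu S2)%E.
    move=> m1 m2 h; have mY := measurableY m1 m2.
    apply: (@le_trans _ _ (mu (S2 `|` (S1 `+` S2)))).
      apply: le_measure; rewrite ?inE//; first exact: measurableU.
      by move=> x S1x; have [|n] := pselect (S2 x); [left|right; left].
    have h' : (mu (S2 `|` (S1 `+` S2)) <= mu S2 + mu (S1 `+` S2))%E := measureU2 mu m2 mY.
    by rewrite h adde0 in h'.
  by move=> mS mS' h; apply/eqP; rewrite eq_le !le// setYC.
rewrite (mu_eq _ _ mE1 mA1 EA1) (mu_eq _ _ mA1 mA2 A12).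
by apply: mu_ergodic; split.
Qed.

Theorem injective_or_translation_invariant :
  (exists S, [/\ measurable S, mu S = 1%E, S `<=` X &
    forall x x', S x -> S x' -> Phi x = Phi x' -> x = x']) \/
  (forall A S, measurable S -> mu (translate (A, 0) @^-1` S) = mu S).
Proof.
have full S : measurable S -> mu (~` S) = 0%E -> mu S = 1%E.
  move=> mS S0; have := probability_setC mu (measurableC mS); rewrite setCK => ->.
  by rewrite S0 sube0.
case: mu_E1_01 => [E0|E1_1]; [left|right].
  (* Outside [E1] no two distinct points of positive density lie in one coset of [K1], that is, in
     one fiber. *)
  exists (X `&` P `&` ~` E1).
  have mS : measurable (X `&` P `&` ~` E1).
    by apply: measurableI; [exact: measurableI|exact: measurableC].
  split=> // [|x [[]]//|x x' [[Xx fx] nEx] [[Xx' fx'] _] xx'].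
    apply: full => //; apply: (@null_sub _ _ _ mu _ ((~` X `|` ~` P) `|` E1)).
    - exact: measurableC.
    - by apply: measurableU => //; apply: measurableU; exact: measurableC.
    - move=> x nx; apply: contrapT => /not_orP[/not_orP[/contrapT Xx /contrapT fx] nE].
      by apply: nx.
    - apply: null_setU => //; first by apply: measurableU; exact: measurableC.
      by apply: null_setU => //; exact: measurableC.
  have [A xA] := fiber_V p_prime etaD rhoD Phi_X gen Xx Xx' xx'.
  have [A0|A0] := eqVneq A 0.
    by rewrite xA A0 -[(0, 0)]/(0 : K2) (V0 p_prime gen) addr0.
  by exfalso; apply: nEx; split=> //; exists A => //; rewrite /tr -xA.
pose w (A : 'F_p) : K2 := (A, 0).
pose D (A : 'F_p) := [set x | f (tr (w A) x) <> f x].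
have mD A : measurable (D A) by apply: mneq => //; exact: measurable_translate.
have mu_D A : mu (D A) = 0%E.
  apply: (@null_sub _ _ _ mu _ (~` (Phi @^-1` E1) `|` ((Phi @^-1` E1) `\` Ac))) => //.
  - apply: measurableU; first by apply: measurableC; exact: mPhi.
    by apply: measurableD => //; exact: mPhi.
  - move=> x Dx; have [Ex|] := pselect ((Phi @^-1` E1) x); [right|by left].
    by split=> // -[_ fA]; apply: Dx; exact: fA.
  - apply: null_setU => //.
    + by apply: measurableC; exact: mPhi.
    + by apply: measurableD => //; exact: mPhi.
    + have : mu (~` (Phi @^-1` E1)) = (1 - mu (Phi @^-1` E1))%E.
        by rewrite probability_setC//; exact: mPhi.
      by rewrite mu_Phi// E1_1 subee.
(* Transport asks for nullity under [nu]. Inside [P] it follows from nullity under [mu]; outside [P]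
   the density is zero at [x], hence positive at the translate, which lies in [D (- A)] and in
   [P]. *)
have nu_D A : nu (D A) = 0%E.
  apply: (@null_sub _ _ _ nu _ ((D A `&` P) `|` tr (w A) @^-1` (D (- A) `&` P))) => //.
  - by apply: measurableU; [exact: measurableI|apply: mtr; exact: measurableI].
  - move=> x Dx; have [fx|fx] := pselect (P x); [by left|right].
    have fx0 : f x = 0.
      by apply/eqP; rewrite eq_le f0 andbT leNgt; exact/negP.
    split; last by rewrite /P /= lt0r f0 andbT -fx0; apply/eqP.
    rewrite /D /= (_ : w (- A) = - w A); last by congr pair; rewrite /= oppr0.
    by rewrite trK => e; apply: Dx.
  - apply: null_setU => //; [exact: measurableI|by apply: mtr; exact: measurableI| |].
      exact: nu_P.
    exact: etrans (nu_tr (w A) (measurableI _ _ (mD _) mP)) (nu_P (mD _) (mu_D _)).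
move=> A S mS.
have h := density_transport mf f0 fE (measurable_translate (- w A))
  (measurable_translate (w A)) (trNK (w A)) (@nu_tr (- w A)) _ mS.
apply: h; rewrite (_ : - w A = w (- A)); first exact: nu_D.
by congr pair; rewrite /= oppr0.
Qed.

End density_argument.

(** * Vanishing of the entropy *)

Lemma law_ae (R : realType) d (T : measurableType d) (mu : probability T R) (A : finType)
    (f g : T -> A) (S : set T) : fmeas f -> fmeas g -> measurable S -> mu S = 1%E ->
  (forall x, S x -> f x = g x) -> law mu f =1 law mu g.
Proof.
move=> mf mg mS S1 fg a; congr fine.
have mSC : mu (~` S) = 0%E by rewrite probability_setC// S1 subee.
have E (h : T -> A) : fmeas h -> mu (h @^-1` [set a]) = mu (h @^-1` [set a] `&` S).
  move=> mh; have mha := mh a.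
  have h1 : mu ((h @^-1` [set a] `&` S) `|` (h @^-1` [set a] `\` S)) =
      (mu (h @^-1` [set a] `&` S) + mu (h @^-1` [set a] `\` S))%E.
    apply: measureU; [exact: measurableI|exact: measurableD|].
    by apply/seteqP; split=> x // [[_ Sx] [_ /(_ Sx)]].
  have h0 : mu (h @^-1` [set a] `\` S) = 0%E.
    by apply: (@null_sub _ _ _ mu _ (~` S));
      [exact: measurableD|exact: measurableC|move=> x []|exact: mSC].
  by move: h1; rewrite setUIDK h0 adde0.
rewrite (E f mf) (E g mg); congr (mu _).
by apply/seteqP; split=> x [/= <- Sx]; split=> //=; rewrite fg.
Qed.

Lemma window_factor (G : pfinType) (A : Type) (F : config G -> A) n i :
  (forall x y, (forall j : int, i <= j < i + n%:Z -> x j = y j) -> F x = F y) ->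
  exists h, forall x, F x = h (window n i x).
Proof.
move=> FE; exists (fun t => F (fun j => nth point (tval t) (absz (j - i)))) => x.
apply: FE => j jn; rewrite window_nth; last by lia.
by congr (x _); lia.
Qed.

Section zero_entropy.
Context (R : realType) (G : pfinType) (phi : G -> G -> G).
Local Notation Phi := (block_map phi).
Context (sec : G -> config G -> config G).
Hypotheses (Phi_sec : forall g y, Phi (sec g y) = y).
Hypotheses (sec_Phi : forall x, sec (x 0) (Phi x) = x) (sec0 : forall g y, sec g y 0 = g).
Hypothesis sec_local : forall g y y' (n : nat),
  (forall j, - n%:Z <= j < n%:Z -> y j = y' j) -> agree n (sec g y) (sec g y').
Hypothesis measurable_sec : forall g, measurable_fun setT (sec g).
Context (mu : probability (config G) R).
Hypotheses (mu_Phi : invariant_measure mu Phi).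
Hypothesis mu_shift : invariant_measure mu (@config_shift G).

Lemma Phi_itin_local l n : exists h, forall x,
  itin Phi (@centered G l) n x = h (window (l.*2.+1 + n) (- l%:Z) x).
Proof.
apply: window_factor => x y xy; apply/ffunP => i; rewrite !ffunE.
have iterE (k : nat) : (k <= n)%N -> forall j : int, - l%:Z <= j < l%:Z + (n - k)%N%:Z + 1 ->
    iter k Phi x j = iter k Phi y j.
  elim: k => [|k IH] kn j jn; first by apply: xy; lia.
  by rewrite !iterS /block_map !IH//; lia.
apply: agree_centered => j jl; apply: iterE; first exact: ltnW.
by have := ltn_ord i; lia.
Qed.

Lemma Phi_invariant_comp (A : finType) (P : config G -> A) : fmeas P ->
  fmeas (P \o Phi) /\ ent mu (P \o Phi) = ent mu P.
Proof.
move=> mP; have mPhi : measurable_fun setT Phi by exact: measurable_block_map.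
have h1 := fmeas_iter mPhi 1 mP; have h2 := ent_iter mPhi mu_Phi 1 mP.
by split; [exact: h1|exact: h2].
Qed.

(* The letter [x 0] and the word of [Phi x] on [-n, n) determine [x] on [-n, n]. *)
Lemma block_ent_increment_Phi n :
  block_ent mu n.*2.+1 - block_ent mu n.*2 <=
  cent mu (coord 0) (window n.*2 (- n%:Z) \o Phi).
Proof.
have mw : fmeas (@window G n.*2 (- n%:Z)) by exact: fmeas_window.
have [mwP eP] := Phi_invariant_comp mw.
rewrite /cent eP (ent_window mu_shift) lerD2r -(ent_window mu_shift _ (- n%:Z)).
have [h hE] : exists h : G -> n.*2.-tuple G -> n.*2.+1.-tuple G,
    forall g y, centered n (sec g y) = h g (window n.*2 (- n%:Z) y).
  have hP g : {h | forall y, centered n (sec g y) = h (window n.*2 (- n%:Z) y)}.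
    apply: cid; apply: window_factor => y y' yy'; apply: agree_centered.
    by apply: sec_local => j jn; apply: yy'; lia.
  by exists (fun g => sval (hP g)) => g y; rewrite (svalP (hP g)).
apply: (ent_factor mu (h := fun t => h t.1 t.2)).
  by apply: fmeas_joint => //; exact: fmeas_coord.
by move=> x; rewrite /joint /= -hE /coord sec_Phi.
Qed.

(** Each [y] has at most one preimage in [S], whose letter at [0] is a function [kappa] of [y]. A
    long window of the image thus leaves little uncertainty on [x 0], and this uncertainty bounds
    the entropy. *)
Lemma Phi_entropy_zero (S : set (config G)) : measurable S -> mu S = 1%E ->
  (forall x x', S x -> S x' -> Phi x = Phi x' -> x = x') ->
  (measure_entropy mu Phi <= 0)%E.
Proof.
move=> mS S1 S_inj; apply/lee_addgt0Pr => e e0; rewrite add0e.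
pose B g := sec g @^-1` S.
have mB g : measurable (B g).
  by rewrite -[X in measurable X]setTI; exact: measurable_sec.
pose ind (y : config G) : {ffun G -> bool} := [ffun g => `[< B g y >]].
have mind : fmeas ind.
  move=> w; rewrite (_ : _ @^-1` _ =
      \bigcap_(g in [set: G]) (if w g then B g else ~` B g)).
    apply: fin_bigcap_measurable => // g _; case: (w g) => //; exact: measurableC.
  apply/seteqP; split=> y /=.
    by move=> <- g _; rewrite ffunE; case: asboolP.
  move=> h; apply/ffunP => g; rewrite ffunE; have := h g I.
  by case: (w g) => h'; [apply/asboolP|apply/asboolPn].
pose kappa y := odflt point [pick g | ind y g].
have mkappa : fmeas kappa.
  by apply: (@fmeas_comp _ _ _ _ (fun w : {ffun G -> bool} => odflt point [pick g | w g]) ind).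
have kappaE x : S x -> coord 0 x = kappa (Phi x).
  move=> Sx; rewrite /kappa; case: pickP => [g|/(_ (x 0))].
    rewrite ffunE => /asboolP Bg; rewrite /coord.
    have := S_inj _ _ Sx Bg; rewrite Phi_sec => /(_ erefl) ->.
    by rewrite sec0.
  by rewrite ffunE => /asboolP; rewrite /B /preimage /= sec_Phi.
have [n /(_ n (leqnn n)) small] := cent_centered mu mkappa e0.
apply: le_trans (_ : _ <= (cent mu kappa (centered n))%:E)%E _; last by rewrite lee_fin.
(* The half-open window [-m, m) has to contain [-n, n]. *)
pose m := n.+1.
apply: le_trans (measure_entropy_increment mu_shift m.*2 (@measurable_block_map G phi) mu_Phi Phi_itin_local) _.
rewrite lee_fin; apply: le_trans (block_ent_increment_Phi m) _.
have mw : fmeas (@window G m.*2 (- m%:Z)) by exact: fmeas_window.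
have [mwP eP] := Phi_invariant_comp mw.
have [mkP _] := Phi_invariant_comp mkappa.
have mc0 : fmeas (@coord G 0) by exact: fmeas_coord.
have [_ ekw] := Phi_invariant_comp (fmeas_joint mkappa mw).
have -> : cent mu (coord 0) (window m.*2 (- m%:Z) \o Phi) = cent mu kappa (window m.*2 (- m%:Z)).
  rewrite /cent eP; congr (_ - _); rewrite -ekw /ent; congr H; apply/funext.
  apply: (law_ae (S := S)) => //; [exact: fmeas_joint|exact: fmeas_joint mkP mwP|].
  by move=> x Sx; rewrite /joint /= kappaE.
have [k kE] : exists k : m.*2.-tuple G -> n.*2.+1.-tuple G, forall x, centered n x = k (window m.*2 (- m%:Z) x).
  apply: (window_factor (F := centered n)) => x y xy.
  by apply: agree_centered => j jn; apply: xy; rewrite /m; lia.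
exact: cent_factor kE.
Qed.

End zero_entropy.

(** * Translation-invariant measures *)

Lemma measure_bigcup_finType d (T : measurableType d) (R : realType) (mu : probability T R)
    (I : finType) (F : I -> set T) :
  (forall i, measurable (F i)) -> (forall i j x, F i x -> F j x -> i = j) ->
  fine (mu (\bigcup_i F i)) = \sum_i fine (mu (F i)).
Proof.
move=> mF F_inj; apply: EFin_inj; rewrite fineK ?fin_num_measure//; last first.
  exact: fin_bigcup_measurable.
rewrite -sumEFin; under eq_bigr do rewrite fineK ?fin_num_measure//.
rewrite measure_fin_bigcup//; last 2 first.
- exact: finite_finset.
- by move=> i j _ _ [x [Fi Fj]]; exact: F_inj Fi Fj.
rewrite [RHS]fsbig_seq ?index_enum_uniq// (_ : [set` index_enum I] = setT)//.
by apply/seteqP; split=> i // _; exact: mem_index_enum.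
Qed.

Section translations.
Context (R : realType) (G : abelianAlphabet) (X : set (config G)).
Context (eta rho : G -> G) (c : G) (p : nat) (p_prime : prime p).
Context (N : nat) (z : config G) (a b : 'F_p).
Let phi g h := eta g + rho h + c.
Local Notation Phi := (block_map phi).
Local Notation V := (V N z a b).
Local Notation conv := (conv (p := p) N z).
Local Notation shift := (@config_shift G).
Hypotheses (eta_bij : bijective eta) (rho_bij : bijective rho).
Hypotheses (etaD : {morph eta : x y / x + y}) (rhoD : {morph rho : x y / x + y}).
Hypotheses (X_markov : is_markov_chain X) (Phi_X : is_cellular_automaton X phi).
Hypothesis gen : shift_generator X eta rho N z a b.
Context (mu : probability (config G) R) (mu_X : mu X = 1%E).
Hypotheses (mu_Phi : invariant_measure mu Phi) (mu_shift : invariant_measure mu shift).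

Definition preserved_by (v : config G) : Prop :=
  forall S, measurable S -> mu ((fun x => x + v) @^-1` S) = mu S.

Let measurable_add v S : measurable S -> measurable ((fun x : config G => x + v) @^-1` S).
Proof.
move=> mS; rewrite -[X in measurable X]setTI.
suff : measurable_fun setT (fun x : config G => x + v) by exact.
apply: measurable_config_fun => i g.
rewrite (_ : mkset _ = [set x : config G | x i = g - v i]); first exact: measurable_coord.
by apply/seteqP; split=> x /=; rewrite configD; [move=> <-; rewrite addrK|move=> ->; rewrite subrK].
Qed.

Let mX : measurable X := measurable_markov X_markov.

Let mu_setIX S : measurable S -> mu (S `&` X) = mu S.
Proof.
move=> mS; rewrite -[in RHS](setUIDK S X) measureU.
- rewrite [X in (_ + X)%E](null_outside X_markov mu_X) ?adde0//; first exact: measurableD.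
  by move=> x Xx [].
- exact: measurableI.
- exact: measurableD.
- by apply/seteqP; split=> x // [[_ Xx] [_ /(_ Xx)]].
Qed.

Lemma preserved_by0 : preserved_by 0.
Proof. by move=> S mS; congr (mu _); apply/seteqP; split=> x; rewrite /preimage /= addr0. Qed.

Lemma preserved_by_shift n v : preserved_by v -> preserved_by (shift_by n v).
Proof.
move=> vI S mS.
have mSn : measurable (shift_by n @^-1` S).
  by rewrite -[X in measurable X]setTI; exact: measurable_shift_by.
rewrite -[RHS](shift_by_invariant mu_shift n mS) -(vI _ mSn).
rewrite -(shift_by_invariant mu_shift n (measurable_add _ mS)).
by congr (mu _); apply/seteqP; split=> x.
Qed.

Section pull_back.
Hypothesis succ_card : forall g, #|[set h | edge X g h]%SET| = p.
Hypothesis K1_preserves : forall A, preserved_by (V (A, 0)).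

(* [B := sec g @^-1` T] is the image of [T] under [Phi], and the fibers of [Phi]
   in [X] are the cosets of [V (A, 0)], which has [p] elements. *)
Lemma preserved_by_fibers (T : set (config G)) g : measurable T ->
  (forall x, T x -> X x /\ x 0 = g) -> exists B, measurable B /\
  forall d, fine (mu ((fun x => Phi (x + conv d)) @^-1` B)) =
    p%:R * fine (mu ((fun x => x + conv d) @^-1` T)).
Proof.
move=> mT TP; have [sec [Phi_sec sec_Phi sec0 sec_local]] := Phi_section_exists c eta_bij rho_bij.
have msec : measurable_fun setT (sec g) by apply: measurable_section; exact: sec_local.
have mB : measurable (sec g @^-1` T) by rewrite -[X in measurable X]setTI; exact: msec.
exists (sec g @^-1` T); split=> // e; set v := conv e.
have lV A : linear_part eta rho (V (A, 0)) = 0.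
  rewrite (linear_part_V p_prime etaD rhoD gen) /= mulr0; exact: (V0 p_prime gen).
pose F A := (fun x => x + (v + V (A, 0))) @^-1` T.
have mF A : measurable (F A) by exact: measurable_add.
have FE A x : F A x -> sec g (Phi (x + v)) = x + (v + V (A, 0)).
  move=> Fx; have [_ xg] := TP _ Fx; rewrite -[RHS]sec_Phi xg addrA.
  by rewrite [in RHS](Phi_add _ etaD rhoD) lV addr0.
have mL : measurable ((fun x => Phi (x + v)) @^-1` (sec g @^-1` T)).
  have mPB : measurable (Phi @^-1` (sec g @^-1` T)).
    by rewrite -[X in measurable X]setTI; exact: measurable_block_map.
  exact: measurable_add mPB.
have -> : mu ((fun x => Phi (x + v)) @^-1` (sec g @^-1` T)) = mu (\bigcup_A F A).
  rewrite -(mu_setIX mL) -[RHS]mu_setIX; last exact: fin_bigcup_measurable.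
  congr (mu _); apply/seteqP; split=> x [Fx Xx]; split=> //.
    have [Xs _] := TP _ Fx; have Xv : X (x + v) by exact: gen_stable gen _ _ Xx.
    have [A xA] := fiber_V p_prime etaD rhoD Phi_X gen Xv Xs (esym (Phi_sec _ _)).
    by exists A => //; rewrite /F /preimage /= addrA -xA.
  by have [A _ FA] := Fx; rewrite /preimage /= (FE A).
rewrite measure_bigcup_finType//.
  transitivity (\sum_(A : 'F_p) fine (mu ((fun x => x + v) @^-1` T))).
    apply: eq_bigr => A _; congr fine.
    rewrite -(K1_preserves A (measurable_add v mT)); congr (mu _).
    by apply/seteqP; split=> x; rewrite /F /preimage /= addrA addrAC.
  by rewrite sumr_const card_Fp// mulr_natl.
move=> A A' x FA FA'; have := FE _ _ FA; rewrite (FE _ _ FA') => /addrI/addrI AA.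
apply/eqP; rewrite -subr_eq0; apply/eqP/(V_inj0 gen).
have -> : (A - A', 0) = (A, 0) + - (A', 0) :> 'F_p * 'F_p.
  by congr pair; rewrite /= oppr0 addr0.
by rewrite (V_add p_prime gen) (V_opp p_prime gen) AA subrr.
Qed.

(** Among the points with a given letter at [0], the mass of a set translated by [conv d] is the
    [p]-th part of the mass of a preimage under [Phi], where the translation acts through its linear
    part. The untranslated set is the case [d = 0]. *)
Lemma preserved_by_pull_back d : preserved_by (linear_part eta rho (conv d)) ->
  preserved_by (conv d).
Proof.
move=> dI S mS.
have Phi_d B e : measurable B -> preserved_by (linear_part eta rho (conv e)) ->
    mu ((fun x => Phi (x + conv e)) @^-1` B) = mu B.
  move=> mB eI; rewrite -(eI _ mB) -(mu_Phi (measurable_add _ mB)).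
  by congr (mu _); apply/seteqP; split=> x; rewrite /preimage /= (Phi_add _ etaD rhoD).
have l0 : linear_part eta rho (conv (fun=> 0)) = 0.
  rewrite (linear_part_conv p_prime etaD rhoD gen) -[RHS](conv0 p N z).
  by congr conv; apply/funext => i; rewrite !mulr0 addr0.
pose T g := S `&` X `&` [set x | x 0 = g].
have mT g : measurable (T g).
  by apply: measurableI; [exact: measurableI|exact: measurable_coord].
have piece g : fine (mu ((fun x => x + conv d) @^-1` T g)) = fine (mu (T g)).
  have TP x : T g x -> X x /\ x 0 = g by move=> [[]].
  have [B [mB BT]] := preserved_by_fibers (mT g) TP.
  have p0 : p%:R != 0 :> R by rewrite pnatr_eq0 -lt0n prime_gt0.
  apply: (mulfI p0); rewrite -BT Phi_d//.
  rewrite -(Phi_d _ (fun=> 0) mB); last by rewrite l0; exact: preserved_by0.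
  rewrite BT conv0; congr (_ * fine _); apply: preserved_by0; exact: mT.
have sumT e : (forall x, X x -> X (x + e)) ->
    fine (mu ((fun x => x + e) @^-1` S)) = \sum_g fine (mu ((fun x => x + e) @^-1` T g)).
  move=> eX; rewrite -measure_bigcup_finType.
  - rewrite -(mu_setIX (measurable_add e mS)) -[in RHS]mu_setIX.
      congr (fine (mu _)); apply/seteqP; split=> x [Sx Xx]; split=> //.
        by exists ((x + e) 0) => //; split=> //; split=> //; exact: eX.
      by have [g _ [[]]] := Sx.
    by apply: fin_bigcup_measurable => // g _; exact: measurable_add.
  - by move=> g; exact: measurable_add.
  - by move=> g h x [_ <-] [_ <-].
have fin B : measurable B -> mu B = (fine (mu B))%:E by move=> mB; rewrite fineK ?fin_num_measure.
rewrite (fin _ (measurable_add _ mS)) (fin _ mS); congr (_%:E).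
rewrite sumT; last by move=> x; exact: gen_stable gen _ _.
under eq_bigr do rewrite piece.
transitivity (fine (mu ((fun x => x + 0) @^-1` S))); last by rewrite preserved_by0.
rewrite sumT; last by move=> x; rewrite addr0.
by apply: eq_bigr => g _; rewrite preserved_by0.
Qed.

(** Solving the recurrence of the linear part from the exact value at [0] lifts a sequence that is
    right at [n] indices to one that is right at [n + 1]; [preserved_by_pull_back] lifts the
    invariance. *)
Lemma preserved_by_approx n (d : int -> 'F_p) : exists d' : int -> 'F_p,
  (forall i : nat, (i < n)%N -> d' i = d i) /\ preserved_by (conv d').
Proof.
elim: n d => [|n IH] d.
  by exists (fun=> 0); split=> //; rewrite conv0; exact: preserved_by0.
have [e [eE eI]] := IH (fun i => a * d i + b * d (i + 1)).
pose fwd (i : int) h := (e i - a * h) / b; pose bwd (i : int) h := (e i - b * h) / a.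
have a0 := gen_a_neq0 gen; have b0 := gen_b_neq0 gen.
pose d' := solve fwd bwd (d 0).
have d'P i : a * d' i + b * d' (i + 1) = e i.
  apply: (solveP (d 0) (rel := fun i h h' => a * h + b * h' = e i)) => j h.
    by rewrite /fwd mulrC [b * _]mulrC divfK// mulrC addrC subrK.
  by rewrite /bwd [a * _]mulrC divfK// subrK.
exists d'; split; last first.
  apply: preserved_by_pull_back; rewrite (linear_part_conv p_prime etaD rhoD gen).
  by congr preserved_by: eI; congr conv; apply/funext => i; rewrite d'P.
elim=> [//|i IHi] ni; apply: (mulfI b0); apply: (addrI (a * d' i)).
have -> : i.+1%:Z = i%:Z + 1 by lia.
by rewrite d'P eE// IHi// ltnW.
Qed.

Lemma translations_split_evenly : splits_evenly X p mu.
Proof.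
have N0 : (0 < N)%N.
  rewrite lt0n; apply/eqP => N0; have conv1 : conv (fun=> 1) = 0.
    by apply/funext => i; rewrite /conv big1// => k; have := ltn_ord k; rewrite [X in (_ < X)%N]N0.
  by have /(congr1 (fun d => d 0))/eqP := gen_inj gen conv1; rewrite oner_eq0.
move=> n t g tg; pose q h := law mu (joint (window n.+1 0) (coord n.+1%:Z)) (t, h).
have qE h : edge X (tnth t ord_max) h -> q h = q g.
  move=> th; have [k hk] := gen_succ gen tg th.
  (* Only nonnegative indices are controlled, while [conv] looks back [N - 1] indices. So the
     impulse [k] is placed at [n + 1 + N] and the translation is shifted by [N]: it vanishes on
     [0, n] and is [z 0 *+ k] at [n + 1]. *)
  have [d [dE dI]] := preserved_by_approx (n.+2 + N)
    (fun i => if i == (n.+1 + N)%N%:Z then k%:R else 0).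
  pose w := shift_by N%:Z (conv d).
  have d0 (i : int) : 1 <= i < (n.+1 + N)%N%:Z -> d i = 0.
    move=> iN; rewrite (_ : i = `|i|%N%:Z); last by lia.
    rewrite dE; last by lia.
    by rewrite ifF//; apply/eqP; lia.
  have w0 (i : nat) : (i < n.+1)%N -> w i = 0.
    move=> i_n; rewrite /w /shift_by /conv big1// => j _; rewrite d0 ?mulr0n//.
    by have := ltn_ord j; lia.
  have wn : w n.+1%:Z = z 0 *+ k.
    rewrite /w /shift_by /conv (bigD1 (Ordinal N0))//= big1 ?addr0; last first.
      move=> j /eqP j0; rewrite d0 ?mulr0n//.
      have : (j : nat) != 0%N by apply/eqP => j0'; apply: j0; exact: val_inj.
      by have := ltn_ord j; lia.
    rewrite (_ : n.+1%:Z + N%:Z = (n.+1 + N)%N%:Z); last by lia.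
    rewrite dE; last by lia.
    by rewrite eqxx mulrFp_nat//; exact: gen_torsion gen _.
  have mS : fmeas (joint (@window G n.+1 0) (coord n.+1%:Z)).
    by apply: fmeas_joint; [exact: fmeas_window|exact: fmeas_coord].
  congr fine; rewrite -(preserved_by_shift N%:Z dI (mS (t, h))); congr (mu _).
  rewrite -/w; apply/seteqP; split=> x; rewrite /preimage /joint /= => e.
    have e1 := congr1 fst e; have e2 := congr1 snd e; rewrite /= in e1 e2.
    congr pair.
      rewrite -e1; apply: eq_from_tnth => j; rewrite !tnth_mktuple configD add0r.
      by rewrite w0 ?addr0.
    by move: e2; rewrite /coord configD wn hk => /addIr.
  have e1 := congr1 fst e; have e2 := congr1 snd e; rewrite /= in e1 e2.
  congr pair.
    rewrite -e1; apply: eq_from_tnth => j; rewrite !tnth_mktuple configD add0r.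
    by rewrite w0 ?addr0.
  by move: e2; rewrite /coord configD wn hk => ->.
rewrite -(law_window_sum mu t) (bigID (edge X (tnth t ord_max))) /=.
rewrite [X in _ + X]big1 ?addr0; last first.
  by move=> h; exact: law_not_edge.
rewrite (eq_bigr (fun=> q g)); last by move=> h; exact: qE.
have card_p : #|edge X (tnth t ord_max)| = p.
  by rewrite -(succ_card (tnth t ord_max)) cardsE.
by rewrite sumr_const card_p -[_ *+ p]mulr_natr mulfK// pnatr_eq0 -lt0n prime_gt0.
Qed.

End pull_back.
End translations.

(** * The theorem for an alphabet with a chosen group law *)

Lemma affine_parry (R : realType) (G : abelianAlphabet) (X : set (config G)) (p : nat)
    (eta rho : G -> G) (c : G) (phi := fun g h : G => eta g + rho h + c)
    (mu : probability (config G) R) :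
  is_markov_chain X -> irreducible_shift X -> uses_all_letters X -> prime p ->
  topological_entropy R X (@config_shift G) = (ln p%:R)%:E ->
  is_cellular_automaton X phi -> structurally_compatible X phi ->
  is_automorphism +%R eta -> is_automorphism +%R rho ->
  mu X = 1%E -> invariant_measure mu (block_map phi) ->
  invariant_measure mu (@config_shift G) ->
  ergodic_action X mu (block_map phi) (@config_shift G) ->
  (0 < measure_entropy mu (block_map phi))%E ->
  coincide_mod mu (invariant_sets X (iter ((p - 1) * p)%N (@config_shift G)))
                  (invariant_sets X (@config_shift G)) ->
  is_parry_measure X mu.
Proof.
move=> X_markov X_irreducible X_letters p_prime X_entropy phi_CA phi_comp.
move=> [eta_bij etaD] [rho_bij rhoD] mu_X mu_Phi mu_shift mu_ergodic mu_entropy mu_inv.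
have eta_inj := bij_inj eta_bij; have rho_inj := bij_inj rho_bij.
have E_succ g := (letter_edges X_markov X_letters g).1.
pose k := #|[set b | edge X 0 b]%SET|.
have succ_k g : #|[set b | edge X g b]%SET| = k.
  by rewrite /k !(card_succ eta_inj rho_inj (compatible_edge phi_comp) E_succ).
have k_gt0 : (0 < k)%N.
  by have [g g0] := E_succ 0; apply/card_gt0P; exists g; rewrite inE.
(* All letters have [k] successors, so the topological entropy is [ln k]. *)
have kp : k = p.
  have : (ln k%:R)%:E = (ln p%:R)%:E :> \bar R.
    rewrite -X_entropy; apply/eqP.
    by rewrite eq_le topological_entropy_ge// topological_entropy_le.
  have pos n : (0 < n)%N -> (n%:R : R) \is Num.pos by rewrite posrE ltr0n.
  move=> [lnkp]; apply/eqP; rewrite -(eqr_nat R); apply/eqP.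
  by apply: ln_inj => //; apply: pos => //; exact: prime_gt0.
have succ_card g : #|[set b | edge X g b]%SET| = p by rewrite succ_k.
have [N [z [a [b gen]]]] := exists_shift_generator p_prime eta_inj rho_inj etaD rhoD
  X_markov X_irreducible X_letters phi_comp succ_card.
have [[S [mS S1 _ S_inj]]|K1_preserves] := injective_or_translation_invariant p_prime
    eta_bij rho_bij etaD rhoD X_markov phi_CA gen mu_X mu_Phi mu_shift mu_ergodic mu_inv.
  have [sec [Phi_sec sec_Phi sec0 sec_local]] := Phi_section_exists c eta_bij rho_bij.
  have msec g := measurable_section (sec_local g).
  have := Phi_entropy_zero Phi_sec sec_Phi sec0 sec_local msec mu_Phi mu_shift mS S1 S_inj.
  by rewrite leNgt mu_entropy.
apply: (splits_evenly_parry X_markov X_irreducible X_letters (prime_gt0 p_prime) succ_card) => //.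
  exact: (card_pred_edge eta_inj rho_inj X_markov X_letters phi_comp succ_card).
exact: (translations_split_evenly p_prime eta_bij rho_bij etaD rhoD X_markov phi_CA gen
  mu_X mu_Phi mu_shift succ_card K1_preserves).
Qed.

Theorem theorem7p2 (R : realType) (G : pfinType) (X : set (config G)) (p : nat)
    (phi : G -> G -> G) (mu : probability (config G) R)
    (X_markov : is_markov_chain X)
    (X_irreducible : irreducible_shift X)
    (X_letters : uses_all_letters X)
    (p_prime : prime p)
    (X_entropy : topological_entropy R X (@config_shift G) = (ln p%:R)%:E)
    (phi_CA : is_cellular_automaton X phi)
    (phi_compatible : structurally_compatible X phi)
    (phi_affine : is_affine phi)
    (mu_X : mu X = 1%E)
    (mu_Phi : invariant_measure mu (block_map phi))
    (mu_shift : invariant_measure mu (@config_shift G))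
    (mu_ergodic : ergodic_action X mu (block_map phi) (@config_shift G))
    (mu_entropy : (0 < measure_entropy mu (block_map phi))%E)
    (mu_invariants :
      coincide_mod mu (invariant_sets X (iter ((p - 1) * p)%N (@config_shift G)))
                      (invariant_sets X (@config_shift G))) :
  is_parry_measure X mu.
Proof.
have [add [eta [rho [c [add_group eta_aut rho_aut _ phiE]]]]] := phi_affine.
have phi_eq : phi = (fun g h => add (add (eta g) (rho h)) c).
  by apply/funext => g; apply/funext => h; exact: phiE.
(* Everything that depends on the alphabet is generalized, since the induction principle replaces
   the alphabet together with its law. *)
subst phi; clear phiE phi_affine; move: G add add_group X mu eta rho c X_markov X_irreducible
  X_letters X_entropy phi_CA phi_compatible mu_X mu_Phi mu_shift mu_ergodic mu_entropy
  mu_invariants eta_aut rho_aut.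
apply: abelian_alphabet_ind => G X mu eta rho c; intros.
exact: (affine_parry (c := c) (eta := eta) (rho := rho) (p := p)).
Qed.
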